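(* Let $X$ be a complex Banach space, let $-1<\gamma<0$, $0<\omega<\pi/2$, and let $A(\tau)\in\Theta_\omega^\gamma(X)$ for each $\tau\ge0$. Let $\phi:[0,+\infty)\to[0,+\infty)$ be continuous with $\phi(t)>0$ for $t>0$. Then the solution operator of the abstract Cauchy problem $$u_t(t)=\phi(t)A(\tau)u(t),\quad t>0,\ \tau\ge0,\qquad u(0)=u_0\in X,$$ is $$T_{A(\tau),\phi}(t)=T_{A(\tau)}\left(\int_0^t\phi(s)\,ds\right),\quad t\ge0,\ \tau\ge0.$$
   Context: Sectors: for $0<\mu<\pi$, $S_\mu=\{z\in\mathbb{C}\setminus\{0\}:|\arg z|\le\mu\}\cup\{0\}$, with $\arg$ valued in $(-\pi,\pi]$. Almost sectorial operators depending on $\tau$: for $-1<\gamma<0$ and $0\le\omega<\pi$, closed linear operators $A(\tau):D(A(\tau))\subset X\to X$, $\tau\ge0$, belong to $\Theta_\omega^\gamma(X)$ if (a) $\sigma(A(\tau))\subset S_\omega$; (b) for every $\omega<\mu<\pi$ there is $C_\mu>0$, independent of $\tau$, with $\|(z-A(\tau))^{-1}\|\le C_\mu|z|^\gamma$ for all $z\notin S_\mu$. The variables $t$ and $\tau$ do not have to be related; the evolution is with respect to $t$. Path: for $0<\theta<\pi$, $\Gamma_\theta=\{\rho e^{-i\theta}:\rho>0\}\cup\{\rho e^{i\theta}:\rho>0\}$, oriented so that the sector $\{z\neq 0: |\arg z|<\theta\}$ lies to its left. Semigroup: for $t>0$, $T_{A(\tau)}(t)=\frac{1}{2\pi i}\int_{\Gamma_\theta}e^{-tz}(z-A(\tau))^{-1}dz$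 with $\omega<\theta<\frac{\pi}{2}$, a bounded operator on $X$; and $T_{A(\tau)}(0)=I$. The solution operator of the problem is the family of operators sending the initial datum $u_0$ to the classical solution $u(t)$, where a classical solution is a function $u\in C([0,+\infty);X)\cap C^1((0,+\infty);X)$ with $u(t)\in D(A(\tau))$ for $t>0$ which satisfies the equation and the initial condition.
   Formalization: The equation is proved with sign u_t = -φ(t)A(τ)u; as printed it fails for X=C, A=1. Not every u_0 in X has a classical solution: T(∫φ)u_0 solves the equation for t>0 for all u_0, equals every classical solution, and is one when u_0 is in D(A(τ)) or when it is continuous at 0. *)

(* Defs.v *)
From Stdlib Require Import Reals Lra.
From Coquelicot Require Import Coquelicot.
Open Scope R_scope.

Set Implicit Arguments.

(** Restriction of scalars from [C] to [R].  Coquelicot's Riemann integral and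
    derivative with respect to a real variable take values in modules over
    [R_AbsRing]; [real_space X] has the same carrier, addition, topology and
    norm as [X]. *)

Section RestrictScalars.
Variable X : CompleteNormedModule C_AbsRing.

Definition real_scal (r : R) (x : X) : X := scal (RtoC r) x.

Lemma real_scal_assoc (r s : R) (x : X) :
  real_scal r (real_scal s x) = real_scal (mult r s) x.
Proof.
  unfold real_scal. rewrite scal_assoc. f_equal. exact (eq_sym (RtoC_mult r s)).
Qed.

Lemma real_scal_one (x : X) : real_scal one x = x.
Proof. exact (scal_one x). Qed.

Lemma real_scal_distr_l (r : R) (x y : X) :
  real_scal r (plus x y) = plus (real_scal r x) (real_scal r y).
Proof. exact (scal_distr_l (RtoC r) x y). Qed.

Lemma real_scal_distr_r (r s : R) (x : X) :
  real_scal (plus r s) x = plus (real_scal r x) (real_scal s x).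
Proof.
  refine (eq_trans _ (scal_distr_r (RtoC r) (RtoC s) x)).
  unfold real_scal. f_equal. exact (RtoC_plus r s).
Qed.

Lemma norm_real_scal (r : R) (x : X) : norm (real_scal r x) <= abs r * norm x.
Proof.
  refine (Rle_trans _ _ _ (@norm_scal C_AbsRing X (RtoC r) x) _).
  change (Cmod (RtoC r) * norm x <= Rabs r * norm x).
  rewrite Cmod_R. apply Rle_refl.
Qed.

Definition real_ModuleSpace_mixin :=
  ModuleSpace.Mixin R_AbsRing X real_scal
    real_scal_assoc real_scal_one real_scal_distr_l real_scal_distr_r.

Definition real_NormedModuleAux_class :
  NormedModuleAux.class_of R_AbsRing X :=
  NormedModuleAux.Class R_AbsRing X
    (ModuleSpace.Class R_AbsRing X
       (AbelianGroup.class X) real_ModuleSpace_mixin)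
    (UniformSpace.class X).

Definition real_NormedModule_mixin :
  NormedModule.mixin_of R_AbsRing
    (NormedModuleAux.Pack R_AbsRing X real_NormedModuleAux_class X) :=
  NormedModule.Mixin R_AbsRing
    (NormedModuleAux.Pack R_AbsRing X real_NormedModuleAux_class X)
    (@norm C_AbsRing X) (@norm_factor C_AbsRing X)
    (@norm_triangle C_AbsRing X) norm_real_scal
    (@norm_compat1 C_AbsRing X) (@norm_compat2 C_AbsRing X)
    (@norm_eq_zero C_AbsRing X).

Definition real_space : CompleteNormedModule R_AbsRing :=
  CompleteNormedModule.Pack R_AbsRing X
    (CompleteNormedModule.Class R_AbsRing X
       (NormedModule.Class R_AbsRing X
          real_NormedModuleAux_class real_NormedModule_mixin)
       (CompleteNormedModule.mixin _ _ (CompleteNormedModule.class _ X)))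
    X.

End RestrictScalars.

Definition Cexp (z : C) : C := (exp (Re z) * cos (Im z), exp (Re z) * sin (Im z)).

Definition cis (theta : R) : C := (cos theta, sin theta).

(** [theta] is the principal argument of [z]. *)
Definition is_arg (z : C) (theta : R) : Prop :=
  z <> 0%C /\ - PI < theta <= PI /\ z = (RtoC (Cmod z) * cis theta)%C.

Definition sector (mu : R) (z : C) : Prop :=
  z = 0%C \/ exists theta, is_arg z theta /\ Rabs theta <= mu.

(** Linear operators defined on a subspace.  The values of [op] outside [dom]
    are irrelevant. *)
Record operator (X : CompleteNormedModule C_AbsRing) := Operator {
  dom : X -> Prop;
  op :> X -> X;
  dom_zero : dom zero;
  dom_plus : forall x y, dom x -> dom y -> dom (plus x y);
  dom_scal : forall (k : C) x, dom x -> dom (scal k x);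
  op_plus : forall x y, dom x -> dom y -> op (plus x y) = plus (op x) (op y);
  op_scal : forall (k : C) x, dom x -> op (scal k x) = scal k (op x)
}.

Section Operators.
Variable X : CompleteNormedModule C_AbsRing.

Definition closed_operator (A : operator X) : Prop :=
  closed (fun p : X * X => dom A (fst p) /\ A (fst p) = snd p).

(** [y] solves [(z - A) y = x]. *)
Definition resolvent_eq (A : operator X) (z : C) (x y : X) : Prop :=
  dom A y /\ minus (scal z y) (A y) = x.

(** [(z - A)^{-1}]; meaningful when [z - A] is a bijection from its domain
    onto [X]. *)
Definition resolvent (A : operator X) (z : C) (x : X) : X :=
  iota (resolvent_eq A z x).

Definition resolvent_set (A : operator X) (z : C) : Prop :=
  (forall x, exists! y, resolvent_eq A z x y) /\
  is_linear (resolvent A z).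

Definition spectrum (A : operator X) (z : C) : Prop := ~ resolvent_set A z.

(** The class [Theta_omega^gamma(X)] for a family indexed by [tau >= 0]; the
    constant [Cmu] does not depend on [tau].  The operator-norm bound on the
    resolvent is written pointwise. *)
Definition almost_sectorial (gamma omega : R) (A : R -> operator X) : Prop :=
  (forall tau, 0 <= tau -> closed_operator (A tau)) /\
  (forall tau, 0 <= tau -> forall z, spectrum (A tau) z -> sector omega z) /\
  (forall mu, omega < mu < PI ->
     exists Cmu, 0 < Cmu /\
       forall tau, 0 <= tau -> forall z, ~ sector mu z -> forall x,
         norm (resolvent (A tau) z x) <= Cmu * Rpower (Cmod z) gamma * norm x).

(** [int_0^oo g(rho e^{i theta}) e^{i theta} drho], the integral of [g] over
    the ray of angle [theta], oriented away from the origin. *)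
Definition ray_integral (theta : R) (g : C -> X) : X :=
  RInt_gen (V := real_space X)
    (fun rho => scal (cis theta) (g (RtoC rho * cis theta)%C))
    (at_right 0) (Rbar_locally p_infty).

(** The path [Gamma_theta] keeps the sector [|arg z| < theta] on its left, so
    it comes in from infinity along the ray of angle [theta] and leaves along
    the ray of angle [- theta]. *)
Definition path_integral (theta : R) (g : C -> X) : X :=
  minus (ray_integral (- theta) g) (ray_integral theta g).

Definition semigroup (theta : R) (A : operator X) (t : R) (x : X) : X :=
  if Req_EM_T t 0 then x else
  scal (/ (RtoC (2 * PI) * Ci))%C
    (path_integral theta
       (fun z => scal (Cexp (- (RtoC t * z)))%C (resolvent A z x))).

(** [u] is C^1 on [(0, +oo)], takes values in [D(A)] there and satisfies
    [u_t = - phi(t) A u].  The minus sign is forced by the conventions above: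
    the spectrum lies in the right half-plane and the semigroup is
    [int e^{-tz} (z - A)^{-1} dz], that is [e^{-tA}]. *)
Definition solves_equation (phi : R -> R) (A : operator X) (u : R -> X) : Prop :=
  (forall t, 0 < t -> dom A (u t)) /\
  exists du : R -> X,
    (forall t, 0 < t -> is_derive (V := real_space X) u t (du t)) /\
    (forall t, 0 < t -> continuous du t) /\
    (forall t, 0 < t -> du t = opp (scal (RtoC (phi t)) (A (u t)))).

Definition continuous_on_halfline {U : UniformSpace} (f : R -> U) : Prop :=
  forall t, 0 <= t -> filterlim f (within (Rle 0) (locally t)) (locally (f t)).

Definition classical_solution
    (phi : R -> R) (A : operator X) (u0 : X) (u : R -> X) : Prop :=
  continuous_on_halfline u /\ solves_equation phi A u /\ u 0 = u0.

(** [S] is the solution operator of [u_t = - phi(t) A u], [u(0) = u0].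
    The semigroup of an almost sectorial operator need not be strongly
    continuous at [0], and [D(A)] need not be dense, so some [u0] may admit no
    classical solution.  [S] must therefore send every [u0] that admits a
    classical solution to that solution (which makes it unique); for every
    [u0] in [X] without exception, [S t u0] must start at [u0] and satisfy the
    equation for [t > 0], so that it is a classical solution as soon as it is
    continuous at [0]; and it must be one whenever [u0] is in [D(A)]. *)
Definition solution_operator
    (phi : R -> R) (A : operator X) (S : R -> X -> X) : Prop :=
  (forall t, 0 <= t -> is_linear (S t)) /\
  (forall u0 u, classical_solution phi A u0 u ->
     forall t, 0 <= t -> u t = S t u0) /\
  (forall u0, S 0 u0 = u0 /\ solves_equation phi A (fun t => S t u0)) /\
  (forall u0, dom A u0 -> classical_solution phi A u0 (fun t => S t u0)).

End Operators.

(* Main.v *)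
(** Write [R z] for the resolvent and [T] for the contour semigroup. All
    contour integrals are improper integrals over two rays. Cauchy's theorem is
    needed only in the form "a ray may be rotated inside a sector where the
    integrand is holomorphic and decays at [0] and at infinity", which follows
    from differentiating in the angle: in polar coordinates the derivative is a
    total derivative in the radius.

    For [t > 0], [T t x] lies in [D(A)] and is differentiable with derivative
    [- A (T t x)], since [z R z = I + A R z] and the contour integral of
    [e^{-tz}] vanishes. For [x] in [D(A)], [R z x = (x + R z (A x + x)) / (z + 1)],
    the first part integrates to [0] against [e^{-tz}], and for the second the
    limit [t -> 0] is dominated because [gamma < 0]; rotating the contour to
    the negative axis after splitting off the explicit term [2 / (z^2 - 1) x]
    identifies the limit as [x], with an error [O(t^{- gamma / 2})] in the
    graph norm. Composing with the clock [int_0^t phi] gives existence.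

    Uniqueness: for a classical solution [u], [T (clock t - clock s) (u s)] is
    constant in [s] on [(0, t)]; letting [s -> 0] and [s -> t] gives
    [T (clock t) u0 = u t]. The second limit uses the error bound in the graph
    norm, as [A u] is bounded near [t > 0]. *)

Require Import Defs.
From Stdlib Require Import Reals Lra Lia Classical_Prop.
From Coquelicot Require Import Coquelicot.
Open Scope R_scope.

Set Implicit Arguments.

(** * Improper integrals with power bounds *)

(** The norm of [T t] may blow up as [t] tends to [0], so limits at [0] are available only on [D(A)]
    and have to be quantitative. They rest on [|e^{-tz} - 1| <= 2 (t |z|)^{- g / 2}] on the contour:
    the power of [t] is the rate of convergence, and the power of [|z|], multiplied by [|z|^g] from
    the resolvent and [1 / |z|] from the pole, leaves [|z|^{g / 2 - 1}], still integrable at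
    infinity. The explicit term comes from an exchange of poles: [R z (A x + x) / (z + 1) = R z (A x
    - x) / (z - 1) + 2 / (z^2 - 1) x]. The pole [-1] blocks the rotation to the negative axis; the
    pole [1] lies on the other side of the contour and does not. The scalar integral that remains is
    computed by arctangents. Holomorphy is carried as a second-order estimate with constants uniform
    on annular sectors ([qdiff]): it is stable under products, and the resolvent identity gives it
    for the resolvent. *)

Lemma eq_of_norm_le {K : AbsRing} {V : NormedModule K} (x y : V) :
  (forall eps, 0 < eps -> norm (minus x y) <= eps) -> x = y.
Proof.
  intros H.
  assert (N : norm (minus x y) = 0).
  { apply Rle_antisym; [| apply norm_ge_0].
    apply Rnot_lt_le; intros Hp.
    generalize (H (norm (minus x y) / 2)); lra. }
  apply norm_eq_zero in N.
  transitivity (plus (minus x y) y).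
  - unfold minus. rewrite <- plus_assoc, plus_opp_l. symmetry; apply plus_zero_r.
  - rewrite N. apply plus_zero_l.
Qed.

Lemma plus_opp_minus {G : AbelianGroup} (x y : G) : plus y (opp (minus y x)) = x.
Proof.
  etransitivity; [apply f_equal, opp_minus | unfold minus].
  etransitivity; [apply plus_comm |].
  etransitivity; [symmetry; apply plus_assoc |].
  etransitivity; [apply f_equal, plus_opp_l | apply plus_zero_r].
Qed.

Lemma norm_le_plus_minus {K : AbsRing} {V : NormedModule K} (x y : V) :
  norm x <= norm y + norm (minus y x).
Proof.
  rewrite <- (plus_opp_minus x y) at 1.
  refine (Rle_trans _ _ _ (norm_triangle _ _) _).
  apply Rplus_le_compat_l. right. exact (norm_opp (minus y x)).
Qed.

Lemma minus_plus_middle {G : AbelianGroup} (x y z : G) :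
  minus (plus (plus x y) z) y = plus x z.
Proof.
  unfold minus.
  etransitivity; [symmetry; apply plus_assoc |].
  etransitivity; [symmetry; apply plus_assoc |]. apply f_equal.
  etransitivity; [apply plus_comm |].
  etransitivity; [symmetry; apply plus_assoc |].
  etransitivity; [apply f_equal, plus_opp_l | apply plus_zero_r].
Qed.

Lemma is_derive_Rpower_const (r x : R) :
  0 < x -> is_derive (fun y => Rpower y r) x (r * Rpower x (r - 1)).
Proof.
  intros Hx. unfold Rpower. auto_derive; [exact Hx |].
  replace ((r - 1) * ln x) with (r * ln x + - ln x) by ring.
  rewrite exp_plus, exp_Ropp, exp_ln by exact Hx.
  field; lra.
Qed.

Lemma is_RInt_Rpower (c r a b : R) :
  r + 1 <> 0 -> 0 < a -> 0 < b ->
  is_RInt (fun x => c * Rpower x r) a b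
    (c * ((Rpower b (r + 1) - Rpower a (r + 1)) / (r + 1))).
Proof.
  intros Hr Ha Hb.
  assert (Hm : 0 < Rmin a b) by (apply Rmin_glb_lt; assumption).
  apply (is_RInt_scal (fun x => Rpower x r) a b c).
  replace ((Rpower b (r + 1) - Rpower a (r + 1)) / (r + 1))
    with (minus (Rpower b (r + 1) / (r + 1)) (Rpower a (r + 1) / (r + 1)))
    by (unfold minus, plus, opp; simpl; field; exact Hr).
  apply (is_RInt_derive (fun x => Rpower x (r + 1) / (r + 1))).
  - intros x Hx.
    replace (Rpower x r) with (/ (r + 1) * ((r + 1) * Rpower x (r + 1 - 1)))
      by (replace (r + 1 - 1) with r by ring; field; exact Hr).
    apply (is_derive_ext (fun y => / (r + 1) * Rpower y (r + 1))).
    { intros t. unfold Rdiv. apply Rmult_comm. }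
    apply (is_derive_scal (fun y => Rpower y (r + 1))), is_derive_Rpower_const; lra.
  - intros x Hx. apply (@ex_derive_continuous R_AbsRing R_NormedModule).
    eexists. apply is_derive_Rpower_const; lra.
Qed.

Lemma Rpower_ge_0 (x r : R) : 0 <= Rpower x r.
Proof. left; apply exp_pos. Qed.

Lemma Rpower_incr_base (r x y : R) : 0 <= r -> 0 < x <= y -> Rpower x r <= Rpower y r.
Proof. intros Hr Hxy. apply Rle_Rpower_l; assumption. Qed.

Lemma Rpower_decr_base (r x y : R) : r <= 0 -> 0 < x <= y -> Rpower y r <= Rpower x r.
Proof.
  intros Hr Hxy. replace r with (- (- r)) by ring.
  rewrite (Rpower_Ropp y), (Rpower_Ropp x).
  apply Rinv_le_contravar; [apply exp_pos | apply Rpower_incr_base; lra].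
Qed.

Lemma Rpower_1_l (r : R) : Rpower 1 r = 1.
Proof. unfold Rpower. rewrite ln_1, Rmult_0_r. apply exp_0. Qed.

(** Source of the cut-off radii: [Rpower eta (/ r)] is the radius at which [rho^r] takes the value
    [eta]. *)
Lemma Rpower_base_lt (r eta : R) :
  r <> 0 -> 0 < eta -> Rpower (Rpower eta (/ r)) r = eta.
Proof.
  intros Hr He. rewrite Rpower_mult, Rinv_l by exact Hr. apply Rpower_1; exact He.
Qed.

Lemma filter_prod_corner (d B : R) :
  0 < d ->
  filter_prod (at_right 0) (Rbar_locally p_infty) (fun ab => 0 < fst ab < d /\ B < snd ab).
Proof.
  intros Hd.
  apply (Filter_prod _ _ _ (fun x => 0 < x < d) (fun x => B < x)).
  - exists (mkposreal d Hd). intros y Hy Hy0.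
    split; [exact Hy0 |]. apply Rabs_lt_between in Hy. simpl in Hy.
    unfold minus, plus, opp in Hy; simpl in Hy. lra.
  - exists B. intros x Hx; exact Hx.
  - intros x y Hx Hy; split; assumption.
Qed.

Section Dominated.
Context {V : CompleteNormedModule R_AbsRing}.
Variable g : R.
Hypothesis Hg : -1 < g < 0.

(** The exponent [g / 2 - 1] at infinity leaves room for a factor
    [rho^(- g / 2)] in front of the decay [rho^(g - 1)]. *)
Definition dominated (M : R) (f : R -> V) : Prop :=
  (forall rho, 0 < rho <= 1 -> norm (f rho) <= M * Rpower rho g) /\
  (forall rho, 1 <= rho -> norm (f rho) <= M * Rpower rho (g / 2 - 1)).

(** The integral of [rho^g] over [(0, 1]] plus that of [rho^(g / 2 - 1)] over [[1, oo)]. *)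
Definition dom_const : R := / (1 + g) + 2 / - g.

Lemma dom_const_pos : 0 < dom_const.
Proof.
  unfold dom_const. apply Rplus_lt_0_compat.
  - apply Rinv_0_lt_compat; lra.
  - apply Rdiv_lt_0_compat; lra.
Qed.

Lemma dominated_ge_0 M f : dominated M f -> 0 <= M.
Proof.
  intros [H _]. specialize (H 1 ltac:(lra)). rewrite Rpower_1_l in H.
  generalize (norm_ge_0 (f 1)). lra.
Qed.

Lemma dominated_near_0 M f a b l :
  dominated M f -> 0 < a <= b -> b <= 1 -> is_RInt f a b l ->
  norm l <= M * (Rpower b (1 + g) * / (1 + g)).
Proof.
  intros D Hab Hb Hl. pose proof (dominated_ge_0 D) as HM. destruct D as [D _].
  refine (Rle_trans _ _ _ (@norm_RInt_le V _ _ _ _ _ _ _ _ Hl (@is_RInt_Rpower M g a b _ _ _)) _); try lra.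
  - intros x Hx. apply D; lra.
  - apply Rmult_le_compat_l; [exact HM |]. replace (g + 1) with (1 + g) by ring.
    unfold Rdiv. apply Rmult_le_compat_r; [left; apply Rinv_0_lt_compat; lra |].
    generalize (Rpower_ge_0 a (1 + g)); lra.
Qed.

Lemma dominated_near_oo M f a b l :
  dominated M f -> 1 <= a <= b -> is_RInt f a b l ->
  norm l <= M * (Rpower a (g / 2) * (2 / - g)).
Proof.
  intros D Hab Hl. pose proof (dominated_ge_0 D) as HM. destruct D as [_ D].
  refine (Rle_trans _ _ _ (@norm_RInt_le V _ _ _ _ _ _ _ _ Hl (@is_RInt_Rpower M (g / 2 - 1) a b _ _ _)) _); try lra.
  - intros x Hx. apply D; lra.
  - apply Rmult_le_compat_l; [exact HM |]. replace (g / 2 - 1 + 1) with (g / 2) by ring.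
    replace ((Rpower b (g / 2) - Rpower a (g / 2)) / (g / 2))
      with ((Rpower a (g / 2) - Rpower b (g / 2)) * (2 / - g)) by (field; lra).
    apply Rmult_le_compat_r; [left; apply Rdiv_lt_0_compat; lra |].
    generalize (Rpower_ge_0 b (g / 2)); lra.
Qed.

Lemma dominated_norm_RInt M f a b l :
  dominated M f -> 0 < a <= 1 -> 1 <= b -> is_RInt f a b l ->
  norm l <= M * dom_const.
Proof.
  intros D Ha Hb Hl.
  assert (E : ex_RInt f a b) by (eexists; apply Hl).
  assert (E1 : ex_RInt f a 1) by (apply (@ex_RInt_Chasles_1 V) with b; [lra | exact E]).
  assert (E2 : ex_RInt f 1 b) by (apply (@ex_RInt_Chasles_2 V) with a; [lra | exact E]).
  apply RInt_correct in E1. apply RInt_correct in E2.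
  rewrite <- (is_RInt_unique _ _ _ _ Hl), (is_RInt_unique _ _ _ _ (is_RInt_Chasles _ _ _ _ _ _ E1 E2)).
  refine (Rle_trans _ _ _ (norm_triangle _ _) _).
  pose proof (@dominated_near_0 M f a 1 _ D ltac:(lra) ltac:(lra) E1) as B1.
  pose proof (@dominated_near_oo M f 1 b _ D ltac:(lra) E2) as B2.
  rewrite Rpower_1_l in B1, B2. unfold dom_const. lra.
Qed.

Lemma dominated_norm_RInt_gen M f l :
  dominated M f -> is_RInt_gen f (at_right 0) (Rbar_locally p_infty) l ->
  norm l <= M * dom_const.
Proof.
  intros D Hl. apply le_epsilon; intros eps He.
  assert (HP : locally l (fun y : V => norm (minus y l) < eps)).
  { apply (@locally_le_locally_norm R_AbsRing V). exists (mkposreal eps He).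
    intros y Hy. exact Hy. }
  specialize (Hl _ HP). unfold filtermapi in Hl.
  pose proof (filter_and _ _ Hl (filter_prod_corner 1 Rlt_0_1)) as HF.
  apply filter_ex in HF. destruct HF as [[a b] [[y [Hy Hn]] [Ha Hb]]].
  simpl in *.
  pose proof (@dominated_norm_RInt M f a b y D ltac:(lra) ltac:(lra) Hy) as B.
  refine (Rle_trans _ _ _ (norm_le_plus_minus l y) _).
  apply Rplus_le_compat; [exact B | left; exact Hn].
Qed.

Lemma norm_RInt_swap (f : R -> V) a b : ex_RInt f b a -> norm (RInt f a b) = norm (RInt f b a).
Proof. intros H. rewrite <- (opp_RInt_swap _ _ _ H). exact (norm_opp (RInt f b a)). Qed.

(** Cauchy criterion in both endpoints: two truncated integrals differ by one piece near [0] and one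
    near infinity, each controlled by a primitive of the dominating power. *)
Lemma dominated_is_RInt_gen M f :
  (forall rho, 0 < rho -> continuous f rho) -> dominated M f ->
  exists l, is_RInt_gen f (at_right 0) (Rbar_locally p_infty) l.
Proof.
  intros Hc D. pose proof (dominated_ge_0 D) as HM.
  assert (EX : forall a b, 0 < a -> 0 < b -> is_RInt f a b (RInt f a b)).
  { intros a b Ha Hb. apply RInt_correct, ex_RInt_continuous. intros z Hz. apply Hc.
    assert (0 < Rmin a b) by (apply Rmin_glb_lt; assumption). lra. }
  assert (LIM : exists l, filterlim (fun ab => RInt f (fst ab) (snd ab))
      (filter_prod (at_right 0) (Rbar_locally p_infty)) (locally l)).
  { apply filterlim_locally_cauchy. intros eps.
    (* Scaled so that [M * e <= eps / 4]; [M + 1] keeps the denominator positive when [M = 0]. *)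
    pose (e := eps / (4 * (M + 1))).
    assert (He : 0 < e) by (apply Rdiv_lt_0_compat; [apply cond_pos | lra]).
    assert (HMe : M * e <= eps / 4).
    { unfold e. apply Rmult_le_reg_r with (4 * (M + 1)); [lra |].
      field_simplify; [| lra]. generalize (cond_pos eps). nra. }
    (* At these radii the bounds of [dominated_near_0] and [dominated_near_oo] have dropped to at
       most [M * e]. *)
    pose (d := Rmin 1 (Rpower (e * (1 + g)) (/ (1 + g)))).
    pose (B := Rmax 1 (Rpower (e * (- g / 2)) (/ (g / 2)))).
    assert (Hd : 0 < d) by (apply Rmin_glb_lt; [lra | apply exp_pos]).
    assert (S1 : forall a a', 0 < a <= d -> 0 < a' <= d -> norm (RInt f a a') <= eps / 4).
    { assert (S : forall a a', 0 < a <= a' -> a' <= d -> norm (RInt f a a') <= eps / 4).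
      { intros a a' Ha Ha'. assert (a' <= 1) by (apply Rle_trans with d; [lra | apply Rmin_l]).
        refine (Rle_trans _ _ _ (@dominated_near_0 M f a a' _ D Ha ltac:(lra) (EX a a' ltac:(lra) ltac:(lra))) _).
        refine (Rle_trans _ _ _ _ HMe). apply Rmult_le_compat_l; [exact HM |].
        apply Rmult_le_reg_r with (1 + g); [lra |].
        rewrite Rmult_assoc, Rinv_l, Rmult_1_r by lra.
        rewrite <- (@Rpower_base_lt (1 + g) (e * (1 + g))); [| lra | apply Rmult_lt_0_compat; lra].
        apply Rpower_incr_base; [lra |]. split; [lra |].
        apply Rle_trans with d; [lra | apply Rmin_r]. }
      intros a a' Ha Ha'. destruct (Rle_dec a a').
      - apply S; lra.
      - rewrite (norm_RInt_swap (ex_intro _ _ (EX a' a ltac:(lra) ltac:(lra)))). apply S; lra. }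
    assert (S2 : forall b b', B <= b -> B <= b' -> norm (RInt f b b') <= eps / 4).
    { assert (HB1 : 1 <= B) by apply Rmax_l.
      assert (S : forall b b', B <= b -> b <= b' -> norm (RInt f b b') <= eps / 4).
      { intros b b' Hb Hb'.
        refine (Rle_trans _ _ _ (@dominated_near_oo M f b b' _ D ltac:(lra) (EX b b' ltac:(lra) ltac:(lra))) _).
        refine (Rle_trans _ _ _ _ HMe). apply Rmult_le_compat_l; [exact HM |].
        apply Rmult_le_reg_r with (- g / 2); [lra |].
        replace (Rpower b (g / 2) * (2 / - g) * (- g / 2)) with (Rpower b (g / 2)) by (field; lra).
        rewrite <- (@Rpower_base_lt (g / 2) (e * (- g / 2))); [| lra | apply Rmult_lt_0_compat; lra].
        apply Rpower_decr_base; [lra |]. split; [apply exp_pos |].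
        apply Rle_trans with B; [apply Rmax_r | lra]. }
      intros b b' Hb Hb'. destruct (Rle_dec b b').
      - apply S; lra.
      - rewrite (norm_RInt_swap (ex_intro _ _ (EX b' b ltac:(lra) ltac:(lra)))). apply S; lra. }
    exists (fun ab => (0 < fst ab < d) /\ B < snd ab). split.
    { exact (filter_prod_corner B Hd). }
    intros [a b] [a' b'] [Ha Hb] [Ha' Hb']. simpl in *.
    apply (@norm_compat1 R_AbsRing V).
    assert (HB1 : 1 <= B) by apply Rmax_l.
    assert (E : is_RInt f a' b' (plus (plus (RInt f a' a) (RInt f a b)) (RInt f b b'))).
    { refine (@is_RInt_Chasles V f a' b b' _ _
        (@is_RInt_Chasles V f a' a b _ _ (EX _ _ _ _) (EX _ _ _ _)) (EX _ _ _ _)); lra. }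
    rewrite (is_RInt_unique _ _ _ _ E).
    rewrite (minus_plus_middle (RInt f a' a)).
    refine (Rle_lt_trans _ _ _ (norm_triangle _ _) _).
    apply Rle_lt_trans with (eps / 4 + eps / 4); [| generalize (cond_pos eps); lra].
    apply Rplus_le_compat; [apply S1 | apply S2]; lra. }
  destruct LIM as [l Hl]. exists l. intros P HP. specialize (Hl P HP).
  unfold filtermapi. unfold filtermap in Hl.
  pose proof (filter_and _ _ Hl (filter_prod_corner 1 Rlt_0_1)) as HF.
  revert HF. apply filter_imp. intros [a b] [HPab [Ha Hb]]. simpl in *. exists (RInt f a b).
  split; [apply EX; lra | exact HPab].
Qed.

End Dominated.

(** * Bounded linear maps commute with integrals *)

Section LinearMaps.
Context {U V : NormedModule R_AbsRing}.
Variable L : U -> V.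
Hypothesis HL : is_linear L.

Lemma linear_zero : L zero = zero.
Proof.
  transitivity (scal 0 (L zero)); [| exact (scal_zero_l (L zero))].
  rewrite <- (linear_scal L HL). apply f_equal. symmetry. exact (scal_zero_l zero).
Qed.

Lemma Riemann_sum_linear f ptd : L (Riemann_sum f ptd) = Riemann_sum (fun x => L (f x)) ptd.
Proof.
  apply (SF_cons_ind (fun ptd => L (Riemann_sum f ptd) = Riemann_sum (fun x => L (f x)) ptd)).
  - intros x0. unfold Riemann_sum; simpl.
    exact linear_zero.
  - intros h s IH. rewrite !Riemann_sum_cons.
    etransitivity; [apply (linear_plus L HL) |]. rewrite IH.
    apply (f_equal (fun v => plus v _)). apply (linear_scal L HL).
Qed.

(** [L] passes through the limit of Riemann sums, because [is_linear] contains a norm bound and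
    hence continuity. *)
Lemma is_RInt_linear f a b l : is_RInt f a b l -> is_RInt (fun x => L (f x)) a b (L l).
Proof.
  intros H. unfold is_RInt in *.
  apply filterlim_ext with (fun ptd => L (scal (sign (b - a)) (Riemann_sum f ptd))).
  { intros ptd. rewrite <- Riemann_sum_linear. apply (linear_scal L HL). }
  apply filterlim_comp with (1 := H). exact (linear_cont L l HL).
Qed.

Lemma is_RInt_gen_linear Fa Fb f l :
  is_RInt_gen f Fa Fb l -> is_RInt_gen (fun x => L (f x)) Fa Fb (L l).
Proof.
  intros H P HP. specialize (H (fun y => P (L y)) (linear_cont L l HL P HP)).
  destruct H as [Q1 Q2 H1 H2 H]. apply (Filter_prod _ _ _ Q1 Q2 H1 H2).
  intros x y Hx Hy. destruct (H x y Hx Hy) as [z [Hz Pz]]. exists (L z).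
  split; [apply is_RInt_linear; exact Hz | exact Pz].
Qed.

End LinearMaps.

(** * Identities between linear combinations *)

(** Syntax for proof by reflection: an identity between linear combinations of vectors reduces to
    one identity in [C] per atom. *)
Inductive vexpr : Type :=
| VAtom (i : nat)
| VZero
| VPlus (e1 e2 : vexpr)
| VOpp (e : vexpr)
| VScal (k : C) (e : vexpr).

Section ModuleNormalForm.
Context {X : ModuleSpace C_Ring}.

Fixpoint vden (env : list X) (e : vexpr) : X :=
  match e with
  | VAtom i => List.nth i env zero
  | VZero => zero
  | VPlus e1 e2 => plus (vden env e1) (vden env e2)
  | VOpp e => opp (vden env e)
  | VScal k e => scal k (vden env e)
  end.

Fixpoint vcoef (e : vexpr) (i : nat) : C :=
  match e with
  | VAtom j => if Nat.eqb j i then 1%C else 0%C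
  | VZero => 0%C
  | VPlus e1 e2 => (vcoef e1 i + vcoef e2 i)%C
  | VOpp e => (- vcoef e i)%C
  | VScal k e => (k * vcoef e i)%C
  end.

Fixpoint lincomb (c : nat -> C) (env : list X) : X :=
  match env with
  | nil => zero
  | cons x env => plus (scal (c O) x) (lincomb (fun i => c (S i)) env)
  end.

Lemma lincomb_zero env : lincomb (fun _ => 0%C) env = zero.
Proof.
  induction env as [| x env IH]; [reflexivity |]. simpl. rewrite IH.
  rewrite plus_zero_r. exact (scal_zero_l x).
Qed.

Lemma lincomb_plus c d env :
  lincomb (fun i => (c i + d i)%C) env = plus (lincomb c env) (lincomb d env).
Proof.
  revert c d; induction env as [| x env IH]; intros c d; simpl.
  - symmetry; apply plus_zero_l.
  - rewrite IH. change (c O + d O)%C with (@plus C_Ring (c O) (d O)).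
    rewrite scal_distr_r, <- !plus_assoc. f_equal.
    rewrite !plus_assoc. f_equal. apply plus_comm.
Qed.

Lemma lincomb_scal k c env :
  lincomb (fun i => (k * c i)%C) env = scal k (lincomb c env).
Proof.
  revert c; induction env as [| x env IH]; intros c; simpl.
  - symmetry; exact (scal_zero_r k).
  - rewrite IH, scal_distr_l, scal_assoc. reflexivity.
Qed.

Lemma lincomb_ext c d env : (forall i, c i = d i) -> lincomb c env = lincomb d env.
Proof.
  revert c d; induction env as [| x env IH]; intros c d H; simpl; [reflexivity |].
  rewrite H, (IH _ (fun i => d (S i))); [reflexivity | intros i; apply H].
Qed.

Lemma vden_lincomb env e : vden env e = lincomb (vcoef e) env.
Proof.
  induction e as [i | | e1 IH1 e2 IH2 | e IH | k e IH]; simpl.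
  - revert i; induction env as [| x env IH]; intros [| i]; simpl; try reflexivity.
    + rewrite lincomb_zero, plus_zero_r. symmetry; exact (scal_one x).
    + rewrite IH. rewrite <- (plus_zero_l (lincomb _ env)) at 1. f_equal.
      symmetry; exact (scal_zero_l x).
  - symmetry; apply lincomb_zero.
  - rewrite IH1, IH2. symmetry; apply lincomb_plus.
  - rewrite IH. transitivity (lincomb (fun i => (- (1) * vcoef e i)%C) env).
    + rewrite (lincomb_scal (- (1))%C). symmetry; exact (scal_opp_one _).
    + apply lincomb_ext. intros i; ring.
  - rewrite IH. symmetry; apply lincomb_scal.
Qed.

Fixpoint veq_upto (c d : nat -> C) (env : list X) : Prop :=
  match env with
  | nil => True
  | cons _ env => c O = d O /\ veq_upto (fun i => c (S i)) (fun i => d (S i)) env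
  end.

Lemma vden_eq env e1 e2 : veq_upto (vcoef e1) (vcoef e2) env -> vden env e1 = vden env e2.
Proof.
  rewrite !vden_lincomb. generalize (vcoef e1) (vcoef e2).
  induction env as [| x env IH]; intros c d; simpl; [reflexivity |].
  intros [-> H]. f_equal. apply IH, H.
Qed.

End ModuleNormalForm.

(** Atoms are compared syntactically, so convertible terms that are written differently count as
    different atoms. *)
Ltac vmem x l :=
  lazymatch l with
  | nil => constr:(false)
  | cons ?y ?t => match constr:(tt) with
                  | _ => let _ := match constr:(tt) with _ => constr_eq x y end in constr:(true)
                  | _ => vmem x t
                  end
  end.

Ltac vatoms t l :=
  lazymatch t with
  | @plus _ ?a ?b => let l := vatoms a l in vatoms b l
  | @minus _ ?a ?b => let l := vatoms a l in vatoms b l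
  | @opp _ ?a => vatoms a l
  | @scal _ _ _ ?a => vatoms a l
  | @zero _ => l
  | _ => let b := vmem t l in
         lazymatch b with true => l | false => constr:(cons t l) end
  end.

Ltac vindex x l :=
  match l with
  | cons ?y _ => let _ := match constr:(tt) with _ => constr_eq x y end in constr:(O)
  | cons _ ?t => let n := vindex x t in constr:(S n)
  end.

(** A real scalar is reified through [RtoC]: in [real_space] its action is convertible to that of
    the complex scalar, which is what the [change] in [vcoefs] relies on. *)
Ltac vreify t l :=
  lazymatch t with
  | @plus _ ?a ?b => let a := vreify a l in let b := vreify b l in constr:(VPlus a b)
  | @minus _ ?a ?b => let a := vreify a l in let b := vreify b l in constr:(VPlus a (VOpp b))
  | @opp _ ?a => let a := vreify a l in constr:(VOpp a)
  | @scal R_Ring _ ?k ?a => let a := vreify a l in constr:(VScal (RtoC k) a)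
  | @scal R_AbsRing _ ?k ?a => let a := vreify a l in constr:(VScal (RtoC k) a)
  | @scal _ _ ?k ?a => let a := vreify a l in constr:(VScal k a)
  | @zero _ => constr:(VZero)
  | _ => let n := vindex t l in constr:(VAtom n)
  end.

(** Reduces an equation between linear combinations in the complex space [X]
    to the equations between coefficients. *)
Ltac vcoefs X :=
  lazymatch goal with
  | |- @eq _ ?a ?b =>
      let l := vatoms a (@nil X) in
      let l := vatoms b l in
      let ea := vreify a l in
      let eb := vreify b l in
      change (@vden X l ea = @vden X l eb);
      apply vden_eq; cbn [veq_upto vcoef Nat.eqb];
      repeat split
  end.

Ltac vring X := vcoefs X; try ring.

(** Coefficient equations that [ring] does not close, such as those with inverses, remain as goals
    in front of the new inequality. *)
Ltac vreplace X e :=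
  lazymatch goal with
  | |- Rle (@norm ?K ?V ?a) ?b =>
      refine (Rle_trans (@norm K V a) (@norm K V e) b (Req_le _ _ (f_equal (@norm K V) _)) _);
      [vring X |]
  end.

(** * Complex exponential and complex differentiability *)

Lemma exp_le (x y : R) : x <= y -> exp x <= exp y.
Proof. intros [H | ->]; [left; apply exp_increasing, H | apply Rle_refl]. Qed.

Lemma Cmod_pair (x y : R) : Cmod (x, y) = sqrt (x ^ 2 + y ^ 2).
Proof. reflexivity. Qed.

Lemma Cmod_sqr (z : C) : Cmod z ^ 2 = Re z ^ 2 + Im z ^ 2.
Proof. unfold Cmod. rewrite pow2_sqrt; [reflexivity | nra]. Qed.

Lemma Cmod_le_sqr (z : C) (K : R) : 0 <= K -> Re z ^ 2 + Im z ^ 2 <= K ^ 2 -> Cmod z <= K.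
Proof.
  intros HK H. rewrite <- Cmod_sqr in H. generalize (Cmod_ge_0 z). nra.
Qed.

Lemma Cmod_nonneg_R (r : R) : 0 <= r -> Cmod (RtoC r) = r.
Proof. intros H. rewrite Cmod_R. apply Rabs_pos_eq, H. Qed.

Lemma Cmod_cis (a : R) : Cmod (cis a) = 1.
Proof.
  unfold cis. rewrite Cmod_pair. replace (cos a ^ 2 + sin a ^ 2) with 1.
  - apply sqrt_1.
  - generalize (sin2_cos2 a); unfold Rsqr; lra.
Qed.

Lemma Cmod_polar (r a : R) : 0 <= r -> Cmod (RtoC r * cis a)%C = r.
Proof. intros H. rewrite Cmod_mult, Cmod_cis, Cmod_nonneg_R by exact H. ring. Qed.

Lemma cis_plus (a b : R) : cis (a + b) = (cis a * cis b)%C.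
Proof. unfold cis. rewrite cos_plus, sin_plus. unfold Cmult; simpl. f_equal; ring. Qed.

Lemma Cexp_plus (v w : C) : Cexp (v + w)%C = (Cexp v * Cexp w)%C.
Proof.
  destruct v, w. unfold Cexp, Cmult; simpl. rewrite exp_plus, cos_plus, sin_plus.
  f_equal; ring.
Qed.

Lemma Cmod_Cexp (w : C) : Cmod (Cexp w) = exp (Re w).
Proof.
  change (Cexp w) with (exp (Re w) * cos (Im w), exp (Re w) * sin (Im w)).
  replace (exp (Re w) * cos (Im w), exp (Re w) * sin (Im w))
    with (RtoC (exp (Re w)) * cis (Im w))%C.
  - apply Cmod_polar. left; apply exp_pos.
  - unfold cis, Cmult, RtoC; simpl. f_equal; ring.
Qed.

Lemma cis_Cexp (h : R) : cis h = Cexp (RtoC h * Ci)%C.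
Proof.
  unfold cis, Cexp, Cmult, RtoC, Ci; simpl.
  replace (h * 0 - 0 * 1) with 0 by ring. replace (h * 1 + 0 * 0) with h by ring.
  rewrite exp_0. f_equal; ring.
Qed.

(* Projecting on the direction of the increment reduces the inequality to the
   real mean value theorem. *)
Lemma Cmod_mean_value (f1 f2 d1 d2 : R -> R) (K : R) :
  (forall s, is_derive f1 s (d1 s)) -> (forall s, is_derive f2 s (d2 s)) ->
  (forall s, 0 <= s <= 1 -> Cmod (d1 s, d2 s) <= K) ->
  Cmod (f1 1 - f1 0, f2 1 - f2 0) <= K.
Proof.
  intros H1 H2 HK.
  pose (D1 := f1 1 - f1 0). pose (D2 := f2 1 - f2 0).
  assert (Hh : forall s, is_derive (fun s => D1 * f1 s + D2 * f2 s) s (D1 * d1 s + D2 * d2 s)).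
  { intros s. refine (@is_derive_plus R_AbsRing R_NormedModule _ _ _ _ _
      (is_derive_scal f1 s D1 (d1 s) (H1 s)) (is_derive_scal f2 s D2 (d2 s) (H2 s))). }
  destruct (MVT_gen (fun s => D1 * f1 s + D2 * f2 s) 0 1
              (fun s => D1 * d1 s + D2 * d2 s)) as [c [Hc E]].
  - intros s _. apply Hh.
  - intros s _. refine (proj2 (continuity_pt_filterlim (fun s => D1 * f1 s + D2 * f2 s) s) _).
    apply (@ex_derive_continuous R_AbsRing R_NormedModule (fun s => D1 * f1 s + D2 * f2 s) s).
    eexists; apply Hh.
  - rewrite Rmin_left, Rmax_right in Hc by lra.
    specialize (HK c Hc).
    assert (HK0 : 0 <= K) by (apply Rle_trans with (2 := HK), Cmod_ge_0).
    assert (HK2 : d1 c ^ 2 + d2 c ^ 2 <= K ^ 2).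
    { generalize (Cmod_sqr (d1 c, d2 c)) (Cmod_ge_0 (d1 c, d2 c)); simpl; nra. }
    fold D1 D2. apply Cmod_le_sqr; [exact HK0 |]. simpl.
    assert (E2 : D1 ^ 2 + D2 ^ 2 = D1 * d1 c + D2 * d2 c) by (unfold D1, D2 in *; nra).
    assert (CS : (D1 * d1 c + D2 * d2 c) ^ 2 <= (D1 ^ 2 + D2 ^ 2) * (d1 c ^ 2 + d2 c ^ 2)).
    { assert (0 <= (D1 * d2 c - D2 * d1 c) ^ 2) by apply pow2_ge_0. nra. }
    rewrite <- E2 in CS.
    assert (HD : 0 <= D1 ^ 2 + D2 ^ 2) by nra.
    simpl in *. nra.
Qed.

(** Mean value inequality along the segment from [0] to [w], where the derivative is
    [w * Cexp (s w)]; [0 <= B] makes [Re (s w) <= B] hold on the whole segment. *)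
Lemma Cexp_sub_1_bound (w : C) (B : R) :
  0 <= B -> Re w <= B -> Cmod (Cexp w - 1)%C <= Cmod w * exp B.
Proof.
  intros HB Hw. destruct w as [a b]; simpl in Hw.
  pose (d1 := fun s => a * (exp (s * a) * cos (s * b)) - b * (exp (s * a) * sin (s * b))).
  pose (d2 := fun s => a * (exp (s * a) * sin (s * b)) + b * (exp (s * a) * cos (s * b))).
  pose proof (@Cmod_mean_value (fun s => exp (s * a) * cos (s * b))
    (fun s => exp (s * a) * sin (s * b)) d1 d2 (Cmod (a, b) * exp B)) as M.
  replace (Cexp (a, b) - 1)%C
    with (exp (1 * a) * cos (1 * b) - exp (0 * a) * cos (0 * b),
          exp (1 * a) * sin (1 * b) - exp (0 * a) * sin (0 * b)).
  2:{ unfold Cexp, Cminus, Cplus, Copp, RtoC; simpl.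
      rewrite !Rmult_1_l, !Rmult_0_l, exp_0, cos_0, sin_0. f_equal; ring. }
  apply M.
  - intros s; unfold d1; auto_derive; [trivial | ring].
  - intros s; unfold d2; auto_derive; [trivial | ring].
  - intros s Hs.
    replace (d1 s, d2 s) with ((a, b) * Cexp (s * a, s * b)%R)%C.
    2:{ unfold d1, d2, Cexp, Cmult; simpl. f_equal; ring. }
    rewrite Cmod_mult, Cmod_Cexp. apply Rmult_le_compat_l; [apply Cmod_ge_0 |].
    simpl. apply exp_le. nra.
Qed.

(** The derivative of [Cexp (s w) - s w] in [s] is [w * (Cexp (s w) - 1)], to which the first-order
    bound applies. *)
Lemma Cexp_sub_1_sub_bound (w : C) (B : R) :
  0 <= B -> Re w <= B -> Cmod (Cexp w - 1 - w)%C <= Cmod w ^ 2 * exp B.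
Proof.
  intros HB Hw. destruct w as [a b]; simpl in Hw.
  pose (d1 := fun s => a * (exp (s * a) * cos (s * b)) - b * (exp (s * a) * sin (s * b)) - a).
  pose (d2 := fun s => a * (exp (s * a) * sin (s * b)) + b * (exp (s * a) * cos (s * b)) - b).
  pose proof (@Cmod_mean_value (fun s => exp (s * a) * cos (s * b) - s * a)
    (fun s => exp (s * a) * sin (s * b) - s * b) d1 d2 (Cmod (a, b) ^ 2 * exp B)) as M.
  replace (Cexp (a, b) - 1 - (a, b))%C
    with (exp (1 * a) * cos (1 * b) - 1 * a - (exp (0 * a) * cos (0 * b) - 0 * a),
          exp (1 * a) * sin (1 * b) - 1 * b - (exp (0 * a) * sin (0 * b) - 0 * b)).
  2:{ unfold Cexp, Cminus, Cplus, Copp, RtoC; simpl.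
      rewrite !Rmult_1_l, !Rmult_0_l, exp_0, cos_0, sin_0. f_equal; ring. }
  apply M.
  - intros s; unfold d1; auto_derive; [trivial | ring].
  - intros s; unfold d2; auto_derive; [trivial | ring].
  - intros s Hs.
    replace (d1 s, d2 s) with ((a, b) * (Cexp (s * a, s * b)%R - 1))%C.
    2:{ unfold d1, d2, Cexp, Cmult, Cminus, Cplus, Copp, RtoC; simpl. f_equal; ring. }
    rewrite Cmod_mult. unfold pow. rewrite Rmult_1_r, Rmult_assoc.
    apply Rmult_le_compat_l; [apply Cmod_ge_0 |].
    refine (Rle_trans _ _ _ (@Cexp_sub_1_bound _ B HB _) _); [simpl; nra |].
    apply Rmult_le_compat_r; [left; apply exp_pos |].
    replace (s * a, s * b) with (RtoC s * (a, b))%C.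
    2:{ unfold Cmult, RtoC; simpl. f_equal; ring. }
    rewrite Cmod_mult, Cmod_nonneg_R by apply Hs.
    generalize (Cmod_ge_0 (a, b)); nra.
Qed.

Lemma cis_sub_bound (a h : R) : Cmod (cis (a + h) - cis a)%C <= Rabs h.
Proof.
  rewrite cis_plus. replace (cis a * cis h - cis a)%C with (cis a * (cis h - 1))%C by ring.
  rewrite Cmod_mult, Cmod_cis, Rmult_1_l, cis_Cexp.
  refine (Rle_trans _ _ _ (@Cexp_sub_1_bound _ 0 (Rle_refl 0) _) _); [simpl; lra |].
  rewrite exp_0, Rmult_1_r, Cmod_mult, Cmod_R.
  unfold Ci. rewrite Cmod_pair. replace (0 ^ 2 + 1 ^ 2) with 1 by ring. rewrite sqrt_1. lra.
Qed.

Lemma cis_sub_sub_bound (a h : R) :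
  Cmod (cis (a + h) - cis a - RtoC h * (Ci * cis a))%C <= h ^ 2.
Proof.
  rewrite cis_plus.
  replace (cis a * cis h - cis a - RtoC h * (Ci * cis a))%C
    with (cis a * (cis h - 1 - RtoC h * Ci))%C by ring.
  rewrite Cmod_mult, Cmod_cis, Rmult_1_l, cis_Cexp.
  refine (Rle_trans _ _ _ (@Cexp_sub_1_sub_bound _ 0 (Rle_refl 0) _) _); [simpl; lra |].
  rewrite exp_0, Rmult_1_r, Cmod_mult, Cmod_R.
  unfold Ci. rewrite Cmod_pair. replace (0 ^ 2 + 1 ^ 2) with 1 by ring.
  rewrite sqrt_1, Rmult_1_r, <- (Rabs_pos_eq (h ^ 2)), <- RPow_abs by apply pow2_ge_0. lra.
Qed.

(** Complex differentiability on [D] with uniform constants.  The constant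
    also bounds [F] and its derivative, so that products are covered. *)
Definition qdiff {X : NormedModule C_AbsRing} (D : C -> Prop) (F : C -> X) : Prop :=
  exists (F' : C -> X) (M : R), 0 <= M /\
    (forall z, D z -> norm (F z) <= M /\ norm (F' z) <= M) /\
    (forall z w, D z -> D w -> norm (minus (F w) (F z)) <= M * Cmod (w - z)%C) /\
    (forall z w, D z -> D w ->
       norm (minus (minus (F w) (F z)) (scal (w - z)%C (F' z))) <= M * Cmod (w - z)%C ^ 2).

Lemma norm_scal_C {X : NormedModule C_AbsRing} (c : C) (x : X) :
  norm (scal c x) <= Cmod c * norm x.
Proof. exact (norm_scal c x). Qed.

Lemma norm_scal_bound {X : NormedModule C_AbsRing} (c : C) (x : X) (A B : R) :
  Cmod c <= A -> norm x <= B -> norm (scal c x) <= A * B.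
Proof.
  intros HA HB. refine (Rle_trans _ _ _ (norm_scal_C c x) _).
  apply Rmult_le_compat; [apply Cmod_ge_0 | apply norm_ge_0 | exact HA | exact HB].
Qed.

Lemma norm_plus_bound {K : AbsRing} {X : NormedModule K} (x y : X) (A B : R) :
  norm x <= A -> norm y <= B -> norm (plus x y) <= A + B.
Proof.
  intros HA HB. refine (Rle_trans _ _ _ (norm_triangle x y) _). apply Rplus_le_compat; assumption.
Qed.

Lemma qdiff_const {X : NormedModule C_AbsRing} (D : C -> Prop) (x : X) : qdiff D (fun _ => x).
Proof.
  exists (fun _ => zero), (norm x). pose proof (norm_ge_0 x) as Hx.
  assert (Z : @norm _ X zero <= 0) by (right; apply norm_zero).
  repeat split.
  - exact Hx.
  - apply Rle_refl.
  - lra.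
  - intros z w _ _. apply Rle_trans with 0.
    + vreplace X (@zero X). exact Z.
    + generalize (Cmod_ge_0 (w - z)%C); nra.
  - intros z w _ _. apply Rle_trans with 0.
    + vreplace X (@zero X). exact Z.
    + generalize (pow2_ge_0 (Cmod (w - z)%C)); nra.
Qed.

Lemma qdiff_scal {X : NormedModule C_AbsRing} (D : C -> Prop)
    (c : C -> AbsRing_NormedModule C_AbsRing) (F : C -> X) :
  qdiff D c -> qdiff D F -> qdiff D (fun z => scal (c z : C) (F z)).
Proof.
  intros (c' & A & HA & Bc & Lc & Qc) (F' & B & HB & BF & LF & QF).
  exists (fun z => plus (scal (c' z : C) (F z)) (scal (c z : C) (F' z))), (3 * (A * B)).
  assert (HAB : 0 <= A * B) by (apply Rmult_le_pos; assumption).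
  repeat split.
  - lra.
  - refine (Rle_trans _ _ _ (@norm_scal_bound X _ _ A B _ _) _); [apply Bc | apply BF | lra]; assumption.
  - apply Rle_trans with (A * B + A * B); [| lra].
    apply (@norm_plus_bound C_AbsRing X); apply norm_scal_bound; first [apply Bc | apply BF]; assumption.
  - intros z w Hz Hw.
    vreplace X (plus (scal (c w : C) (minus (F w) (F z))) (scal (c w - c z)%C (F z))).
    apply Rle_trans with (A * (B * Cmod (w - z)%C) + A * Cmod (w - z)%C * B).
    + apply (@norm_plus_bound C_AbsRing X); apply norm_scal_bound;
        first [apply Bc | apply BF | apply LF | apply Lc]; assumption.
    + generalize (Cmod_ge_0 (w - z)%C); nra.
  - intros z w Hz Hw.
    (* Remainder of the product: remainder of [c] times [F z], product of the two increments, [c z]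
       times remainder of [F]. *)
    vreplace X (plus (plus (scal (c w - c z - (w - z) * c' z)%C (F z))
                          (scal (c w - c z)%C (minus (F w) (F z))))
                    (scal (c z : C) (minus (minus (F w) (F z)) (scal (w - z)%C (F' z))))).
    apply Rle_trans with (A * Cmod (w - z)%C ^ 2 * B
      + A * Cmod (w - z)%C * (B * Cmod (w - z)%C) + A * (B * Cmod (w - z)%C ^ 2)); [| lra].
    apply (@norm_plus_bound C_AbsRing X); [apply (@norm_plus_bound C_AbsRing X) |]; apply norm_scal_bound;
      first [apply Bc | apply BF | apply LF | apply Lc | apply QF | apply Qc]; assumption.
Qed.

Lemma qdiff_ext {X : NormedModule C_AbsRing} (D : C -> Prop) (F G : C -> X) :
  (forall z, D z -> F z = G z) -> qdiff D F -> qdiff D G.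
Proof.
  intros E (F' & M & HM & B & L & Q). exists F', M. split; [exact HM |].
  split; [| split].
  - intros z Hz. rewrite <- E by assumption. auto.
  - intros z w Hz Hw. rewrite <- !E by assumption. auto.
  - intros z w Hz Hw. rewrite <- !E by assumption. auto.
Qed.

Lemma qdiff_subset {X : NormedModule C_AbsRing} (D D' : C -> Prop) (F : C -> X) :
  (forall z, D' z -> D z) -> qdiff D F -> qdiff D' F.
Proof. intros E (F' & M & HM & B & L & Q). exists F', M. repeat split; auto; apply B; auto. Qed.

Lemma qdiff_id (D : C -> Prop) (N : R) :
  (forall z, D z -> Cmod z <= N) -> qdiff (X := AbsRing_NormedModule C_AbsRing) D (fun z => z).
Proof.
  intros HN. exists (fun _ => RtoC 1), (Rmax 1 N).
  pose proof (Rmax_l 1 N) as M1. pose proof (Rmax_r 1 N) as M2.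
  repeat split.
  - lra.
  - apply Rle_trans with N; [apply HN; assumption | assumption].
  - change (Cmod 1%C <= Rmax 1 N). rewrite Cmod_1. exact M1.
  - intros z w _ _. change (Cmod (w - z)%C <= Rmax 1 N * Cmod (w - z)%C).
    generalize (Cmod_ge_0 (w - z)%C). nra.
  - intros z w _ _. change (Cmod (w - z - (w - z) * 1)%C <= Rmax 1 N * Cmod (w - z)%C ^ 2).
    replace (w - z - (w - z) * 1)%C with (RtoC 0) by ring. rewrite Cmod_0.
    generalize (pow2_ge_0 (Cmod (w - z)%C)). nra.
Qed.

Lemma qdiff_inv (D : C -> Prop) (c : C) (d : R) :
  0 < d -> (forall z, D z -> d <= Cmod (z - c)%C) ->
  qdiff (X := AbsRing_NormedModule C_AbsRing) D (fun z => (/ (z - c))%C).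
Proof.
  intros Hd Hc.
  assert (NZ : forall z, D z -> (z - c)%C <> 0%C).
  { intros z Hz E. specialize (Hc z Hz). rewrite E, Cmod_0 in Hc. lra. }
  assert (BI : forall z, D z -> Cmod (/ (z - c))%C <= / d).
  { intros z Hz. rewrite Cmod_inv by auto. apply Rinv_le_contravar; auto. }
  assert (Hd' : 0 < / d) by (apply Rinv_0_lt_compat; exact Hd).
  assert (BI2 : forall z w, D z -> D w -> Cmod (/ (z - c) * / (w - c))%C <= / d * / d).
  { intros z w Hz Hw. rewrite Cmod_mult.
    apply Rmult_le_compat; auto; apply Cmod_ge_0. }
  (* The powers of [/ d] bound, in turn, the value, the derivative together with the first
     difference, and the second-order remainder. *)
  exists (fun z => (- (/ (z - c) * / (z - c)))%C), (/ d + / d * / d + / d * / d * / d).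
  assert (P2 : 0 < / d * / d) by nra. assert (P3 : 0 < / d * / d * / d) by nra.
  repeat split.
  - lra.
  - change (Cmod (/ (z - c))%C <= / d + / d * / d + / d * / d * / d). specialize (BI z H). lra.
  - change (Cmod (- (/ (z - c) * / (z - c)))%C <= / d + / d * / d + / d * / d * / d).
    rewrite Cmod_opp. specialize (BI2 z z H H). lra.
  - intros z w Hz Hw.
    change (Cmod (/ (w - c) - / (z - c))%C <= (/ d + / d * / d + / d * / d * / d) * Cmod (w - z)%C).
    replace (/ (w - c) - / (z - c))%C with (- (/ (z - c) * / (w - c)) * (w - z))%C
      by (field; auto).
    rewrite Cmod_mult, Cmod_opp. apply Rmult_le_compat_r; [apply Cmod_ge_0 |].
    specialize (BI2 z w Hz Hw). lra.
  - intros z w Hz Hw.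
    change (Cmod (/ (w - c) - / (z - c) - (w - z) * (- (/ (z - c) * / (z - c))))%C
            <= (/ d + / d * / d + / d * / d * / d) * Cmod (w - z)%C ^ 2).
    replace (/ (w - c) - / (z - c) - (w - z) * (- (/ (z - c) * / (z - c))))%C
      with (/ (z - c) * / (w - c) * / (z - c) * ((w - z) * (w - z)))%C by (field; auto).
    rewrite !Cmod_mult. replace (Cmod (w - z)%C ^ 2) with (Cmod (w - z)%C * Cmod (w - z)%C) by ring.
    apply Rmult_le_compat_r; [generalize (Cmod_ge_0 (w - z)%C); nra |].
    apply Rle_trans with (/ d * / d * / d); [| lra].
    apply Rmult_le_compat; [| apply Cmod_ge_0 | | auto].
    + apply Rmult_le_pos; apply Cmod_ge_0.
    + rewrite <- Cmod_mult; auto.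
Qed.

Lemma Re_le_Cmod (z : C) : Re z <= Cmod z.
Proof. refine (Rle_trans _ _ _ (Rle_abs _) _). apply re_le_Cmod. Qed.

Lemma qdiff_exp (D : C -> Prop) (t N : R) :
  0 <= N -> (forall z, D z -> Cmod z <= N) ->
  qdiff (X := AbsRing_NormedModule C_AbsRing) D (fun z => Cexp (- (RtoC t * z))%C).
Proof.
  intros HN0 HN.
  pose (T := Rabs t). assert (HT : 0 <= T) by apply Rabs_pos.
  assert (HTN : 0 <= T * N) by (apply Rmult_le_pos; assumption).
  pose (E := exp (T * N)). assert (HE : 0 < E) by apply exp_pos.
  (* Increments [w - z] of points of [D] have modulus at most [2 N], hence the doubled exponent. *)
  pose (E2 := exp (2 * (T * N))). assert (HE2 : 0 < E2) by apply exp_pos.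
  assert (BE : forall z, D z -> Cmod (Cexp (- (RtoC t * z)))%C <= E).
  { intros z Hz. rewrite Cmod_Cexp. apply exp_le.
    refine (Rle_trans _ _ _ (Re_le_Cmod _) _). rewrite Cmod_opp, Cmod_mult, Cmod_R.
    apply Rmult_le_compat_l; auto. }
  assert (ID : forall z w, Cexp (- (RtoC t * w))%C
    = (Cexp (- (RtoC t * z)) * Cexp (- (RtoC t * (w - z))))%C).
  { intros z w. rewrite <- Cexp_plus. f_equal. ring. }
  assert (MW : forall z w, Cmod (- (RtoC t * (w - z)))%C = T * Cmod (w - z)%C).
  { intros z w. rewrite Cmod_opp, Cmod_mult, Cmod_R. reflexivity. }
  assert (RW : forall z w, D z -> D w -> Re (- (RtoC t * (w - z)))%C <= 2 * (T * N)).
  { intros z w Hz Hw. refine (Rle_trans _ _ _ (Re_le_Cmod _) _). rewrite MW.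
    assert (Cmod (w - z)%C <= N + N).
    { refine (Rle_trans _ _ _ (Cmod_triangle _ _) _). rewrite Cmod_opp.
      apply Rplus_le_compat; auto. }
    nra. }
  assert (P1 : 0 <= T * E) by nra.
  assert (P2 : 0 <= E * (T * E2)) by (apply Rmult_le_pos; nra).
  assert (P3 : 0 <= E * (T ^ 2 * E2)).
  { apply Rmult_le_pos; [lra | apply Rmult_le_pos; [apply pow2_ge_0 | lra]]. }
  exists (fun z => (- RtoC t * Cexp (- (RtoC t * z)))%C),
    (E + T * E + E * (T * E2) + E * (T ^ 2 * E2)).
  repeat split.
  - lra.
  - match goal with |- _ <= ?m => change (Cmod (Cexp (- (RtoC t * z)))%C <= m) end.
    specialize (BE z H). lra.
  - match goal with |- _ <= ?m => change (Cmod (- RtoC t * Cexp (- (RtoC t * z)))%C <= m) end.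
    rewrite Cmod_mult, Cmod_opp, Cmod_R. specialize (BE z H). fold T. nra.
  - intros z w Hz Hw.
    match goal with |- _ <= ?m =>
      change (Cmod (Cexp (- (RtoC t * w)) - Cexp (- (RtoC t * z)))%C <= m) end.
    rewrite (ID z w).
    replace (Cexp (- (RtoC t * z)) * Cexp (- (RtoC t * (w - z))) - Cexp (- (RtoC t * z)))%C
      with (Cexp (- (RtoC t * z)) * (Cexp (- (RtoC t * (w - z))) - 1))%C by ring.
    rewrite Cmod_mult.
    apply Rle_trans with (E * (T * Cmod (w - z)%C * E2)).
    + apply Rmult_le_compat; [apply Cmod_ge_0 | apply Cmod_ge_0 | auto |].
      rewrite <- MW. apply Cexp_sub_1_bound; [lra | auto].
    + generalize (Cmod_ge_0 (w - z)%C); nra.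
  - intros z w Hz Hw.
    match goal with |- _ <= ?m =>
      change (Cmod (Cexp (- (RtoC t * w)) - Cexp (- (RtoC t * z))
        - (w - z) * (- RtoC t * Cexp (- (RtoC t * z))))%C <= m) end.
    rewrite (ID z w).
    replace (Cexp (- (RtoC t * z)) * Cexp (- (RtoC t * (w - z))) - Cexp (- (RtoC t * z))
        - (w - z) * (- RtoC t * Cexp (- (RtoC t * z))))%C
      with (Cexp (- (RtoC t * z)) * (Cexp (- (RtoC t * (w - z))) - 1 - (- (RtoC t * (w - z)))))%C by ring.
    rewrite Cmod_mult.
    apply Rle_trans with (E * ((T * Cmod (w - z)%C) ^ 2 * E2)).
    + apply Rmult_le_compat; [apply Cmod_ge_0 | apply Cmod_ge_0 | auto |].
      rewrite <- MW. apply Cexp_sub_1_sub_bound; [lra | auto].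
    + replace (E * ((T * Cmod (w - z)%C) ^ 2 * E2)) with (E * (T ^ 2 * E2) * Cmod (w - z)%C ^ 2) by ring.
      apply Rmult_le_compat_r; [apply pow2_ge_0 | lra].
Qed.

(** * Rotation of rays *)

Lemma continuous_of_lipschitz_at {V : NormedModule R_AbsRing} (f : R -> V) (x d M : R) :
  0 < d -> (forall y, Rabs (y - x) < d -> norm (minus (f y) (f x)) <= M * Rabs (y - x)) ->
  continuous f x.
Proof.
  intros Hd H. apply filterlim_locally. intros eps.
  assert (HM : 0 < Rabs M + 1) by (generalize (Rabs_pos M); lra).
  assert (He : 0 < Rmin d (eps / (Rabs M + 1))).
  { apply Rmin_glb_lt; [exact Hd | apply Rdiv_lt_0_compat; [apply cond_pos | exact HM]]. }
  exists (mkposreal _ He). intros y Hy. change (Rabs (y - x) < Rmin d (eps / (Rabs M + 1))) in Hy.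
  apply (@norm_compat1 R_AbsRing V).
  refine (Rle_lt_trans _ _ _ (H y _) _).
  { apply Rlt_le_trans with (1 := Hy), Rmin_l. }
  apply Rle_lt_trans with (Rabs M * Rabs (y - x)).
  { apply Rmult_le_compat_r; [apply Rabs_pos | apply Rle_abs]. }
  assert (Hy2 : Rabs (y - x) < eps / (Rabs M + 1)) by (apply Rlt_le_trans with (1 := Hy), Rmin_r).
  apply Rmult_lt_compat_r with (r := Rabs M + 1) in Hy2; [| exact HM].
  unfold Rdiv in Hy2. rewrite Rmult_assoc, Rinv_l, Rmult_1_r in Hy2 by lra.
  generalize (Rabs_pos (y - x)) (Rabs_pos M). nra.
Qed.

Lemma is_derive_of_quadratic {V : NormedModule R_AbsRing} (f : R -> V) (x d M : R) (l : V) :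
  0 < d ->
  (forall y, Rabs (y - x) < d ->
     norm (minus (minus (f y) (f x)) (scal (y - x) l)) <= M * (y - x) ^ 2) ->
  is_derive f x l.
Proof.
  intros Hd H. split; [apply is_linear_scal_l |].
  intros x0 Hx0.
  assert (E : x = x0) by exact (@is_filter_lim_locally_unique R_AbsRing R_NormedModule x x0 Hx0).
  subst x0. clear Hx0. intros eps.
  assert (HM : 0 < Rabs M + 1) by (generalize (Rabs_pos M); lra).
  assert (He : 0 < Rmin d (eps / (Rabs M + 1))).
  { apply Rmin_glb_lt; [exact Hd | apply Rdiv_lt_0_compat; [apply cond_pos | exact HM]]. }
  exists (mkposreal _ He). intros y Hy. change (Rabs (y - x) < Rmin d (eps / (Rabs M + 1))) in Hy.
  change (norm (minus (minus (f y) (f x)) (scal (y - x) l)) <= eps * Rabs (y - x)).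
  refine (Rle_trans _ _ _ (H y _) _).
  { apply Rlt_le_trans with (1 := Hy), Rmin_l. }
  assert (Hy2 : Rabs (y - x) < eps / (Rabs M + 1)) by (apply Rlt_le_trans with (1 := Hy), Rmin_r).
  apply Rmult_lt_compat_r with (r := Rabs M + 1) in Hy2; [| exact HM].
  unfold Rdiv in Hy2. rewrite Rmult_assoc, Rinv_l, Rmult_1_r in Hy2 by lra.
  rewrite <- pow2_abs.
  generalize (Rabs_pos (y - x)) (Rabs_pos M) (Rle_abs M). intros P1 P2 P3.
  assert (M * Rabs (y - x) ^ 2 <= Rabs M * Rabs (y - x) ^ 2).
  { apply Rmult_le_compat_r; [apply pow2_ge_0 | exact P3]. }
  nra.
Qed.

(** Mean value inequality by subdivision: over [n] equal steps the quadratic errors add up to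
    [M (b - a)^2 / n], which is below any [eps] for large [n]. *)
Lemma norm_increment_le {K : AbsRing} {V : NormedModule K} (k : R -> V) (a b eta M : R) :
  a <= b ->
  (forall x y, a <= x <= b -> a <= y <= b ->
     norm (minus (k y) (k x)) <= eta * Rabs (y - x) + M * (y - x) ^ 2) ->
  norm (minus (k b) (k a)) <= eta * (b - a).
Proof.
  intros Hab H. apply le_epsilon; intros eps He.
  destruct (INR_unbounded (Rabs M * (b - a) ^ 2 / eps)) as [n Hn].
  assert (Hn0 : 0 < INR n).
  { apply Rle_lt_trans with (2 := Hn). apply Rmult_le_pos; [| left; apply Rinv_0_lt_compat, He].
    apply Rmult_le_pos; [apply Rabs_pos | apply pow2_ge_0]. }
  pose (h := (b - a) / INR n).
  assert (Hh : 0 <= h).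
  { apply Rmult_le_pos; [lra | left; apply Rinv_0_lt_compat, Hn0]. }
  assert (Hnh : INR n * h = b - a) by (unfold h; field; lra).
  assert (S : forall j, (j <= n)%nat ->
    norm (minus (k (a + INR j * h)) (k a)) <= INR j * (eta * h + M * h ^ 2)).
  { induction j as [| j IH]; intros Hj.
    - simpl. replace (a + 0 * h) with a by ring. rewrite Rmult_0_l.
      right. rewrite minus_eq_zero. exact (@norm_zero K V).
    - assert (Hj1 : INR (S j) <= INR n) by (apply le_INR; exact Hj).
      rewrite S_INR in Hj1 |- *.
      pose proof (pos_INR j) as Pj.
      rewrite (minus_trans (k (a + INR j * h))).
      refine (Rle_trans _ _ _ (norm_triangle _ _) _).
      replace ((INR j + 1) * (eta * h + M * h ^ 2))
        with ((eta * h + M * h ^ 2) + INR j * (eta * h + M * h ^ 2)) by ring.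
      apply Rplus_le_compat; [| apply IH; lia].
      refine (Rle_trans _ _ _ (H _ _ _ _) _).
      + split; nra.
      + split; nra.
      + replace (a + (INR j + 1) * h - (a + INR j * h)) with h by ring.
        rewrite Rabs_pos_eq by exact Hh. apply Rle_refl. }
  specialize (S n (le_n n)). rewrite Hnh in S. replace (a + (b - a)) with b in S by ring.
  refine (Rle_trans _ _ _ S _).
  assert (E : INR n * (eta * h + M * h ^ 2) = eta * (b - a) + M * (b - a) ^ 2 / INR n).
  { unfold h. field. lra. }
  rewrite E. apply Rplus_le_compat_l.
  apply Rmult_le_reg_r with (INR n); [exact Hn0 |].
  unfold Rdiv. rewrite Rmult_assoc, Rinv_l, Rmult_1_r by lra.
  apply Rle_trans with (Rabs M * (b - a) ^ 2).
  { apply Rmult_le_compat_r; [apply pow2_ge_0 | apply Rle_abs]. }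
  apply Rmult_gt_compat_r with (r := eps) in Hn; [| exact He].
  unfold Rdiv in Hn. rewrite Rmult_assoc, Rinv_l, Rmult_1_r in Hn by lra. lra.
Qed.

(** Adding the expansion at [z] evaluated at [w] to the one at [w] evaluated at [z] leaves
    [(w - z) (F' w - F' z)]. *)
Lemma qdiff_deriv_lipschitz {X : NormedModule C_AbsRing} (D : C -> Prop) (F F' : C -> X) (M : R) :
  (forall z w, D z -> D w ->
     norm (minus (minus (F w) (F z)) (scal (w - z)%C (F' z))) <= M * Cmod (w - z)%C ^ 2) ->
  forall z w, D z -> D w -> norm (minus (F' w) (F' z)) <= 2 * M * Cmod (w - z)%C.
Proof.
  intros H z w Hz Hw.
  destruct (Req_dec (Cmod (w - z)%C) 0) as [E | E].
  - rewrite E. apply Cmod_eq_0 in E.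
    replace w with z.
    2:{ replace w with ((w - z) + z)%C by ring. rewrite E. ring. }
    rewrite minus_eq_zero, Rmult_0_r. right. exact (@norm_zero _ X).
  - assert (NZ : (w - z)%C <> 0%C) by (intros E0; rewrite E0, Cmod_0 in E; lra).
    pose proof (Cmod_ge_0 (w - z)%C) as P.
    vreplace X (scal (/ (w - z))%C
      (plus (minus (minus (F w) (F z)) (scal (w - z)%C (F' z)))
            (minus (minus (F z) (F w)) (scal (z - w)%C (F' w))))).
    1,2: field; exact NZ.
    apply Rle_trans with (/ Cmod (w - z)%C * (M * Cmod (w - z)%C ^ 2 + M * Cmod (w - z)%C ^ 2)).
    + apply norm_scal_bound; [rewrite Cmod_inv by exact NZ; apply Rle_refl |].
      apply (@norm_plus_bound C_AbsRing X).
      * apply H; assumption.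
      * replace (Cmod (w - z)%C) with (Cmod (z - w)%C); [apply H; assumption |].
        rewrite <- Cmod_opp. f_equal. ring.
    + right. field. exact E.
Qed.

Section Rays.
Context {X : CompleteNormedModule C_AbsRing}.
Variable g : R.
Hypothesis Hg : -1 < g < 0.

Definition on_ray (a : R) (F : C -> X) (rho : R) : real_space X :=
  scal (cis a) (F (RtoC rho * cis a)%C).

Definition is_ray (a : R) (F : C -> X) (l : X) : Prop :=
  is_RInt_gen (V := real_space X) (on_ray a F) (at_right 0) (Rbar_locally p_infty) l.

Lemma is_ray_unique a F l : is_ray a F l -> ray_integral X a F = l.
Proof. intros H. exact (@is_RInt_gen_unique (real_space X) _ _ _ _ _ _ H). Qed.

(** The radii stay in a compact interval, positive once [0 < e], because the constants of [qdiff]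
    degenerate at the origin and at infinity. *)
Definition annular_sector (a b e N : R) (z : C) : Prop :=
  exists rho alpha, e <= rho <= N /\ a <= alpha <= b /\ z = (RtoC rho * cis alpha)%C.

Lemma norm_on_ray a F rho : norm (on_ray a F rho) <= norm (F (RtoC rho * cis a)%C).
Proof.
  refine (Rle_trans _ _ _ (@norm_scal_C X (cis a) _) _). rewrite Cmod_cis. lra.
Qed.

Definition ray_dominated (M a : R) (F : C -> X) : Prop :=
  (forall rho, 0 < rho <= 1 -> norm (F (RtoC rho * cis a)%C) <= M * Rpower rho g) /\
  (forall rho, 1 <= rho -> norm (F (RtoC rho * cis a)%C) <= M * Rpower rho (g / 2 - 1)).

Lemma ray_dominated_on_ray M a F : ray_dominated M a F -> dominated (V := real_space X) g M (on_ray a F).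
Proof.
  intros [H1 H2]. split; intros rho Hr.
  - exact (Rle_trans _ _ _ (norm_on_ray a F rho) (H1 rho Hr)).
  - exact (Rle_trans _ _ _ (norm_on_ray a F rho) (H2 rho Hr)).
Qed.

Lemma is_ray_norm M a F l : is_ray a F l -> ray_dominated M a F -> norm l <= M * dom_const g.
Proof.
  intros H D. exact (dominated_norm_RInt_gen Hg (ray_dominated_on_ray D) H).
Qed.

Lemma Cmod_polar_sub (r s a : R) : Cmod (RtoC s * cis a - RtoC r * cis a)%C = Rabs (s - r).
Proof.
  replace (RtoC s * cis a - RtoC r * cis a)%C with (RtoC (s - r) * cis a)%C
    by (rewrite RtoC_minus; ring).
  rewrite Cmod_mult, Cmod_cis, Cmod_R. ring.
Qed.

Lemma annular_sector_in a b e N rho alpha :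
  e <= rho <= N -> a <= alpha <= b -> annular_sector a b e N (RtoC rho * cis alpha)%C.
Proof. intros H1 H2. exists rho, alpha. auto. Qed.

Lemma on_ray_continuous a F rho :
  (forall e N, 0 < e -> qdiff (annular_sector a a e N) F) -> 0 < rho ->
  continuous (on_ray a F) rho.
Proof.
  intros Q Hr. destruct (Q (rho / 2) (2 * rho)) as (F' & M & HM & _ & L & _); [lra |].
  apply (@continuous_of_lipschitz_at (real_space X) _ rho (rho / 2) M); [lra |].
  intros y Hy. apply Rabs_lt_between in Hy.
  change (@norm C_AbsRing X (minus (on_ray a F y) (on_ray a F rho)) <= M * Rabs (y - rho)).
  unfold on_ray.
  vreplace X (scal (cis a) (minus (F (RtoC y * cis a)%C) (F (RtoC rho * cis a)%C))).
  rewrite <- (Cmod_polar_sub rho y a), <- (Rmult_1_l (M * _)).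
  apply norm_scal_bound; [rewrite Cmod_cis; lra |].
  apply L; apply annular_sector_in; lra.
Qed.

Lemma is_ray_exists M a F :
  (forall e N, 0 < e -> qdiff (annular_sector a a e N) F) -> ray_dominated M a F ->
  exists l, is_ray a F l.
Proof.
  intros Q D.
  exact (dominated_is_RInt_gen Hg (fun rho Hr => on_ray_continuous Q Hr) (ray_dominated_on_ray D)).
Qed.

(* In polar coordinates the Cauchy-Riemann equations say that the derivative of
   the integrand [e^{i alpha} F] in [alpha] is the derivative of [i z F] in
   [rho]; hence the integral over a segment of the ray changes only through
   the boundary values of [z F]. *)
Lemma on_ray_rotation_increment a b e N F ka kb :
  0 < e -> e <= N -> a <= b ->
  (forall e N, 0 < e -> qdiff (annular_sector a b e N) F) ->
  forall eta,
  (forall alpha, a <= alpha <= b ->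
     e * norm (F (RtoC e * cis alpha)%C) + N * norm (F (RtoC N * cis alpha)%C) <= eta) ->
  is_RInt (V := real_space X) (on_ray a F) e N ka ->
  is_RInt (V := real_space X) (on_ray b F) e N kb ->
  norm (minus kb ka) <= eta * (b - a).
Proof.
  intros He HeN Hab Q eta Heta Hka Hkb.
  pose (G := fun z : C => scal z (F z)).
  (* Larger than the radii [[e, N]] of integration, so that radial derivatives at both endpoints are
     two-sided. *)
  pose (D := annular_sector a b (e / 2) (2 * N)).
  assert (QG : qdiff D G).
  { apply (@qdiff_scal X D (fun z => z)); [| apply Q; lra].
    apply qdiff_id with (2 * N). intros z (rho & al & H1 & H2 & ->).
    rewrite Cmod_polar; lra. }
  destruct QG as (G' & M & HM & BG & LG & QG).
  pose proof (qdiff_deriv_lipschitz _ _ _ QG) as LG'.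
  assert (INT : forall al, a <= al <= b -> ex_RInt (V := real_space X) (on_ray al F) e N).
  { intros al Hal. apply (@ex_RInt_continuous (real_space X)). intros z Hz.
    rewrite Rmin_left, Rmax_right in Hz by lra. apply on_ray_continuous; [| lra].
    intros e' N' He'. apply qdiff_subset with (2 := Q e' N' He').
    intros w (rho & al' & H1 & H2 & ->). apply annular_sector_in; lra. }
  pose (k := fun al => RInt (V := real_space X) (on_ray al F) e N).
  rewrite <- (is_RInt_unique (V := real_space X) _ _ _ _ Hka), <- (is_RInt_unique (V := real_space X) _ _ _ _ Hkb).
  (* The integrand has remainder at most [M (N + 1) h^2]: [M N] from the expansion of [G], [M] from
     that of [cis]. Integration over [[e, N]] gives the factor [N - e]. *)
  apply (@norm_increment_le R_AbsRing (real_space X) k a b eta ((N - e) * (M * (N + 1)))); [exact Hab |].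
  intros al al' Hal Hal'. pose (h := al' - al).
  pose (psi := fun rho => scal Ci (G (RtoC rho * cis al)%C) : real_space X).
  pose (dpsi := fun rho => scal Ci (scal (cis al) (G' (RtoC rho * cis al)%C)) : real_space X).
  assert (MCi : Cmod Ci <= 1).
  { unfold Ci. rewrite Cmod_pair. replace (0 ^ 2 + 1 ^ 2) with 1 by ring. rewrite sqrt_1. lra. }
  (* [dpsi] is both the radial derivative of [psi] and the angular derivative of the integrand, so
     its integral consists of boundary values. *)
  assert (Ipsi : is_RInt dpsi e N (minus (psi N) (psi e))).
  { apply (@is_RInt_derive (real_space X) psi dpsi).
    - intros rho Hrho. rewrite Rmin_left, Rmax_right in Hrho by lra.
      apply (@is_derive_of_quadratic (real_space X) _ rho (e / 2) M); [lra |].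
      intros y Hy. apply Rabs_lt_between in Hy.
      change (@norm C_AbsRing X (minus (minus (psi y) (psi rho)) (scal (RtoC (y - rho)) (dpsi rho))) <= M * (y - rho) ^ 2).
      unfold psi, dpsi.
      vreplace X (scal Ci (minus (minus (G (RtoC y * cis al)%C) (G (RtoC rho * cis al)%C))
        (scal (RtoC y * cis al - RtoC rho * cis al)%C (G' (RtoC rho * cis al)%C)))).
      { rewrite RtoC_minus. ring. }
      rewrite <- (Rmult_1_l (M * _)), <- pow2_abs, <- (Cmod_polar_sub rho y al).
      apply norm_scal_bound; [exact MCi |]. apply QG; apply annular_sector_in; lra.
    - intros rho Hrho. rewrite Rmin_left, Rmax_right in Hrho by lra.
      apply (@continuous_of_lipschitz_at (real_space X) _ rho (e / 2) (2 * M)); [lra |].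
      intros y Hy. apply Rabs_lt_between in Hy.
      change (@norm C_AbsRing X (minus (dpsi y) (dpsi rho)) <= 2 * M * Rabs (y - rho)).
      unfold dpsi.
      vreplace X (scal Ci (scal (cis al) (minus (G' (RtoC y * cis al)%C) (G' (RtoC rho * cis al)%C)))).
      rewrite <- (Cmod_polar_sub rho y al), <- (Rmult_1_l (2 * M * _)), <- (Rmult_1_l (2 * M * _)).
      apply norm_scal_bound; [exact MCi |].
      apply norm_scal_bound; [rewrite Cmod_cis; lra |].
      apply LG'; apply annular_sector_in; lra. }
  assert (Hk : forall al, a <= al <= b -> is_RInt (V := real_space X) (on_ray al F) e N (k al)).
  { intros al0 H0. apply (@RInt_correct (real_space X)). apply INT, H0. }
  pose proof (@is_RInt_minus (real_space X) _ _ _ _ _ _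
    (@is_RInt_minus (real_space X) _ _ _ _ _ _ (Hk al' Hal') (Hk al Hal))
    (@is_RInt_scal (real_space X) _ _ _ h _ Ipsi)) as IE.
  assert (BE : norm (minus (minus (k al') (k al)) (scal h (minus (psi N) (psi e))))
               <= (N - e) * (M * (N + 1) * h ^ 2)).
  { refine (@norm_RInt_le_const (real_space X) _ _ _ _ _ HeN _ IE).
    intros rho Hrho.
    match goal with |- @norm _ _ ?v <= ?m => change (@norm C_AbsRing X v <= m) end.
    unfold dpsi, on_ray.
    pose (z := (RtoC rho * cis al)%C). pose (z' := (RtoC rho * cis al')%C).
    assert (Hrho0 : RtoC rho <> 0%C).
    { intros E. apply RtoC_inj in E. lra. }
    change (scal h (scal Ci (scal (cis al) (G' (RtoC rho * cis al)%C)) : real_space X) : real_space X)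
      with (scal (RtoC h) (scal Ci (scal (cis al) (G' z)))).
    change (F (RtoC rho * cis al')%C) with (F z'). change (F (RtoC rho * cis al)%C) with (F z).
    (* On the circle of radius [rho], [cis al * F z] is [G z / rho]; this splits the error into the
       remainder of [G] and that of [cis]. *)
    vreplace X (plus (scal (/ RtoC rho)%C (minus (minus (scal z' (F z')) (scal z (F z))) (scal (z' - z)%C (G' z))))
                     (scal (cis al' - cis al - RtoC h * (Ci * cis al))%C (G' z))).
    1-3: unfold z', z; field; exact Hrho0.
    assert (Hz : D z) by (apply annular_sector_in; lra).
    assert (Hz' : D z') by (apply annular_sector_in; lra).
    assert (Hz'z : Cmod (z' - z)%C <= rho * Rabs h).
    { unfold z', z. replace (RtoC rho * cis al' - RtoC rho * cis al)%C
        with (RtoC rho * (cis al' - cis al))%C by ring.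
      rewrite Cmod_mult, Cmod_nonneg_R by lra. apply Rmult_le_compat_l; [lra |].
      replace al' with (al + h) by (unfold h; ring). apply cis_sub_bound. }
    apply Rle_trans with (/ rho * (M * (rho * Rabs h) ^ 2) + h ^ 2 * M).
    - apply (@norm_plus_bound C_AbsRing X).
      + apply norm_scal_bound.
        { rewrite Cmod_inv, Cmod_nonneg_R by (try exact Hrho0; lra). apply Rle_refl. }
        refine (Rle_trans _ _ _ (QG z z' Hz Hz') _).
        apply Rmult_le_compat_l; [exact HM |]. apply pow_incr. split; [apply Cmod_ge_0 | exact Hz'z].
      + apply norm_scal_bound; [| apply BG; exact Hz].
        replace al' with (al + h) by (unfold h; ring). apply cis_sub_sub_bound.
    - rewrite Rpow_mult_distr, pow2_abs.
      replace (/ rho * (M * (rho ^ 2 * h ^ 2))) with (M * rho * h ^ 2) by (field; lra).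
      assert (0 <= h ^ 2) by apply pow2_ge_0.
      assert (M * rho <= M * N) by (apply Rmult_le_compat_l; lra).
      nra. }
  assert (NP : forall rho, 0 <= rho -> norm (psi rho) <= rho * norm (F (RtoC rho * cis al)%C)).
  { intros rho Hr. rewrite <- (Rmult_1_l (rho * _)).
    apply (@norm_scal_bound X); [exact MCi |].
    apply norm_scal_bound; [| apply Rle_refl]. rewrite Cmod_polar by exact Hr. apply Rle_refl. }
  assert (Bpsi : norm (minus (psi N) (psi e)) <= eta).
  { refine (Rle_trans _ _ _ _ (Heta al Hal)). rewrite Rplus_comm.
    apply (@norm_plus_bound R_AbsRing (real_space X)); [apply NP; lra |].
    refine (Rle_trans _ _ _ (Req_le _ _ (@norm_opp R_AbsRing (real_space X) _)) _). apply NP; lra. }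
  fold h.
  pose proof (@norm_le_plus_minus R_AbsRing (real_space X) (minus (k al') (k al)) (scal h (minus (psi N) (psi e)))) as T.
  refine (Rle_trans _ _ _ T _).
  apply Rplus_le_compat.
  - refine (Rle_trans _ _ _ (@norm_scal R_AbsRing (real_space X) h _) _).
    rewrite Rmult_comm. apply Rmult_le_compat_r; [apply Rabs_pos | exact Bpsi].
  - rewrite <- (Rmult_assoc (N - e)) in BE. refine (Rle_trans _ _ _ _ BE). right.
    refine (eq_trans _ (@norm_opp R_AbsRing (real_space X) _)). apply f_equal.
    symmetry. apply (@opp_minus (real_space X)).
Qed.

(** The boundary terms of [on_ray_rotation_increment] are at most [M e^(1 + g)] and [M N^(g / 2)],
    uniformly in the angle, and vanish as [e] tends to [0] and [N] to infinity. *)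
Lemma ray_rotation M a b F la lb :
  a <= b ->
  (forall e N, 0 < e -> qdiff (annular_sector a b e N) F) ->
  (forall alpha, a <= alpha <= b -> ray_dominated M alpha F) ->
  is_ray a F la -> is_ray b F lb -> la = lb.
Proof.
  intros Hab Q HD Ha Hb. symmetry.
  apply (@eq_of_norm_le R_AbsRing (real_space X)). intros eps He.
  assert (HM : 0 <= M).
  { exact (dominated_ge_0 (ray_dominated_on_ray (HD a ltac:(lra)))). }
  assert (NB : forall (l : real_space X), locally l (fun y => norm (minus y l) < eps / 3)).
  { intros l. apply (@locally_le_locally_norm R_AbsRing (real_space X)).
    assert (H3 : 0 < eps / 3) by lra. exists (mkposreal _ H3). intros y Hy. exact Hy. }
  (* Chosen so that [2 (M c) (b - a) <= eps / 3]; the added ones avoid a zero denominator. *)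
  pose (c := eps / (6 * (M + 1) * (b - a + 1))).
  assert (Hc : 0 < c).
  { apply Rdiv_lt_0_compat; [exact He |]. apply Rmult_lt_0_compat; lra. }
  pose (d := Rmin 1 (Rpower c (/ (1 + g)))).
  pose (B := Rmax 1 (Rpower c (/ (g / 2)))).
  assert (Hd : 0 < d) by (apply Rmin_glb_lt; [lra | apply exp_pos]).
  assert (HB : 1 <= B) by apply Rmax_l.
  pose proof (Ha _ (NB la)) as La. pose proof (Hb _ (NB lb)) as Lb. unfold filtermapi in La, Lb.
  (* Both improper integrals are limits along the same filter, so one pair of endpoints [e], [N]
     serves both. *)
  pose proof (filter_and _ _ (filter_and _ _ La Lb) (filter_prod_corner B Hd)) as HF.
  apply filter_ex in HF.
  destruct HF as [[e N] [[[ka [Hka Na]] [kb [Hkb Nb]]] [H1 H2]]]. simpl in *.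
  assert (Hd1 : d <= 1) by apply Rmin_l.
  assert (P1 : Rpower e (1 + g) <= c).
  { rewrite <- (@Rpower_base_lt (1 + g) c) by lra. apply Rpower_incr_base; [lra |].
    split; [lra |]. apply Rle_trans with d; [lra | apply Rmin_r]. }
  assert (P2 : Rpower N (g / 2) <= c).
  { rewrite <- (@Rpower_base_lt (g / 2) c) by lra. apply Rpower_decr_base; [lra |].
    split; [apply exp_pos |]. apply Rle_trans with B; [apply Rmax_r | lra]. }
  assert (HK : norm (minus kb ka) <= 2 * (M * c) * (b - a)).
  { apply (@on_ray_rotation_increment a b e N F ka kb); try lra; try assumption.
    intros al Hal. destruct (HD al Hal) as [D1 D2].
    specialize (D1 e ltac:(lra)). specialize (D2 N ltac:(lra)).
    assert (E1 : e * Rpower e g = Rpower e (1 + g)).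
    { rewrite Rpower_plus, Rpower_1 by lra. reflexivity. }
    assert (E2 : N * Rpower N (g / 2 - 1) = Rpower N (g / 2)).
    { replace (g / 2) with (1 + (g / 2 - 1)) at 2 by ring. rewrite Rpower_plus, Rpower_1 by lra. reflexivity. }
    replace (2 * (M * c)) with (M * c + M * c) by ring.
    apply Rplus_le_compat.
    - apply Rle_trans with (e * (M * Rpower e g)); [apply Rmult_le_compat_l; [lra | exact D1] |].
      replace (e * (M * Rpower e g)) with (M * (e * Rpower e g)) by ring. rewrite E1.
      apply Rmult_le_compat_l; assumption.
    - apply Rle_trans with (N * (M * Rpower N (g / 2 - 1))); [apply Rmult_le_compat_l; [lra | exact D2] |].
      replace (N * (M * Rpower N (g / 2 - 1))) with (M * (N * Rpower N (g / 2 - 1))) by ring. rewrite E2.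
      apply Rmult_le_compat_l; assumption. }
  assert (HKe : 2 * (M * c) * (b - a) <= eps / 3).
  { unfold c. apply Rmult_le_reg_r with (6 * (M + 1) * (b - a + 1)).
    { apply Rmult_lt_0_compat; lra. }
    replace (2 * (M * (eps / (6 * (M + 1) * (b - a + 1)))) * (b - a) * (6 * (M + 1) * (b - a + 1)))
      with (2 * M * (b - a) * eps) by (field; lra).
    replace (eps / 3 * (6 * (M + 1) * (b - a + 1))) with (2 * eps * ((M + 1) * (b - a + 1))) by field.
    assert (0 <= M * (b - a)) by (apply Rmult_le_pos; lra). nra. }
  change (@norm C_AbsRing X (minus lb la) <= eps).
  vreplace X (plus (plus (minus kb ka) (opp (minus kb lb))) (minus ka la)).
  replace eps with (eps / 3 + eps / 3 + eps / 3) by field.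
  apply (@norm_plus_bound C_AbsRing X); [apply (@norm_plus_bound C_AbsRing X) |].
  - exact (Rle_trans _ _ _ HK HKe).
  - refine (Rle_trans _ _ _ (Req_le _ _ (@norm_opp _ X _)) _). left; exact Nb.
  - left; exact Na.
Qed.

End Rays.

(** * Contour integrals *)

Section Paths.
Context {X : CompleteNormedModule C_AbsRing}.
Variable g : R.
Hypothesis Hg : -1 < g < 0.

Lemma is_ray_plus a (F G : C -> X) l m :
  is_ray a F l -> is_ray a G m -> is_ray a (fun z => plus (F z) (G z)) (plus l m).
Proof.
  intros HF HG. unfold is_ray.
  apply (@is_RInt_gen_ext (real_space X) _ _ _ _ (fun rho => plus (on_ray a F rho) (on_ray a G rho))).
  - apply filter_forall. intros ab rho _.
    change (plus (on_ray a F rho) (on_ray a G rho) = scal (cis a) (plus (F (RtoC rho * cis a)%C) (G (RtoC rho * cis a)%C)) :> X).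
    unfold on_ray. vring X.
  - exact (@is_RInt_gen_plus (real_space X) _ _ _ _ _ _ _ _ HF HG).
Qed.

Lemma is_ray_linear a (F : C -> X) l (L : X -> X) :
  is_linear L -> is_ray a F l -> is_ray a (fun z => L (F z)) (L l).
Proof.
  intros HL HF. unfold is_ray.
  assert (HLR : @is_linear R_AbsRing (real_space X) (real_space X) L).
  { split.
    - apply (linear_plus L HL).
    - intros k x. exact (linear_scal L HL (RtoC k) x).
    - exact (linear_norm L HL). }
  apply (@is_RInt_gen_ext (real_space X) _ _ _ _ (fun rho => L (on_ray a F rho))).
  - apply filter_forall. intros ab rho _.
    exact (linear_scal L HL (cis a) (F (RtoC rho * cis a)%C)).
  - exact (is_RInt_gen_linear HLR HF).
Qed.

Lemma is_ray_ext a (F G : C -> X) l :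
  (forall rho, 0 < rho -> F (RtoC rho * cis a)%C = G (RtoC rho * cis a)%C) ->
  is_ray a F l -> is_ray a G l.
Proof.
  intros E. apply (@is_RInt_gen_ext (real_space X)); try typeclasses eauto.
  generalize (filter_prod_corner 1 Rlt_0_1). apply filter_imp.
  intros [u v] [Hu Hv] rho Hrho. simpl in *. unfold on_ray. rewrite E; [reflexivity |].
  assert (0 < Rmin u v) by (apply Rmin_glb_lt; lra). lra.
Qed.

Lemma is_linear_scal_C (c : C) : is_linear (fun x : X => scal c x).
Proof.
  exact (@is_linear_scal_r C_AbsRing X c (fun n m => Cmult_comm n m)).
Qed.

(** The contour [Gamma_theta]. *)
Definition is_path (theta : R) (F : C -> X) (l : X) : Prop :=
  exists l1 l2, is_ray (- theta) F l1 /\ is_ray theta F l2 /\ l = minus l1 l2.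

Lemma is_path_unique theta F l : is_path theta F l -> path_integral X theta F = l.
Proof.
  intros (l1 & l2 & H1 & H2 & ->). unfold path_integral.
  rewrite (is_ray_unique H1), (is_ray_unique H2). reflexivity.
Qed.

Lemma is_path_plus theta F G l m :
  is_path theta F l -> is_path theta G m -> is_path theta (fun z => plus (F z) (G z)) (plus l m).
Proof.
  intros (l1 & l2 & H1 & H2 & ->) (m1 & m2 & K1 & K2 & ->).
  exists (plus l1 m1), (plus l2 m2).
  split; [apply is_ray_plus; assumption |]. split; [apply is_ray_plus; assumption |]. vring X.
Qed.

Lemma is_path_linear theta F l (L : X -> X) :
  is_linear L -> is_path theta F l -> is_path theta (fun z => L (F z)) (L l).
Proof.
  intros HL (l1 & l2 & H1 & H2 & ->). exists (L l1), (L l2).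
  split; [apply is_ray_linear; assumption |]. split; [apply is_ray_linear; assumption |].
  unfold minus. etransitivity; [apply (linear_plus L HL) |]. apply f_equal.
  transitivity (L (scal (- (1))%C l2)); [apply f_equal; vring X |].
  etransitivity; [apply (linear_scal L HL) |]. vring X.
Qed.

Lemma is_path_scal theta F l (c : C) :
  is_path theta F l -> is_path theta (fun z => scal c (F z)) (scal c l).
Proof. apply (@is_path_linear theta F l (fun x => scal c x)), is_linear_scal_C. Qed.

Definition on_path (theta : R) (P : C -> Prop) : Prop :=
  forall rho alpha, 0 < rho -> (alpha = - theta \/ alpha = theta) -> P (RtoC rho * cis alpha)%C.

Lemma is_path_ext theta F G l :
  on_path theta (fun z => F z = G z) -> is_path theta F l -> is_path theta G l.
Proof.
  intros E (l1 & l2 & H1 & H2 & ->). exists l1, l2.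
  split; [apply is_ray_ext with (2 := H1); intros rho Hr; apply E; auto |].
  split; [apply is_ray_ext with (2 := H2); intros rho Hr; apply E; auto | reflexivity].
Qed.

Lemma is_path_eq theta F l m : is_path theta F l -> is_path theta F m -> l = m.
Proof. intros H1 H2. rewrite <- (is_path_unique H1). apply is_path_unique, H2. Qed.

(** Holomorphic on the closed sector between the angles [a] and [b], with the
    bounds that make the integrals over its rays converge uniformly. *)
Definition tame (a b M : R) (F : C -> X) : Prop :=
  (forall e N, 0 < e -> qdiff (annular_sector a b e N) F) /\
  (forall alpha, a <= alpha <= b -> ray_dominated g M alpha F).

Lemma tame_sub a b a' b' M F : a <= a' -> b' <= b -> tame a b M F -> tame a' b' M F.
Proof.
  intros Ha Hb [Q D]. split.
  - intros e N He. apply qdiff_subset with (2 := Q e N He).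
    intros z (rho & al & H1 & H2 & ->). apply annular_sector_in; lra.
  - intros al Hal. apply D; lra.
Qed.

Lemma tame_is_ray a b M F alpha : tame a b M F -> a <= alpha <= b -> exists l, is_ray alpha F l.
Proof.
  intros T Hal. destruct (@tame_sub a b alpha alpha M F) as [Q D]; try lra; [exact T |].
  apply (is_ray_exists Hg Q (D alpha ltac:(lra))).
Qed.

Lemma tame_is_path theta M F :
  tame (- theta) (- theta) M F -> tame theta theta M F -> exists l, is_path theta F l.
Proof.
  intros T1 T2. destruct (tame_is_ray T1 (alpha := - theta)) as [l1 H1]; [lra |].
  destruct (tame_is_ray T2 (alpha := theta)) as [l2 H2]; [lra |].
  exists (minus l1 l2), l1, l2. auto.
Qed.

Lemma is_path_norm theta M F l :
  is_path theta F l -> ray_dominated g M (- theta) F -> ray_dominated g M theta F ->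
  norm l <= 2 * (M * dom_const g).
Proof.
  intros (l1 & l2 & H1 & H2 & ->) D1 D2.
  replace (2 * (M * dom_const g)) with (M * dom_const g + M * dom_const g) by ring.
  apply (@norm_plus_bound C_AbsRing X); [exact (is_ray_norm Hg H1 D1) |].
  refine (Rle_trans _ _ _ (Req_le _ _ (@norm_opp _ X _)) _). exact (is_ray_norm Hg H2 D2).
Qed.

(** The ray at [- theta] rotates through the sector into the ray at [theta], and the path integral
    is the difference of the two. *)
Lemma path_zero_inside theta M F :
  0 <= theta -> tame (- theta) theta M F -> is_path theta F zero.
Proof.
  intros Ht T.
  destruct (tame_is_ray T (alpha := - theta)) as [l1 H1]; [lra |].
  destruct (tame_is_ray T (alpha := theta)) as [l2 H2]; [lra |].
  exists l1, l2. split; [exact H1 |]. split; [exact H2 |].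
  destruct T as [Q D].
  rewrite (@ray_rotation X g Hg M (- theta) theta F l1 l2) by (try assumption; lra).
  symmetry. exact (minus_eq_zero l2).
Qed.

Lemma cis_PI_opp : cis (- PI) = cis PI.
Proof. unfold cis. rewrite cos_neg, sin_neg, sin_PI. f_equal. ring. Qed.

(** The two rays rotate away from the sector, one on each side, until they coincide on the negative
    axis, where [cis (- PI) = cis PI]. *)
Lemma path_zero_outside theta M F :
  theta <= PI -> tame (- PI) (- theta) M F -> tame theta PI M F -> is_path theta F zero.
Proof.
  intros Ht T1 T2.
  destruct (tame_is_ray T1 (alpha := - theta)) as [l1 H1]; [lra |].
  destruct (tame_is_ray T1 (alpha := - PI)) as [m1 K1]; [lra |].
  destruct (tame_is_ray T2 (alpha := theta)) as [l2 H2]; [lra |].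
  destruct (tame_is_ray T2 (alpha := PI)) as [m2 K2]; [lra |].
  exists l1, l2. split; [exact H1 |]. split; [exact H2 |].
  destruct T1 as [Q1 D1]. destruct T2 as [Q2 D2].
  rewrite <- (@ray_rotation X g Hg M (- PI) (- theta) F m1 l1) by (try assumption; lra).
  rewrite (@ray_rotation X g Hg M theta PI F l2 m2) by (try assumption; lra).
  assert (E : m1 = m2).
  { rewrite <- (is_ray_unique K1), <- (is_ray_unique K2).
    unfold ray_integral. rewrite cis_PI_opp. reflexivity. }
  rewrite E. symmetry. exact (minus_eq_zero m2).
Qed.

(** [c] is the scalar factor of an integrand: bounded near [0], where the resolvent alone is
    integrable, and of order [rho^q] at infinity. *)
Definition weight_bound (q B a : R) (c : C -> C) : Prop :=
  (forall rho, 0 < rho <= 1 -> Cmod (c (RtoC rho * cis a)%C) <= B) /\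
  (forall rho, 1 <= rho -> Cmod (c (RtoC rho * cis a)%C) <= B * Rpower rho q).

Lemma Rpower_mono_exp (q r rho : R) : 1 <= rho -> q <= r -> Rpower rho q <= Rpower rho r.
Proof.
  intros Hr Hq. apply exp_le.
  assert (0 <= ln rho) by (rewrite <- ln_1; apply ln_le; lra). nra.
Qed.

Lemma Rpower_anti_exp (q r rho : R) : 0 < rho <= 1 -> q <= r -> Rpower rho r <= Rpower rho q.
Proof.
  intros Hr Hq. apply exp_le.
  assert (ln rho <= 0) by (rewrite <- ln_1; apply ln_le; lra). nra.
Qed.

Lemma weight_bound_ge_0 q B a c : weight_bound q B a c -> 0 <= B.
Proof. intros [H _]. apply Rle_trans with (2 := H 1 ltac:(lra)), Cmod_ge_0. Qed.

Lemma weight_bound_weaken q r B a c : q <= r -> weight_bound q B a c -> weight_bound r B a c.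
Proof.
  intros Hq H. pose proof (weight_bound_ge_0 H) as HB. destruct H as [H1 H2].
  split; [exact H1 |]. intros rho Hr. apply Rle_trans with (1 := H2 rho Hr).
  apply Rmult_le_compat_l; [exact HB | apply Rpower_mono_exp; assumption].
Qed.

Lemma weight_bound_mult q1 q2 B1 B2 a c1 c2 :
  weight_bound q1 B1 a c1 -> weight_bound q2 B2 a c2 ->
  weight_bound (q1 + q2) (B1 * B2) a (fun z => (c1 z * c2 z)%C).
Proof.
  intros H K. destruct H as [H1 H2]. destruct K as [K1 K2]. split; intros rho Hr; rewrite Cmod_mult.
  - apply Rmult_le_compat; auto; apply Cmod_ge_0.
  - rewrite Rpower_plus.
    replace (B1 * B2 * (Rpower rho q1 * Rpower rho q2)) with (B1 * Rpower rho q1 * (B2 * Rpower rho q2)) by ring.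
    apply Rmult_le_compat; auto; apply Cmod_ge_0.
Qed.

(** A constant vector does not decay, so the weight alone has to: [-2 <= g / 2 - 1], and near [0]
    one uses [1 <= rho^g]. *)
Lemma ray_dominated_const B a c (x : X) :
  weight_bound (-2) B a c -> ray_dominated g (B * norm x) a (fun z => scal (c z) x).
Proof.
  intros H. pose proof (weight_bound_ge_0 H) as HB. pose proof (norm_ge_0 x) as Hx.
  assert (HBx : 0 <= B * norm x) by (apply Rmult_le_pos; assumption).
  destruct H as [H1 H2]. split; intros rho Hr.
  - apply Rle_trans with (B * norm x); [apply (@norm_scal_bound X); [auto | apply Rle_refl] |].
    rewrite <- (Rmult_1_r (B * norm x)) at 1. apply Rmult_le_compat_l; [exact HBx |].
    rewrite <- (Rpower_O rho) by lra. apply Rpower_anti_exp; lra.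
  - apply Rle_trans with (B * Rpower rho (-2) * norm x);
      [apply (@norm_scal_bound X); [auto | apply Rle_refl] |].
    replace (B * Rpower rho (-2) * norm x) with (B * norm x * Rpower rho (-2)) by ring.
    apply Rmult_le_compat_l; [exact HBx |]. apply Rpower_mono_exp; lra.
Qed.

(** The exponents add up: [(- g / 2 - 1) + g = g / 2 - 1], the decay asked for at infinity. *)
Lemma ray_dominated_weight B K a c (F : C -> X) :
  0 <= K ->
  (forall rho, 0 < rho -> norm (F (RtoC rho * cis a)%C) <= K * Rpower rho g) ->
  weight_bound (- g / 2 - 1) B a c -> ray_dominated g (B * K) a (fun z => scal (c z) (F z)).
Proof.
  intros HK HF [H1 H2]. split; intros rho Hr.
  - rewrite Rmult_assoc. apply (@norm_scal_bound X); [auto | apply HF; lra].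
  - replace (g / 2 - 1) with ((- g / 2 - 1) + g) by field. rewrite Rpower_plus.
    replace (B * K * (Rpower rho (- g / 2 - 1) * Rpower rho g))
      with (B * Rpower rho (- g / 2 - 1) * (K * Rpower rho g)) by ring.
    apply (@norm_scal_bound X); [auto | apply HF; lra].
Qed.

End Paths.

(** * Exponential weights and simple poles on rays *)

Definition exp_const (a : R) : R := Rmax 1 (4 / a) ^ 4.

Lemma exp_const_pos (a : R) : 0 < exp_const a.
Proof. apply pow_lt. apply Rlt_le_trans with 1; [lra | apply Rmax_l]. Qed.

(** With [L = max (1, 4 / a)] one has [1 + rho <= L (1 + a rho / 4)], and [(1 + y)^4 <= e^{4 y}]. *)
Lemma exp_decay (a rho : R) :
  0 < a -> 0 <= rho -> (1 + rho) ^ 4 * exp (- (a * rho)) <= exp_const a.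
Proof.
  intros Ha Hr. unfold exp_const.
  pose (L := Rmax 1 (4 / a)). fold L.
  assert (L1 : 1 <= L) by apply Rmax_l.
  assert (L2 : 1 <= L * (a / 4)).
  { replace 1 with (4 / a * (a / 4)) by (field; lra).
    apply Rmult_le_compat_r; [lra | apply Rmax_r]. }
  assert (B : 1 + rho <= L * (1 + a * rho / 4)) by nra.
  assert (E : (1 + a * rho / 4) ^ 4 <= exp (a * rho)).
  { replace (exp (a * rho)) with (exp (a * rho / 4) ^ 4).
    - apply pow_incr. split; [nra | apply exp_ineq1_le].
    - simpl. rewrite Rmult_1_r, <- !exp_plus. f_equal. field. }
  assert (P : (1 + rho) ^ 4 <= L ^ 4 * exp (a * rho)).
  { apply Rle_trans with (L ^ 4 * (1 + a * rho / 4) ^ 4).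
    - rewrite <- Rpow_mult_distr. apply pow_incr. lra.
    - apply Rmult_le_compat_l; [apply pow_le; lra | exact E]. }
  rewrite exp_Ropp. apply Rmult_le_reg_r with (exp (a * rho)); [apply exp_pos |].
  rewrite Rmult_assoc, Rinv_l, Rmult_1_r by (apply Rgt_not_eq, exp_pos). exact P.
Qed.

(** Of the four powers of [1 + rho] absorbed by the exponential, two cover the polynomial factor of
    the hypothesis and two give the decay [rho^(-2)]. *)
Lemma weight_bound_exp_decay (a B alpha : R) (c : C -> C) :
  0 < a -> 0 <= B ->
  (forall rho, 0 < rho -> Cmod (c (RtoC rho * cis alpha)%C) <= B * ((1 + rho) ^ 2 * exp (- (a * rho)))) ->
  weight_bound (-2) (B * exp_const a) alpha c.
Proof.
  intros Ha HB H.
  assert (D : forall rho, 0 < rho -> (1 + rho) ^ 2 * ((1 + rho) ^ 2 * exp (- (a * rho))) <= exp_const a).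
  { intros rho Hr. generalize (@exp_decay a rho Ha ltac:(lra)). simpl. lra. }
  assert (P : forall rho, 0 < rho -> 0 <= (1 + rho) ^ 2 * exp (- (a * rho))).
  { intros rho Hr. apply Rmult_le_pos; [apply pow2_ge_0 | left; apply exp_pos]. }
  split; intros rho Hr.
  - apply Rle_trans with (1 := H rho ltac:(lra)). apply Rmult_le_compat_l; [exact HB |].
    specialize (D rho ltac:(lra)). specialize (P rho ltac:(lra)).
    assert (1 <= (1 + rho) ^ 2) by nra. nra.
  - apply Rle_trans with (1 := H rho ltac:(lra)). rewrite Rmult_assoc.
    apply Rmult_le_compat_l; [exact HB |].
    specialize (D rho ltac:(lra)). specialize (P rho ltac:(lra)).
    assert (E : Rpower rho (-2) = / rho ^ 2).
    { replace (-2) with (- INR 2) by (simpl; ring). rewrite Rpower_Ropp, Rpower_pow by lra. reflexivity. }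
    rewrite E. assert (Hr2 : 0 < rho ^ 2) by nra.
    apply Rmult_le_reg_r with (rho ^ 2); [exact Hr2 |].
    replace (exp_const a * / rho ^ 2 * rho ^ 2) with (exp_const a) by (field; lra).
    assert (rho ^ 2 <= (1 + rho) ^ 2) by nra. nra.
Qed.

Lemma cos_le_of_abs (theta alpha : R) :
  Rabs alpha <= theta <= PI -> cos theta <= cos alpha.
Proof.
  intros H. replace (cos alpha) with (cos (Rabs alpha)).
  - apply cos_decr_1; try lra; generalize (Rabs_pos alpha); lra.
  - unfold Rabs. destruct (Rcase_abs alpha); [apply cos_neg | reflexivity].
Qed.

Lemma Cmod_exp_ray (t theta alpha rho : R) :
  0 <= t -> 0 <= rho -> Rabs alpha <= theta <= PI ->
  Cmod (Cexp (- (RtoC t * (RtoC rho * cis alpha))))%C <= exp (- (t * cos theta * rho)).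
Proof.
  intros Ht Hr Ha. rewrite Cmod_Cexp. apply exp_le. simpl.
  pose proof (cos_le_of_abs _ Ha).
  assert (0 <= t * rho) by (apply Rmult_le_pos; assumption). nra.
Qed.

(** The square of the distance is [rho^2 - 2 rho cos alpha + 1]; use [cos alpha <= cos theta], then
    [2 rho <= rho^2 + 1] with [0 <= cos theta]. *)
Lemma Cmod_sub_1_ray (theta alpha rho : R) :
  0 <= theta <= PI / 2 -> theta <= Rabs alpha <= PI -> 0 <= rho ->
  (1 - cos theta) * (rho ^ 2 + 1) <= Cmod (RtoC rho * cis alpha - RtoC 1)%C ^ 2.
Proof.
  intros Ht Ha Hr. rewrite Cmod_sqr. simpl.
  assert (Hc : cos alpha <= cos theta).
  { replace (cos alpha) with (cos (Rabs alpha)).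
    - apply cos_decr_1; lra.
    - unfold Rabs. destruct (Rcase_abs alpha); [apply cos_neg | reflexivity]. }
  assert (C0 : 0 <= cos theta) by (apply cos_ge_0; lra).
  generalize (sin2_cos2 alpha). unfold Rsqr. intros S.
  match goal with |- _ <= ?e =>
    replace e with (rho ^ 2 * (sin alpha * sin alpha + cos alpha * cos alpha) - 2 * rho * cos alpha + 1)
      by ring end.
  rewrite S.
  assert (0 <= cos theta * (rho - 1) ^ 2) by (apply Rmult_le_pos; [exact C0 | apply pow2_ge_0]).
  assert (rho * cos alpha <= rho * cos theta) by (apply Rmult_le_compat_l; assumption). nra.
Qed.

Lemma Cmod_add_1_ray (alpha rho : R) :
  Rabs alpha <= PI / 2 -> 0 <= rho ->
  rho ^ 2 + 1 <= Cmod (RtoC rho * cis alpha - RtoC (-1))%C ^ 2.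
Proof.
  intros Ha Hr. rewrite Cmod_sqr. simpl.
  assert (Hc : 0 <= cos alpha).
  { rewrite <- cos_PI2. apply cos_le_of_abs. generalize PI_RGT_0; lra. }
  generalize (sin2_cos2 alpha). unfold Rsqr. intros S. nra.
Qed.

(** The quadratic form of the hypothesis gives at once the lower bounds [sqrt d], used near [0], and
    [sqrt d * rho], used at infinity. *)
Lemma weight_bound_inv (alpha d : R) (p : C) :
  0 < d -> (forall rho, 0 <= rho -> d * (rho ^ 2 + 1) <= Cmod (RtoC rho * cis alpha - p)%C ^ 2) ->
  weight_bound (-1) (/ sqrt d) alpha (fun z => (/ (z - p))%C).
Proof.
  intros Hd H. pose proof (sqrt_lt_R0 d Hd) as Hs. pose proof (sqrt_sqrt d ltac:(lra)) as Hss.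
  assert (L : forall rho, 0 <= rho ->
    sqrt d <= Cmod (RtoC rho * cis alpha - p)%C /\ sqrt d * rho <= Cmod (RtoC rho * cis alpha - p)%C).
  { intros rho Hr. specialize (H rho Hr). pose proof (Cmod_ge_0 (RtoC rho * cis alpha - p)%C).
    assert (0 <= sqrt d * rho) by (apply Rmult_le_pos; lra).
    split; apply Rsqr_incr_0_var; unfold Rsqr; try assumption; nra. }
  assert (NZ : forall rho, 0 <= rho -> (RtoC rho * cis alpha - p)%C <> 0%C).
  { intros rho Hr. apply Cmod_gt_0. destruct (L rho Hr). lra. }
  split; intros rho Hr; rewrite Cmod_inv by (apply NZ; lra).
  - apply Rinv_le_contravar; [exact Hs | apply L; lra].
  - replace (-1) with (- (1)) by ring. rewrite Rpower_Ropp, Rpower_1, <- Rinv_mult by lra.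
    apply Rinv_le_contravar; [nra | apply L; lra].
Qed.

Lemma qdiff_inv_sector (a b e N d : R) (p : C) :
  0 < d -> 0 < e ->
  (forall rho alpha, 0 <= rho -> a <= alpha <= b ->
     d * (rho ^ 2 + 1) <= Cmod (RtoC rho * cis alpha - p)%C ^ 2) ->
  qdiff (X := AbsRing_NormedModule C_AbsRing) (annular_sector a b e N) (fun z => (/ (z - p))%C).
Proof.
  intros Hd He H. apply qdiff_inv with (sqrt d); [apply sqrt_lt_R0, Hd |].
  intros z (rho & al & H1 & H2 & ->). specialize (H rho al ltac:(lra) H2).
  pose proof (sqrt_sqrt d ltac:(lra)) as Hss. pose proof (Cmod_ge_0 (RtoC rho * cis al - p)%C).
  apply Rsqr_incr_0_var; unfold Rsqr; [nra | assumption].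
Qed.

Lemma qdiff_exp_sector (a b e N t : R) :
  0 < e -> qdiff (X := AbsRing_NormedModule C_AbsRing) (annular_sector a b e N)
    (fun z => Cexp (- (RtoC t * z))%C).
Proof.
  intros He. apply qdiff_exp with (Rabs N); [apply Rabs_pos |].
  intros z (rho & al & H1 & H2 & ->). rewrite Cmod_polar by lra.
  apply Rle_trans with N; [lra | apply Rle_abs].
Qed.

Lemma qdiff_id_sector (a b e N : R) :
  0 < e -> qdiff (X := AbsRing_NormedModule C_AbsRing) (annular_sector a b e N) (fun z => z).
Proof.
  intros He. apply qdiff_id with N.
  intros z (rho & al & H1 & H2 & ->). rewrite Cmod_polar by lra. lra.
Qed.

Lemma qdiff_mult (D : C -> Prop) (c d : C -> C) :
  qdiff (X := AbsRing_NormedModule C_AbsRing) D c ->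
  qdiff (X := AbsRing_NormedModule C_AbsRing) D d ->
  qdiff (X := AbsRing_NormedModule C_AbsRing) D (fun z => (c z * d z)%C).
Proof. intros Hc Hd. exact (@qdiff_scal (AbsRing_NormedModule C_AbsRing) D c d Hc Hd). Qed.

(** * Poles and resolvents *)

Lemma filterlim_atan_p_infty : filterlim atan (Rbar_locally p_infty) (locally (PI / 2)).
Proof.
  apply filterlim_locally. intros eps. pose proof PI_RGT_0 as HP.
  assert (He : 0 < Rmin eps (PI / 2)) by (apply Rmin_glb_lt; [apply cond_pos | lra]).
  pose proof (Rmin_l eps (PI / 2)). pose proof (Rmin_r eps (PI / 2)).
  exists (tan (PI / 2 - Rmin eps (PI / 2))). intros y Hy.
  change (Rabs (atan y - PI / 2) < eps).
  apply atan_increasing in Hy. rewrite atan_tan in Hy by lra.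
  pose proof (atan_bound y). apply Rabs_def1; lra.
Qed.

(** A primitive is [atan ((rho - c) / s) + atan ((rho + c) / s)]; it vanishes at [0] by oddness and
    tends to [PI] at infinity. *)
Lemma is_RInt_gen_pole_pair (c s : R) :
  0 < s ->
  is_RInt_gen (V := R_NormedModule) (fun rho => s / ((rho - c) ^ 2 + s ^ 2) + s / ((rho + c) ^ 2 + s ^ 2))
    (at_right 0) (Rbar_locally p_infty) PI.
Proof.
  intros Hs.
  assert (D : forall d rho, 0 < (rho - d) ^ 2 + s ^ 2).
  { intros d rho. generalize (pow2_ge_0 (rho - d)). nra. }
  pose (p := fun rho => s / ((rho - c) ^ 2 + s ^ 2) + s / ((rho + c) ^ 2 + s ^ 2)). fold p.
  pose (Q := fun rho => atan ((rho - c) / s) + atan ((rho + c) / s)).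
  assert (HQ : forall rho, is_derive Q rho (p rho)).
  { intros rho. unfold Q, p. auto_derive; [trivial |].
    pose proof (D c rho). pose proof (D (- c) rho). replace (rho - - c) with (rho + c) in * by ring.
    field. repeat split; try lra; nra. }
  assert (HI : forall a b, is_RInt (V := R_NormedModule) p a b (Q b - Q a)).
  { intros a b. apply (@is_RInt_derive R_CompleteNormedModule Q p).
    - intros x _. apply HQ.
    - intros x _. apply (@ex_derive_continuous R_AbsRing R_NormedModule).
      unfold p. pose proof (D c x). pose proof (D (- c) x). replace (x - - c) with (x + c) in * by ring.
      auto_derive. repeat split; nra. }
  assert (Q0 : filterlim Q (at_right 0) (locally 0)).
  { refine (filterlim_filter_le_1 (F := locally 0) Q _ _).
    { intros P HP. unfold at_right, within. revert HP. apply filter_imp. auto. }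
    replace 0 with (Q 0) at 2.
    - apply (@ex_derive_continuous R_AbsRing R_NormedModule Q 0). eexists; apply HQ.
    - unfold Q. replace ((0 - c) / s) with (- ((0 + c) / s)) by (field; lra).
      rewrite atan_opp. ring. }
  assert (Qoo : filterlim Q (Rbar_locally p_infty) (locally PI)).
  { assert (L : forall d, filterlim (fun rho => atan ((rho + d) / s)) (Rbar_locally p_infty) (locally (PI / 2))).
    { intros d. apply filterlim_comp with (2 := filterlim_atan_p_infty).
      intros P [M HM]. exists (M * s - d). intros x Hx. apply HM.
      apply Rmult_lt_reg_r with s; [exact Hs |]. unfold Rdiv.
      rewrite Rmult_assoc, Rinv_l by lra. lra. }
    replace PI with (plus (PI / 2) (PI / 2)) by (unfold plus; simpl; field).
    apply (filterlim_comp_2 (G := locally (PI / 2)) (H := locally (PI / 2))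
      (fun rho => atan ((rho + - c) / s)) (fun rho => atan ((rho + c) / s)) plus).
    - apply L.
    - apply L.
    - apply (@filterlim_plus R_AbsRing R_NormedModule). }
  intros P HP. unfold filtermapi.
  assert (Lim : filterlim (fun ab => Q (snd ab) - Q (fst ab))
     (filter_prod (at_right 0) (Rbar_locally p_infty)) (locally PI)).
  { replace PI with (plus PI (opp 0)) by (unfold plus, opp; simpl; ring).
    apply (filterlim_comp_2 (G := locally PI) (H := locally (opp 0))
      (fun ab => Q (snd ab)) (fun ab => opp (Q (fst ab))) plus).
    - apply filterlim_comp with (Rbar_locally p_infty); [apply filterlim_snd | exact Qoo].
    - apply filterlim_comp with (locally 0).
      + apply filterlim_comp with (at_right 0); [apply filterlim_fst | exact Q0].
      + apply (@filterlim_opp R_AbsRing R_NormedModule).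
    - apply (@filterlim_plus R_AbsRing R_NormedModule). }
  generalize (Lim P HP). unfold filtermap. apply filter_imp. intros [a b] Hab.
  exists (Q b - Q a). split; [apply HI | exact Hab].
Qed.

(** The two denominators are conjugate, so their product is the real number [D], and the numerator
    reduces to [e (cis theta - cis (- theta))]. The cases [e = 1] and [e = -1] are the two poles. *)
Lemma pole_pair (theta rho e : R) :
  e ^ 2 = 1 -> 0 < (rho - e * cos theta) ^ 2 + sin theta ^ 2 ->
  (cis (- theta) * / (RtoC rho * cis (- theta) - RtoC e) - cis theta * / (RtoC rho * cis theta - RtoC e))%C
  = (RtoC (e * sin theta / ((rho - e * cos theta) ^ 2 + sin theta ^ 2)) * (RtoC 2 * Ci))%C.
Proof.
  intros He HD. pose (D := (rho - e * cos theta) ^ 2 + sin theta ^ 2). fold D in HD |- *.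
  pose proof (sin2_cos2 theta) as SC. unfold Rsqr in SC.
  pose (w := (RtoC rho * cis theta - RtoC e)%C). pose (w' := (RtoC rho * cis (- theta) - RtoC e)%C).
  fold w w'.
  assert (HW : (w * w')%C = RtoC D).
  { unfold w, w', D, cis, Cmult, Cminus, Cplus, Copp, RtoC; simpl. rewrite cos_neg, sin_neg.
    f_equal; [| ring].
    match goal with |- ?l = ?r => replace l with
      (rho * rho * (sin theta * sin theta + cos theta * cos theta) - 2 * e * rho * cos theta + e ^ 2) by ring;
      replace r with (rho * rho - 2 * e * rho * cos theta + e ^ 2 * (cos theta * cos theta) + sin theta * sin theta) by ring end.
    rewrite SC, He. lra. }
  assert (HD0 : RtoC D <> 0%C) by (intros E; apply RtoC_inj in E; lra).
  assert (Hw : w <> 0%C).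
  { intros E. rewrite E in HW. apply HD0. rewrite <- HW. ring. }
  assert (Hw' : w' <> 0%C).
  { intros E. rewrite E in HW. apply HD0. rewrite <- HW. ring. }
  assert (HN : (cis (- theta) * w - cis theta * w')%C = (RtoC (e * sin theta) * (RtoC 2 * Ci))%C).
  { unfold w, w', cis, Cmult, Cminus, Cplus, Copp, RtoC, Ci; simpl. rewrite cos_neg, sin_neg.
    f_equal; ring. }
  transitivity ((cis (- theta) * w - cis theta * w') / (w * w'))%C; [field; auto |].
  rewrite HN, HW. unfold Rdiv. rewrite !RtoC_mult, RtoC_inv by lra. field. exact HD0.
Qed.

Section PolePath.
Context {X : CompleteNormedModule C_AbsRing}.
Variable g : R.
Hypothesis Hg : -1 < g < 0.
Variable theta : R.
Hypothesis Htheta : 0 < theta < PI / 2.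

Lemma cos_theta_lt_1 : cos theta < 1.
Proof. rewrite <- cos_0. apply cos_decreasing_1; generalize PI_RGT_0; lra. Qed.

Lemma sub_1_outside rho alpha :
  0 <= rho -> theta <= Rabs alpha <= PI ->
  (1 - cos theta) * (rho ^ 2 + 1) <= Cmod (RtoC rho * cis alpha - RtoC 1)%C ^ 2.
Proof. intros Hr Ha. apply Cmod_sub_1_ray; [lra | exact Ha | exact Hr]. Qed.

Lemma add_1_inside rho alpha :
  0 <= rho -> Rabs alpha <= theta -> 1 * (rho ^ 2 + 1) <= Cmod (RtoC rho * cis alpha - RtoC (-1))%C ^ 2.
Proof. intros Hr Ha. rewrite Rmult_1_l. apply Cmod_add_1_ray; lra. Qed.

Lemma weight_sub_1 alpha :
  theta <= Rabs alpha <= PI ->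
  weight_bound (-1) (/ sqrt (1 - cos theta)) alpha (fun z => (/ (z - RtoC 1))%C).
Proof.
  intros Ha. apply weight_bound_inv; [generalize cos_theta_lt_1; lra |].
  intros rho Hr. apply sub_1_outside; assumption.
Qed.

Lemma weight_add_1 alpha :
  Rabs alpha <= theta -> weight_bound (-1) 1 alpha (fun z => (/ (z - RtoC (-1)))%C).
Proof.
  intros Ha. cut (weight_bound (-1) (/ sqrt 1) alpha (fun z => (/ (z - RtoC (-1)))%C)).
  { rewrite sqrt_1, Rinv_1. auto. }
  apply weight_bound_inv; [lra |]. intros rho Hr. apply add_1_inside; assumption.
Qed.

(** The value is [2 pi i] times the residue at [1], the only pole to the left of the contour. The
    two poles are kept together because [1 / (z - 1)] alone decays too slowly for its ray integrals
    to converge. Conjugate points of the two rays combine into [2 i] times the real pole pair, whose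
    integral is [PI]. *)
Lemma path_pole_pair (x : X) :
  is_path theta (fun z => scal (RtoC 2 * (/ (z - RtoC 1) * / (z - RtoC (-1))))%C x)
    (scal (RtoC (2 * PI) * Ci)%C x).
Proof.
  pose (F := fun z => scal (RtoC 2 * (/ (z - RtoC 1) * / (z - RtoC (-1))))%C x). fold F.
  pose (B := / sqrt (1 - cos theta) * 1).
  assert (T : forall alpha, Rabs alpha = theta -> tame g alpha alpha (B * norm (scal (RtoC 2) x)) F).
  { intros alpha Ha.
    assert (E : forall z, scal (/ (z - RtoC 1) * / (z - RtoC (-1)))%C (scal (RtoC 2) x) = F z).
    { intros z. unfold F. vring X. }
    split.
    - intros e N He. apply qdiff_ext with (1 := fun z _ => E z).
      apply (@qdiff_scal X _ (fun z => (/ (z - RtoC 1) * / (z - RtoC (-1)))%C)); [| apply qdiff_const].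
      apply qdiff_mult; eapply qdiff_inv_sector.
      + instantiate (1 := 1 - cos theta). generalize cos_theta_lt_1; lra.
      + exact He.
      + intros rho al Hr Hal. replace al with alpha by lra. apply sub_1_outside; lra.
      + exact Rlt_0_1.
      + exact He.
      + intros rho al Hr Hal. replace al with alpha by lra. apply add_1_inside; lra.
    - intros al Hal. replace al with alpha by lra.
      assert (W : weight_bound (-2) B alpha (fun z => (/ (z - RtoC 1) * / (z - RtoC (-1)))%C)).
      { replace (-2) with (-1 + -1) by ring. apply weight_bound_mult; [apply weight_sub_1 | apply weight_add_1]; lra. }
      pose proof (ray_dominated_const Hg (scal (RtoC 2) x) W) as [D1 D2].
      split; intros rho Hr; rewrite <- E; auto. }
  assert (A1 : Rabs (- theta) = theta) by (rewrite Rabs_Ropp; apply Rabs_pos_eq; lra).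
  assert (A2 : Rabs theta = theta) by (apply Rabs_pos_eq; lra).
  destruct (tame_is_path Hg (T _ A1) (T _ A2)) as [l (l1 & l2 & H1 & H2 & ->)].
  exists l1, l2. split; [exact H1 |]. split; [exact H2 |].
  assert (Hs : 0 < sin theta) by (apply sin_gt_0; lra).
  pose proof (@is_RInt_gen_minus (real_space X) _ _ _ _ _ _ _ _ H1 H2) as HM.
  pose proof (@is_RInt_gen_linear R_NormedModule (real_space X)
    (fun r => scal r (scal (RtoC 2 * Ci)%C x : real_space X))
    (is_linear_scal_l (scal (RtoC 2 * Ci)%C x : real_space X)) _ _ _ _
    (is_RInt_gen_pole_pair (cos theta) Hs)) as HP.
  transitivity (scal PI (scal (RtoC 2 * Ci)%C x : real_space X)).
  { change (scal (RtoC (2 * PI) * Ci)%C x = scal (RtoC PI) (scal (RtoC 2 * Ci)%C x)).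
    rewrite RtoC_mult. vring X. }
  symmetry. refine (eq_trans (eq_sym (@is_RInt_gen_unique (real_space X) _ _ _ _ _ _ HM)) _).
  apply (@is_RInt_gen_unique (real_space X)); [typeclasses eauto | typeclasses eauto |].
  refine (@is_RInt_gen_ext (real_space X) _ _ _ _ _ _ _ _ HP).
  generalize (filter_prod_corner 1 Rlt_0_1). apply filter_imp.
  intros [u v] [Hu Hv] rho Hrho. simpl in *.
  assert (Hr : 0 < rho) by (assert (0 < Rmin u v) by (apply Rmin_glb_lt; lra); lra).
  clear HM HP.
  assert (P1 : 0 < (rho - 1 * cos theta) ^ 2 + sin theta ^ 2) by (generalize (pow2_ge_0 (rho - 1 * cos theta)); nra).
  assert (P2 : 0 < (rho - -1 * cos theta) ^ 2 + sin theta ^ 2) by (generalize (pow2_ge_0 (rho - -1 * cos theta)); nra).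
  assert (I1 := @pole_pair theta rho 1 ltac:(ring) P1).
  assert (I2 := @pole_pair theta rho (-1) ltac:(ring) P2).
  (* Partial fractions: [2 / ((z - 1) (z + 1)) = 1 / (z - 1) - 1 / (z + 1)]. *)
  assert (PF : forall alpha, Rabs alpha = theta ->
    (RtoC 2 * (/ (RtoC rho * cis alpha - RtoC 1) * / (RtoC rho * cis alpha - RtoC (-1))))%C
    = (/ (RtoC rho * cis alpha - RtoC 1) - / (RtoC rho * cis alpha - RtoC (-1)))%C).
  { intros alpha Ha.
    assert (N1 : (RtoC rho * cis alpha - RtoC 1)%C <> 0%C).
    { intros E. pose proof (@sub_1_outside rho alpha ltac:(lra) ltac:(lra)) as S. rewrite E, Cmod_0 in S.
      generalize cos_theta_lt_1. nra. }
    assert (N2 : (RtoC rho * cis alpha - RtoC (-1))%C <> 0%C).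
    { intros E. pose proof (@add_1_inside rho alpha ltac:(lra) ltac:(lra)) as S. rewrite E, Cmod_0 in S. nra. }
    replace (RtoC 2) with ((RtoC rho * cis alpha - RtoC (-1)) - (RtoC rho * cis alpha - RtoC 1))%C.
    - field. split; assumption.
    - replace (RtoC rho * cis alpha - RtoC (-1) - (RtoC rho * cis alpha - RtoC 1))%C
        with (RtoC 1 - RtoC (-1))%C by ring.
      rewrite <- RtoC_minus. f_equal. ring. }
  change (scal (RtoC (sin theta / ((rho - cos theta) ^ 2 + sin theta ^ 2) + sin theta / ((rho + cos theta) ^ 2 + sin theta ^ 2)))
     (scal (RtoC 2 * Ci)%C x) = minus (on_ray (- theta) F rho) (on_ray theta F rho)).
  unfold on_ray, F. rewrite (PF _ A1), (PF _ A2).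
  replace (sin theta / ((rho - cos theta) ^ 2 + sin theta ^ 2))
    with (1 * sin theta / ((rho - 1 * cos theta) ^ 2 + sin theta ^ 2)) by (rewrite !Rmult_1_l; reflexivity).
  replace (sin theta / ((rho + cos theta) ^ 2 + sin theta ^ 2))
    with (- (-1 * sin theta / ((rho - -1 * cos theta) ^ 2 + sin theta ^ 2))).
  2:{ replace (rho - -1 * cos theta) with (rho + cos theta) in * by ring. field. lra. }
  rewrite RtoC_plus, RtoC_opp.
  transitivity (scal (RtoC (1 * sin theta / ((rho - 1 * cos theta) ^ 2 + sin theta ^ 2)) * (RtoC 2 * Ci)
    - RtoC (-1 * sin theta / ((rho - -1 * cos theta) ^ 2 + sin theta ^ 2)) * (RtoC 2 * Ci))%C x).
  { vring X. }
  rewrite <- I1, <- I2. vring X.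
Qed.

End PolePath.

(** * Resolvent identities and holomorphy of the resolvent *)

Section Resolvent.
Context {X : CompleteNormedModule C_AbsRing}.
Variable A : operator X.

Lemma resolvent_spec z x : resolvent_set A z -> resolvent_eq A z x (resolvent A z x).
Proof. intros [H _]. exact (@iota_correct C_AbsRing X (resolvent_eq A z x) (H x)). Qed.

Lemma resolvent_eq_unique z x y : resolvent_set A z -> resolvent_eq A z x y -> resolvent A z x = y.
Proof.
  intros HR Hy. destruct (proj1 HR x) as [y0 [_ U]].
  rewrite <- (U y Hy). symmetry. apply U, resolvent_spec, HR.
Qed.

(** Holds because [w - A = (w - z) + (z - A)]. In this form the vector visibly lies in the range of
    the single resolvent at [w]. *)
Lemma resolvent_identity z w x :
  resolvent_set A z -> resolvent_set A w ->
  resolvent A z x = resolvent A w (plus (scal (w - z)%C (resolvent A z x)) x).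
Proof.
  intros Hz Hw. symmetry. apply resolvent_eq_unique; [exact Hw |].
  destruct (resolvent_spec x Hz) as [D E]. split; [exact D |].
  transitivity (plus (scal (w - z)%C (resolvent A z x))
    (minus (scal z (resolvent A z x)) (A (resolvent A z x)))).
  - vring X.
  - apply f_equal. exact E.
Qed.

Lemma resolvent_op z x :
  resolvent_set A z -> dom A x ->
  scal z (resolvent A z x) = plus x (resolvent A z (A x)).
Proof.
  intros Hz Hx.
  assert (E : resolvent A z (minus (scal z x) (A x)) = x).
  { apply resolvent_eq_unique; [exact Hz |]. split; [exact Hx | reflexivity]. }
  destruct Hz as [_ L].
  rewrite <- E at 2. rewrite <- (linear_scal _ L).
  etransitivity; [| apply (linear_plus _ L)].
  apply f_equal. vring X.
Qed.

Lemma resolvent_op_plus z x :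
  resolvent_set A z -> dom A x ->
  resolvent A z (plus (A x) x) = plus (minus (scal z (resolvent A z x)) x) (resolvent A z x).
Proof.
  intros Hz Hx. transitivity (plus (resolvent A z (A x)) (resolvent A z x)).
  - apply (linear_plus _ (proj2 Hz)).
  - rewrite (resolvent_op _ Hz Hx). vring X.
Qed.

Lemma resolvent_diff z w x :
  resolvent_set A z -> resolvent_set A w ->
  minus (resolvent A w x) (resolvent A z x) = scal (z - w)%C (resolvent A w (resolvent A z x)).
Proof.
  intros Hz Hw. rewrite (resolvent_identity x Hz Hw) at 1.
  pose proof (proj2 Hw) as L.
  transitivity (minus (resolvent A w x) (plus (resolvent A w (scal (w - z)%C (resolvent A z x))) (resolvent A w x))).
  { apply f_equal. apply (linear_plus _ L). }
  transitivity (minus (resolvent A w x) (plus (scal (w - z)%C (resolvent A w (resolvent A z x))) (resolvent A w x))).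
  { apply f_equal. apply (f_equal (fun u => plus u _)). apply (linear_scal _ L). }
  vring X.
Qed.

(** The derivative is [- R z (R z x)]; applying the resolvent identity twice shows that the
    remainder is [(z - w)^2 R w (R z (R z x))]. *)
Lemma qdiff_resolvent (D : C -> Prop) (N : R) (x : X) :
  (forall z, D z -> resolvent_set A z) ->
  (forall z, D z -> forall y, norm (resolvent A z y) <= N * norm y) ->
  0 <= N -> qdiff D (fun z => resolvent A z x).
Proof.
  intros HR HB HN. pose proof (norm_ge_0 x) as Hx.
  assert (P1 : 0 <= N * norm x) by (apply Rmult_le_pos; assumption).
  assert (P2 : 0 <= N * (N * norm x)) by (apply Rmult_le_pos; assumption).
  assert (P3 : 0 <= N * (N * (N * norm x))) by (apply Rmult_le_pos; assumption).
  assert (B2 : forall z w, D z -> D w -> norm (resolvent A w (resolvent A z x)) <= N * (N * norm x)).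
  { intros z w Hz Hw. apply Rle_trans with (1 := HB w Hw _). apply Rmult_le_compat_l; auto. }
  exists (fun z => scal (- (1))%C (resolvent A z (resolvent A z x))),
    (N * norm x + N * (N * norm x) + N * (N * (N * norm x))).
  repeat split.
  - lra.
  - apply Rle_trans with (1 := HB z H x). lra.
  - apply Rle_trans with (1 * (N * (N * norm x))); [| lra].
    apply (@norm_scal_bound X); [rewrite Cmod_opp, Cmod_1; lra | apply B2; assumption].
  - intros z w Hz Hw. rewrite resolvent_diff by auto. rewrite Rmult_comm.
    apply (@norm_scal_bound X).
    + rewrite <- Cmod_opp. right. f_equal. ring.
    + specialize (B2 z w Hz Hw). lra.
  - intros z w Hz Hw. rewrite resolvent_diff by auto.
    vreplace X (scal (z - w)%C (minus (resolvent A w (resolvent A z x)) (resolvent A z (resolvent A z x)))).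
    rewrite resolvent_diff by auto.
    replace (Cmod (w - z)%C) with (Cmod (z - w)%C) by (rewrite <- Cmod_opp; f_equal; ring).
    replace ((N * norm x + N * (N * norm x) + N * (N * (N * norm x))) * Cmod (z - w)%C ^ 2)
      with (Cmod (z - w)%C * (Cmod (z - w)%C * (N * norm x + N * (N * norm x) + N * (N * (N * norm x))))) by ring.
    apply (@norm_scal_bound X); [lra |]. apply (@norm_scal_bound X); [lra |].
    apply Rle_trans with (1 := HB w Hw _). specialize (B2 z z Hz Hz).
    apply Rle_trans with (N * (N * (N * norm x))); [apply Rmult_le_compat_l; assumption | lra].
Qed.

End Resolvent.

(** [alpha] may be [- PI], which is not a principal argument, so cosines are compared: the cosine is
    injective on [[0, PI]], and absolute values of angles lie there. *)
Lemma not_sector_polar (mu rho alpha : R) :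
  0 < rho -> 0 <= mu < Rabs alpha -> Rabs alpha <= PI -> ~ sector mu (RtoC rho * cis alpha)%C.
Proof.
  intros Hr Hm Ha [E | (th & (NZ & Hth & E) & Hb)].
  - assert (C0 : Cmod (RtoC rho * cis alpha)%C = 0) by (rewrite E; apply Cmod_0).
    rewrite Cmod_polar in C0; lra.
  - rewrite Cmod_polar in E by lra.
    assert (EC : cos alpha = cos th).
    { apply (f_equal Re) in E. simpl in E. nra. }
    assert (AB : forall u, cos u = cos (Rabs u)).
    { intros u. unfold Rabs. destruct (Rcase_abs u); [symmetry; apply cos_neg | reflexivity]. }
    rewrite (AB alpha), (AB th) in EC.
    apply cos_inj in EC; try lra; generalize (Rabs_pos th); try lra.
Qed.

(** * The semigroup *)

Section Semigroup.
Context {X : CompleteNormedModule C_AbsRing}.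
Variable A : operator X.
Variables g mu theta Cmu : R.
Hypothesis Hg : -1 < g < 0.
Hypothesis Hmu : 0 < mu < theta.
Hypothesis Htheta : theta < PI / 2.
Hypothesis HC : 0 < Cmu.
Hypothesis HR : forall z, ~ sector mu z -> resolvent_set A z.
Hypothesis HB : forall z, ~ sector mu z -> forall x,
  norm (resolvent A z x) <= Cmu * Rpower (Cmod z) g * norm x.

Notation res := (resolvent A).

Lemma PI_bound : theta < PI.
Proof. generalize PI_RGT_0; lra. Qed.

Lemma outside rho alpha :
  0 < rho -> theta <= Rabs alpha <= PI -> ~ sector mu (RtoC rho * cis alpha)%C.
Proof. intros Hr Ha. apply not_sector_polar; lra. Qed.

Lemma abs_path alpha : alpha = - theta \/ alpha = theta -> Rabs alpha = theta.
Proof.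
  intros [-> | ->]; [rewrite Rabs_Ropp |]; apply Rabs_pos_eq; lra.
Qed.

Lemma res_ray_bound rho alpha x :
  0 < rho -> theta <= Rabs alpha <= PI ->
  norm (res (RtoC rho * cis alpha)%C x) <= Cmu * norm x * Rpower rho g.
Proof.
  intros Hr Ha. apply Rle_trans with (1 := HB (outside Hr Ha) x).
  rewrite Cmod_polar by lra. right; ring.
Qed.

(** At radii at least [e] the resolvent bound is at most [Cmu e^g], since [g < 0]. *)
Lemma qdiff_res a b e N x :
  0 < e -> (forall alpha, a <= alpha <= b -> theta <= Rabs alpha <= PI) ->
  qdiff (annular_sector a b e N) (fun z => res z x).
Proof.
  intros He Hab. apply qdiff_resolvent with (Cmu * Rpower e g).
  - intros z (rho & al & H1 & H2 & ->). apply HR, outside; [lra | auto].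
  - intros z (rho & al & H1 & H2 & ->) y.
    apply Rle_trans with (1 := @res_ray_bound rho al y ltac:(lra) (Hab al H2)).
    replace (Cmu * Rpower e g * norm y) with (Cmu * norm y * Rpower e g) by ring.
    apply Rmult_le_compat_l; [apply Rmult_le_pos; [lra | apply norm_ge_0] |].
    apply Rpower_decr_base; lra.
  - apply Rmult_le_pos; [lra | apply Rpower_ge_0].
Qed.

Definition qdiff_on_path (c : C -> C) : Prop :=
  forall alpha e N, alpha = - theta \/ alpha = theta -> 0 < e ->
    qdiff (X := AbsRing_NormedModule C_AbsRing) (annular_sector alpha alpha e N) c.

Definition path_weight (q B : R) (c : C -> C) : Prop :=
  forall alpha, alpha = - theta \/ alpha = theta -> weight_bound q B alpha c.

(** The factor [2] counts the two rays of the contour. *)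
Definition path_const : R := 2 * (Cmu * dom_const g).

Lemma path_const_pos : 0 < path_const.
Proof.
  unfold path_const. pose proof (dom_const_pos Hg). apply Rmult_lt_0_compat; [lra |].
  apply Rmult_lt_0_compat; assumption.
Qed.

Lemma path_res_dominated B c x alpha :
  path_weight (- g / 2 - 1) B c -> alpha = - theta \/ alpha = theta ->
  ray_dominated g (B * (Cmu * norm x)) alpha (fun z => scal (c z) (res z x)).
Proof.
  intros HW Ha. apply ray_dominated_weight; [| | apply HW, Ha].
  - apply Rmult_le_pos; [lra | apply norm_ge_0].
  - intros rho Hr. apply res_ray_bound; [exact Hr |].
    rewrite (abs_path Ha). generalize PI_bound; lra.
Qed.

Lemma path_res_exists B c x :
  qdiff_on_path c -> path_weight (- g / 2 - 1) B c ->
  exists l, is_path theta (fun z => scal (c z) (res z x)) l.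
Proof.
  intros Q W.
  assert (T : forall alpha, alpha = - theta \/ alpha = theta ->
    tame g alpha alpha (B * (Cmu * norm x)) (fun z => scal (c z) (res z x))).
  { intros alpha Ha. split.
    - intros e N He. apply (@qdiff_scal X _ c); [apply Q; assumption |].
      apply qdiff_res; [exact He |]. intros al Hal. replace al with alpha by lra.
      rewrite (abs_path Ha). generalize PI_bound; lra.
    - intros al Hal. replace al with alpha by lra. apply path_res_dominated; assumption. }
  apply (tame_is_path Hg (T _ (or_introl eq_refl)) (T _ (or_intror eq_refl))).
Qed.

(** The estimate behind all later bounds: a difference of contour integrals is written as one
    integral with weight [c], and only [c] has to be estimated. *)
Lemma path_res_norm B c x l :
  is_path theta (fun z => scal (c z) (res z x)) l -> path_weight (- g / 2 - 1) B c ->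
  norm l <= path_const * B * norm x.
Proof.
  intros H W. refine (Rle_trans _ _ _ (is_path_norm Hg H
    (@path_res_dominated B c x _ W (or_introl eq_refl))
    (@path_res_dominated B c x _ W (or_intror eq_refl))) _).
  unfold path_const. right; ring.
Qed.

Lemma path_res_weight_exp B a c :
  0 < a -> 0 <= B ->
  (forall rho alpha, 0 < rho -> alpha = - theta \/ alpha = theta ->
     Cmod (c (RtoC rho * cis alpha)%C) <= B * ((1 + rho) ^ 2 * exp (- (a * rho)))) ->
  path_weight (- g / 2 - 1) (B * exp_const a) c.
Proof.
  intros Ha HB0 H alpha Hal. apply weight_bound_weaken with (-2); [lra |].
  apply weight_bound_exp_decay; auto.
Qed.

Lemma cos_theta_pos : 0 < cos theta.
Proof. apply cos_gt_0; lra. Qed.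

Lemma Cmod_exp_path t rho alpha :
  0 <= t -> 0 < rho -> alpha = - theta \/ alpha = theta ->
  Cmod (Cexp (- (RtoC t * (RtoC rho * cis alpha))))%C <= exp (- (t * cos theta * rho)).
Proof.
  intros Ht Hr Ha. apply Cmod_exp_ray; [exact Ht | lra |].
  rewrite (abs_path Ha). generalize PI_bound; lra.
Qed.

Lemma one_plus_sqr_ge rho u : 0 < rho -> 0 <= u -> u <= (1 + rho) ^ 2 * u.
Proof. intros Hr Hu. assert (1 <= (1 + rho) ^ 2) by nra. nra. Qed.

Definition e_weight (t : R) (z : C) : C := Cexp (- (RtoC t * z))%C.
Definition ze_weight (t : R) (z : C) : C := (z * Cexp (- (RtoC t * z)))%C.

Lemma e_weight_bound t a :
  0 < a <= t * cos theta -> path_weight (- g / 2 - 1) (1 * exp_const a) (e_weight t).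
Proof.
  intros Ha. pose proof cos_theta_pos.
  assert (Ht : 0 <= t) by nra.
  apply path_res_weight_exp; [lra | lra |]. intros rho alpha Hr Hal. rewrite Rmult_1_l.
  refine (Rle_trans _ _ _ (Cmod_exp_path Ht Hr Hal) _).
  apply Rle_trans with (exp (- (a * rho))); [apply exp_le; nra |].
  apply one_plus_sqr_ge; [exact Hr | left; apply exp_pos].
Qed.

Lemma ze_weight_bound t a :
  0 < a <= t * cos theta -> path_weight (- g / 2 - 1) (1 * exp_const a) (ze_weight t).
Proof.
  intros Ha. pose proof cos_theta_pos.
  assert (Ht : 0 <= t) by nra.
  apply path_res_weight_exp; [lra | lra |]. intros rho alpha Hr Hal. rewrite Rmult_1_l.
  unfold ze_weight. rewrite Cmod_mult, Cmod_polar by lra.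
  apply Rmult_le_compat; [lra | apply Cmod_ge_0 | nra |].
  refine (Rle_trans _ _ _ (Cmod_exp_path Ht Hr Hal) _). apply exp_le; nra.
Qed.

Lemma e_weight_qdiff t : qdiff_on_path (e_weight t).
Proof. intros alpha e N _ He. apply qdiff_exp_sector, He. Qed.

Lemma ze_weight_qdiff t : qdiff_on_path (ze_weight t).
Proof.
  intros alpha e N _ He. apply qdiff_mult; [apply qdiff_id_sector, He | apply qdiff_exp_sector, He].
Qed.

(** [2 i pi] times the semigroup, and [2 i pi] times [A] applied to it. *)
Definition raw_semigroup (t : R) (x : X) : X := path_integral X theta (fun z => scal (e_weight t z) (res z x)).
Definition raw_generator (t : R) (x : X) : X := path_integral X theta (fun z => scal (ze_weight t z) (res z x)).

Lemma raw_semigroup_path t x : 0 < t -> is_path theta (fun z => scal (e_weight t z) (res z x)) (raw_semigroup t x).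
Proof.
  intros Ht. pose proof cos_theta_pos.
  destruct (@path_res_exists _ _ x (e_weight_qdiff t) (@e_weight_bound t (t * cos theta) ltac:(nra))) as [l Hl].
  unfold raw_semigroup. rewrite (is_path_unique Hl). exact Hl.
Qed.

Lemma raw_generator_path t x : 0 < t -> is_path theta (fun z => scal (ze_weight t z) (res z x)) (raw_generator t x).
Proof.
  intros Ht. pose proof cos_theta_pos.
  destruct (@path_res_exists _ _ x (ze_weight_qdiff t) (@ze_weight_bound t (t * cos theta) ltac:(nra))) as [l Hl].
  unfold raw_generator. rewrite (is_path_unique Hl). exact Hl.
Qed.

Lemma res_linear rho alpha :
  0 < rho -> alpha = - theta \/ alpha = theta -> is_linear (res (RtoC rho * cis alpha)%C).
Proof.
  intros Hr Ha. apply HR, outside; [exact Hr |]. rewrite (abs_path Ha). generalize PI_bound; lra.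
Qed.

Lemma path_res_linear (c : C -> C) (P : X -> X) B :
  (forall x, is_path theta (fun z => scal (c z) (res z x)) (P x)) ->
  path_weight (- g / 2 - 1) B c -> is_linear P.
Proof.
  intros HP W. split.
  - intros x y. apply (is_path_eq (HP (plus x y))).
    refine (is_path_ext _ _ (is_path_plus (HP x) (HP y))).
    intros rho alpha Hr Ha. pose proof (res_linear Hr Ha) as L.
    transitivity (scal (c (RtoC rho * cis alpha)%C) (plus (res (RtoC rho * cis alpha)%C x) (res (RtoC rho * cis alpha)%C y))).
    + vring X.
    + apply f_equal. symmetry. apply (linear_plus _ L).
  - intros k x. apply (is_path_eq (HP (scal k x))).
    refine (is_path_ext _ _ (is_path_scal k (HP x))).
    intros rho alpha Hr Ha. pose proof (res_linear Hr Ha) as L.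
    transitivity (scal (c (RtoC rho * cis alpha)%C) (scal k (res (RtoC rho * cis alpha)%C x))).
    + change k with (k : C). vring X.
    + apply f_equal. symmetry. apply (linear_scal _ L).
  - pose proof path_const_pos as Hc.
    (* [is_linear] asks for a strictly positive constant. *)
    exists (Rmax 1 (path_const * B)). split; [apply Rlt_le_trans with 1; [lra | apply Rmax_l] |].
    intros x. apply Rle_trans with (1 := @path_res_norm B c x _ (HP x) W).
    apply Rmult_le_compat_r; [apply norm_ge_0 | apply Rmax_r].
Qed.

Lemma raw_semigroup_linear t : 0 < t -> is_linear (raw_semigroup t).
Proof.
  intros Ht. pose proof cos_theta_pos. apply path_res_linear with (e_weight t) (1 * exp_const (t * cos theta)).
  - intros x. apply raw_semigroup_path, Ht.
  - apply e_weight_bound. nra.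
Qed.

(** The decay rate [t cos theta >= 2 a] is split: one half pays for the factor [e^{|h| rho}] of a
    shift by [h], the other remains. *)
Lemma exp_increment t h a rho alpha :
  0 < a -> 2 * a <= t * cos theta -> Rabs h <= a -> 0 < rho -> alpha = - theta \/ alpha = theta ->
  exp (Rabs h * rho) * Cmod (Cexp (- (RtoC t * (RtoC rho * cis alpha))))%C <= exp (- (a * rho)).
Proof.
  intros Ha Ht Hh Hr Hal. pose proof cos_theta_pos. assert (Ht0 : 0 <= t) by nra.
  apply Rle_trans with (exp (Rabs h * rho) * exp (- (t * cos theta * rho))).
  - apply Rmult_le_compat_l; [left; apply exp_pos | apply Cmod_exp_path; assumption].
  - rewrite <- exp_plus. apply exp_le. nra.
Qed.

Lemma Cmod_h_polar h rho alpha : 0 < rho -> Cmod (- (RtoC h * (RtoC rho * cis alpha)))%C = Rabs h * rho.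
Proof. intros Hr. rewrite Cmod_opp, Cmod_mult, Cmod_polar, Cmod_R by lra. reflexivity. Qed.

Lemma Cexp_shift t h z : Cexp (- (RtoC (t + h) * z))%C = (Cexp (- (RtoC t * z)) * Cexp (- (RtoC h * z)))%C.
Proof. rewrite <- Cexp_plus. f_equal. rewrite RtoC_plus. ring. Qed.

Lemma Re_h_polar h rho alpha :
  0 < rho -> Re (- (RtoC h * (RtoC rho * cis alpha)))%C <= Rabs h * rho.
Proof. intros Hr. rewrite <- (Cmod_h_polar h alpha Hr). apply Re_le_Cmod. Qed.

Lemma Rabs_h_rho_ge_0 h rho : 0 < rho -> 0 <= Rabs h * rho.
Proof. intros Hr. apply Rmult_le_pos; [apply Rabs_pos | lra]. Qed.

Lemma shift_pos t h a : 0 < a -> 2 * a <= t * cos theta -> Rabs h <= a -> 0 < t /\ 0 < t + h.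
Proof.
  intros Ha Ht Hh. apply Rabs_le_between in Hh.
  assert (cos theta <= 1) by apply COS_bound. pose proof cos_theta_pos.
  assert (0 < t) by nra. split; nra.
Qed.

(** The left side is the contour integral with weight [e^{-tz} (e^{-hz} - 1 + h z)], which is at
    most [h^2 rho^2 e^{-a rho}]. *)
Lemma raw_semigroup_taylor t h a x :
  0 < a -> 2 * a <= t * cos theta -> Rabs h <= a ->
  norm (plus (minus (raw_semigroup (t + h) x) (raw_semigroup t x)) (scal (RtoC h) (raw_generator t x)))
  <= path_const * (h ^ 2 * exp_const a) * norm x.
Proof.
  intros Ha Ht Hh. destruct (@shift_pos t h a Ha Ht Hh) as [Ht0 Hth].
  pose (c := fun z => (Cexp (- (RtoC t * z)) * (Cexp (- (RtoC h * z)) - 1 - (- (RtoC h * z))))%C).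
  apply (@path_res_norm (h ^ 2 * exp_const a) c).
  - pose proof (is_path_plus (is_path_plus (raw_semigroup_path x Hth) (is_path_scal (- (1))%C (raw_semigroup_path x Ht0)))
      (is_path_scal (RtoC h) (raw_generator_path x Ht0))) as P.
    replace (plus (minus (raw_semigroup (t + h) x) (raw_semigroup t x)) (scal (RtoC h) (raw_generator t x)))
      with (plus (plus (raw_semigroup (t + h) x) (scal (- (1))%C (raw_semigroup t x))) (scal (RtoC h) (raw_generator t x))) by vring X.
    refine (is_path_ext _ _ P). intros rho alpha Hr Hal.
    unfold c, e_weight, ze_weight. rewrite Cexp_shift. vring X.
  - apply path_res_weight_exp; [exact Ha | apply pow2_ge_0 |]. intros rho alpha Hr Hal.
    unfold c. rewrite Cmod_mult.
    pose proof (@Cexp_sub_1_sub_bound _ _ (Rabs_h_rho_ge_0 h Hr) (@Re_h_polar h rho alpha Hr)) as E.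
    rewrite Cmod_h_polar in E by exact Hr.
    pose proof (@exp_increment t h a rho alpha Ha Ht Hh Hr Hal) as I.
    pose proof (Cmod_ge_0 (Cexp (- (RtoC t * (RtoC rho * cis alpha))))%C) as P.
    apply Rle_trans with ((Rabs h * rho) ^ 2 * exp (- (a * rho))).
    + apply Rle_trans with (Cmod (Cexp (- (RtoC t * (RtoC rho * cis alpha))))%C * ((Rabs h * rho) ^ 2 * exp (Rabs h * rho))).
      { apply Rmult_le_compat_l; assumption. }
      generalize (pow2_ge_0 (Rabs h * rho)). intros Q. nra.
    + rewrite Rpow_mult_distr, pow2_abs, Rmult_assoc. apply Rmult_le_compat_l; [apply pow2_ge_0 |].
      apply Rmult_le_compat_r; [left; apply exp_pos | nra].
Qed.

(** [k = 1] serves the semigroup and [k z = z] the generator. *)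
Lemma shift_weight t h a (k : C -> C) :
  0 < a -> 2 * a <= t * cos theta -> Rabs h <= a ->
  (forall rho alpha, 0 < rho -> Cmod (k (RtoC rho * cis alpha)%C) <= 1 + rho) ->
  path_weight (- g / 2 - 1) (Rabs h * exp_const a)
    (fun z => (k z * (Cexp (- (RtoC t * z)) * (Cexp (- (RtoC h * z)) - 1)))%C).
Proof.
  intros Ha Ht Hh Hk. apply path_res_weight_exp; [exact Ha | apply Rabs_pos |]. intros rho alpha Hr Hal.
  rewrite !Cmod_mult.
  pose proof (@Cexp_sub_1_bound _ _ (Rabs_h_rho_ge_0 h Hr) (@Re_h_polar h rho alpha Hr)) as E.
  rewrite Cmod_h_polar in E by exact Hr.
  pose proof (@exp_increment t h a rho alpha Ha Ht Hh Hr Hal) as I.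
  pose proof (Cmod_ge_0 (Cexp (- (RtoC t * (RtoC rho * cis alpha))))%C) as P.
  apply Rle_trans with ((1 + rho) * (Rabs h * rho * exp (- (a * rho)))).
  - apply Rmult_le_compat; [apply Cmod_ge_0 | | apply Hk, Hr |].
    { apply Rmult_le_pos; apply Cmod_ge_0. }
    apply Rle_trans with (Cmod (Cexp (- (RtoC t * (RtoC rho * cis alpha))))%C * ((Rabs h * rho) * exp (Rabs h * rho))).
    { apply Rmult_le_compat_l; assumption. }
    generalize (Rabs_h_rho_ge_0 h Hr). intros Q. nra.
  - replace ((1 + rho) * (Rabs h * rho * exp (- (a * rho))))
      with (Rabs h * ((1 + rho) * rho * exp (- (a * rho)))) by ring.
    apply Rmult_le_compat_l; [apply Rabs_pos |].
    apply Rmult_le_compat_r; [left; apply exp_pos | nra].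
Qed.

Lemma raw_semigroup_lipschitz t h a x :
  0 < a -> 2 * a <= t * cos theta -> Rabs h <= a ->
  norm (minus (raw_semigroup (t + h) x) (raw_semigroup t x)) <= path_const * (Rabs h * exp_const a) * norm x.
Proof.
  intros Ha Ht Hh. destruct (@shift_pos t h a Ha Ht Hh) as [Ht0 Hth].
  refine (@path_res_norm _ _ x _ _ (@shift_weight t h a (fun _ => RtoC 1) Ha Ht Hh _)).
  - pose proof (is_path_plus (raw_semigroup_path x Hth) (is_path_scal (- (1))%C (raw_semigroup_path x Ht0))) as P.
    replace (minus (raw_semigroup (t + h) x) (raw_semigroup t x))
      with (plus (raw_semigroup (t + h) x) (scal (- (1))%C (raw_semigroup t x))) by vring X.
    refine (is_path_ext _ _ P). intros rho alpha Hr Hal.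
    unfold e_weight. rewrite Cexp_shift. vring X.
  - intros rho alpha Hr. rewrite Cmod_1. lra.
Qed.

Lemma raw_generator_lipschitz t h a x :
  0 < a -> 2 * a <= t * cos theta -> Rabs h <= a ->
  norm (minus (raw_generator (t + h) x) (raw_generator t x)) <= path_const * (Rabs h * exp_const a) * norm x.
Proof.
  intros Ha Ht Hh. destruct (@shift_pos t h a Ha Ht Hh) as [Ht0 Hth].
  refine (@path_res_norm _ _ x _ _ (@shift_weight t h a (fun z => z) Ha Ht Hh _)).
  - pose proof (is_path_plus (raw_generator_path x Hth) (is_path_scal (- (1))%C (raw_generator_path x Ht0))) as P.
    replace (minus (raw_generator (t + h) x) (raw_generator t x))
      with (plus (raw_generator (t + h) x) (scal (- (1))%C (raw_generator t x))) by vring X.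
    refine (is_path_ext _ _ P). intros rho alpha Hr Hal.
    unfold ze_weight. rewrite Cexp_shift. vring X.
  - intros rho alpha Hr. rewrite Cmod_polar by lra. lra.
Qed.

Lemma abs_inside alpha : - theta <= alpha <= theta -> Rabs alpha <= theta.
Proof. intros H. apply Rabs_le. exact H. Qed.

Lemma e_weight_inside t alpha :
  0 < t -> - theta <= alpha <= theta ->
  weight_bound (-2) (1 * exp_const (t * cos theta)) alpha (e_weight t).
Proof.
  intros Ht Hal. pose proof cos_theta_pos. apply weight_bound_exp_decay; [nra | lra |].
  intros rho Hr. rewrite Rmult_1_l.
  apply Rle_trans with (exp (- (t * cos theta * rho))).
  - apply Cmod_exp_ray; [lra | lra |]. generalize (abs_inside Hal) PI_bound. lra.
  - apply one_plus_sqr_ge; [exact Hr | left; apply exp_pos].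
Qed.

Lemma e_path_zero t (x : X) : 0 < t -> is_path theta (fun z => scal (e_weight t z) x) zero.
Proof.
  intros Ht. apply (@path_zero_inside X g Hg theta (1 * exp_const (t * cos theta) * norm x)); [lra |].
  split.
  - intros e N He. apply (@qdiff_scal X _ (e_weight t)); [apply qdiff_exp_sector, He | apply qdiff_const].
  - intros alpha Hal. apply ray_dominated_const; [exact Hg |]. apply e_weight_inside; assumption.
Qed.

(** The pole [-1] lies outside the sector, so nothing obstructs the rotation from one ray to the
    other. *)
Lemma e_pole_path_zero t (x : X) :
  0 < t -> is_path theta (fun z => scal (e_weight t z * / (z - RtoC (-1)))%C x) zero.
Proof.
  intros Ht.
  apply (@path_zero_inside X g Hg theta (1 * exp_const (t * cos theta) * 1 * norm x)); [lra |].
  split.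
  - intros e N He. apply (@qdiff_scal X _ (fun z => (e_weight t z * / (z - RtoC (-1)))%C)); [| apply qdiff_const].
    apply qdiff_mult; [apply qdiff_exp_sector, He |].
    apply qdiff_inv_sector with 1; [lra | exact He |].
    intros rho alpha Hr Hal. apply (@add_1_inside theta); [lra | exact Hr |]. apply abs_inside, Hal.
  - intros alpha Hal. apply ray_dominated_const; [exact Hg |].
    apply weight_bound_weaken with (-2 + -1); [lra |].
    apply weight_bound_mult; [apply e_weight_inside; assumption |].
    apply (@weight_add_1 theta); [lra | apply abs_inside, Hal].
Qed.

Lemma minus_one_outside : ~ sector mu (RtoC (-1)).
Proof.
  replace (RtoC (-1)) with (RtoC 1 * cis PI)%C.
  - apply outside; [lra |]. rewrite Rabs_pos_eq by (generalize PI_RGT_0; lra). generalize PI_bound; lra.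
  - unfold cis, Cmult, RtoC; simpl. rewrite cos_PI, sin_PI. f_equal; ring.
Qed.

(** The integral is factored through the fixed bounded operator [R (-1)], whose range is the domain;
    the equation solved by [R (-1)] then identifies the value of [A]. *)
Lemma raw_semigroup_dom t x : 0 < t -> dom A (raw_semigroup t x) /\ A (raw_semigroup t x) = raw_generator t x.
Proof.
  intros Ht. pose proof (HR minus_one_outside) as R1.
  (* Under the integral, [R z x = R (-1) ((-1 - z) R z x + x)], and the contour integral of
     [e^{-tz} x] vanishes. *)
  assert (E : raw_semigroup t x = res (RtoC (-1)) (minus (opp (raw_semigroup t x)) (raw_generator t x))).
  { pose proof (is_path_linear (proj2 R1) (is_path_plus (is_path_plus (e_path_zero x Ht)
      (is_path_scal (- (1))%C (raw_semigroup_path x Ht))) (is_path_scal (- (1))%C (raw_generator_path x Ht)))) as P.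
    replace (minus (opp (raw_semigroup t x)) (raw_generator t x))
      with (plus (plus zero (scal (- (1))%C (raw_semigroup t x))) (scal (- (1))%C (raw_generator t x))) by vring X.
    apply (is_path_eq (raw_semigroup_path x Ht)). refine (is_path_ext _ _ P).
    intros rho alpha Hr Hal. pose (z := (RtoC rho * cis alpha)%C). fold z.
    assert (Rz : resolvent_set A z).
    { apply HR, outside; [exact Hr |]. rewrite (abs_path Hal). generalize PI_bound; lra. }
    rewrite (resolvent_identity x Rz R1) at 3.
    refine (eq_trans _ (linear_scal _ (proj2 R1) (e_weight t z) _)). apply f_equal.
    unfold ze_weight, e_weight. vcoefs X; try ring; rewrite RtoC_opp; ring. }
  rewrite E at 1 2. destruct (resolvent_spec (minus (opp (raw_semigroup t x)) (raw_generator t x)) R1) as [D1 E1].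
  split; [exact D1 |]. rewrite <- E in E1 |- *.
  transitivity (minus (scal (RtoC (-1)) (raw_semigroup t x)) (minus (scal (RtoC (-1)) (raw_semigroup t x)) (A (raw_semigroup t x)))).
  - vring X.
  - etransitivity; [apply f_equal, E1 |]. vcoefs X; rewrite ?RtoC_opp; ring.
Qed.

(** [A] commutes with the semigroup on [D(A)]: [z R z x = x + R z (A x)], where the term [x]
    integrates to zero. *)
Lemma raw_generator_op t x : 0 < t -> dom A x -> raw_generator t x = raw_semigroup t (A x).
Proof.
  intros Ht Hx.
  pose proof (is_path_plus (e_path_zero x Ht) (raw_semigroup_path (A x) Ht)) as P.
  transitivity (plus zero (raw_semigroup t (A x))); [| vring X].
  apply (is_path_eq (raw_generator_path x Ht)). refine (is_path_ext _ _ P).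
  intros rho alpha Hr Hal. pose (z := (RtoC rho * cis alpha)%C). fold z.
  assert (Rz : resolvent_set A z).
  { apply HR, outside; [exact Hr |]. rewrite (abs_path Hal). generalize PI_bound; lra. }
  transitivity (scal (e_weight t z) (plus x (res z (A x)))); [vring X |].
  rewrite <- (resolvent_op x Rz Hx). unfold ze_weight, e_weight. vring X.
Qed.

(** The modulus is at most [t rho] and at most [2], and the exponent [- g / 2] lies between [0] and
    [1], so [2 (t rho)^(- g / 2)] dominates in both regimes. *)
Lemma exp_sub_1_small t rho alpha :
  0 < t -> 0 < rho -> alpha = - theta \/ alpha = theta ->
  Cmod (e_weight t (RtoC rho * cis alpha)%C - 1)%C <= 2 * Rpower t (- g / 2) * Rpower rho (- g / 2).
Proof.
  intros Ht Hr Hal. rewrite Rmult_assoc, Rpower_mult_distr by assumption.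
  assert (Htr : 0 < t * rho) by (apply Rmult_lt_0_compat; assumption).
  unfold e_weight. destruct (Rle_dec (t * rho) 1) as [H1 | H1].
  - apply Rle_trans with (t * rho).
    + assert (HRe : Re (- (RtoC t * (RtoC rho * cis alpha)))%C <= 0).
      { simpl. assert (0 < cos alpha).
        { destruct Hal as [-> | ->]; rewrite ?cos_neg; apply cos_theta_pos. }
        assert (0 < t * rho * cos alpha) by (apply Rmult_lt_0_compat; assumption). nra. }
      apply Rle_trans with (1 := Cexp_sub_1_bound _ (Rle_refl 0) HRe).
      rewrite exp_0, Cmod_h_polar, Rabs_pos_eq by lra. lra.
    + apply Rle_trans with (1 * Rpower (t * rho) (- g / 2)).
      * rewrite Rmult_1_l. rewrite <- (Rpower_1 (t * rho)) at 1 by exact Htr.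
        apply Rpower_anti_exp; lra.
      * apply Rmult_le_compat_r; [apply Rpower_ge_0 | lra].
  - apply Rle_trans with (1 + 1).
    + refine (Rle_trans _ _ _ (Cmod_triangle _ _) _). rewrite Cmod_opp, Cmod_1.
      apply Rplus_le_compat_r. refine (Rle_trans _ _ _ (@Cmod_exp_path t rho alpha _ Hr Hal) _); [lra |].
      rewrite <- exp_0. apply exp_le. pose proof cos_theta_pos.
      assert (0 < t * rho * cos theta) by (apply Rmult_lt_0_compat; assumption). nra.
    + apply Rle_trans with (2 * Rpower (t * rho) 0); [rewrite Rpower_O by exact Htr; lra |].
      apply Rmult_le_compat_l; [lra |]. apply Rpower_mono_exp; lra.
Qed.

Lemma pole_weight : path_weight (-1) 1 (fun z => (/ (z - RtoC (-1)))%C).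
Proof. intros alpha Hal. apply (@weight_add_1 theta); [lra |]. rewrite (abs_path Hal). lra. Qed.

Lemma path_sub_pole_neq_0 rho alpha :
  0 < rho -> alpha = - theta \/ alpha = theta ->
  (RtoC rho * cis alpha - RtoC (-1))%C <> 0%C /\ (RtoC rho * cis alpha - RtoC 1)%C <> 0%C.
Proof.
  intros Hr Hal. pose proof (abs_path Hal) as Ha. split; intros E.
  - pose proof (@add_1_inside theta ltac:(lra) rho alpha ltac:(lra) ltac:(lra)) as S.
    rewrite E, Cmod_0 in S. nra.
  - pose proof (@sub_1_outside theta ltac:(lra) rho alpha ltac:(lra) ltac:(generalize PI_bound; lra)) as S.
    rewrite E, Cmod_0 in S. pose proof (@cos_theta_lt_1 theta ltac:(lra)). nra.
Qed.

(** The pole [1] lies inside the sector, so the integrand is holomorphic from the contour up to the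
    negative axis, where the resolvent bound still holds. *)
Lemma res_pole_outside_zero y :
  is_path theta (fun z => scal (/ (z - RtoC 1))%C (res z y)) zero.
Proof.
  pose proof (@cos_theta_lt_1 theta ltac:(lra)) as Hc.
  assert (T : forall a b, (forall alpha, a <= alpha <= b -> theta <= Rabs alpha <= PI) ->
    tame g a b (/ sqrt (1 - cos theta) * (Cmu * norm y)) (fun z => scal (/ (z - RtoC 1))%C (res z y))).
  { intros a b Hab. split.
    - intros e N He. apply (@qdiff_scal X _ (fun z => (/ (z - RtoC 1))%C)); [| apply qdiff_res; assumption].
      apply qdiff_inv_sector with (1 - cos theta); [lra | exact He |].
      intros rho al Hr Hal. apply sub_1_outside; [lra | exact Hr | apply Hab, Hal].
    - intros al Hal. apply ray_dominated_weight.
      + apply Rmult_le_pos; [lra | apply norm_ge_0].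
      + intros rho Hr. apply res_ray_bound; [exact Hr | apply Hab, Hal].
      + apply weight_bound_weaken with (-1); [lra |]. apply weight_sub_1; [lra | apply Hab, Hal]. }
  apply (@path_zero_outside X g Hg theta (/ sqrt (1 - cos theta) * (Cmu * norm y))).
  - generalize PI_bound; lra.
  - apply T. intros al Hal. rewrite Rabs_left1 by lra. lra.
  - apply T. intros al Hal. rewrite Rabs_pos_eq by lra. lra.
Qed.

(** On [D(A)] the integrand differs from [R z (A x - x) / (z - 1)], whose integral vanishes, by the
    pole pair [2 / (z^2 - 1) x]. *)
Lemma res_pole_path x :
  dom A x ->
  is_path theta (fun z => scal (/ (z - RtoC (-1)))%C (res z (plus (A x) x))) (scal (RtoC (2 * PI) * Ci)%C x).
Proof.
  intros Hx.
  pose proof (is_path_plus (res_pole_outside_zero (minus (A x) x)) (path_pole_pair Hg (conj (Rlt_trans _ _ _ (proj1 Hmu) (proj2 Hmu)) Htheta) x)) as P.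
  replace (scal (RtoC (2 * PI) * Ci)%C x) with (plus zero (scal (RtoC (2 * PI) * Ci)%C x)) by vring X.
  refine (is_path_ext _ _ P). intros rho alpha Hr Hal.
  destruct (path_sub_pole_neq_0 Hr Hal) as [N1 N2].
  pose (z := (RtoC rho * cis alpha)%C). fold z. fold z in N1, N2.
  assert (Rz : resolvent_set A z).
  { apply HR, outside; [exact Hr |]. rewrite (abs_path Hal). generalize PI_bound; lra. }
  pose proof (proj2 Rz) as L.
  assert (E1 : res z (minus (A x) x) = minus (minus (scal z (res z x)) x) (res z x)).
  { transitivity (plus (res z (A x)) (res z (scal (- (1))%C x))).
    - rewrite <- (linear_plus _ L). apply f_equal. vring X.
    - rewrite (resolvent_op x Rz Hx).
      transitivity (plus (res z (A x)) (scal (- (1))%C (res z x))); [| vring X].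
      apply f_equal. apply (linear_scal _ L). }
  rewrite E1, (resolvent_op_plus x Rz Hx).
  vcoefs X; (replace (RtoC 2) with (RtoC 1 - RtoC (-1))%C by (rewrite <- RtoC_minus; f_equal; ring));
    (replace (RtoC (-1)) with (- RtoC 1)%C by (rewrite <- RtoC_opp; reflexivity)); field; repeat split; assumption.
Qed.

(** The difference is the contour integral of [(e^{-tz} - 1) / (z + 1)] against [R z (A x + x)]. The
    terms [e^{-tz} x / (z + 1)] that arise on the way integrate to zero. *)
Lemma raw_semigroup_near_0 t x :
  0 < t -> dom A x ->
  norm (minus (raw_semigroup t x) (scal (RtoC (2 * PI) * Ci)%C x))
  <= path_const * (2 * Rpower t (- g / 2)) * norm (plus (A x) x).
Proof.
  intros Ht Hx.
  pose (c := fun z => ((e_weight t z - 1) * / (z - RtoC (-1)))%C).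
  pose proof (is_path_plus (raw_semigroup_path x Ht) (is_path_scal (- (1))%C
    (is_path_plus (res_pole_path x Hx) (e_pole_path_zero x Ht)))) as P.
  apply (@path_res_norm _ c).
  - replace (minus (raw_semigroup t x) (scal (RtoC (2 * PI) * Ci)%C x))
      with (plus (raw_semigroup t x) (scal (- (1))%C (plus (scal (RtoC (2 * PI) * Ci)%C x) zero))) by vring X.
    refine (is_path_ext _ _ P). intros rho alpha Hr Hal.
    destruct (path_sub_pole_neq_0 Hr Hal) as [N1 _].
    pose (z := (RtoC rho * cis alpha)%C). fold z. fold z in N1.
    assert (Rz : resolvent_set A z).
    { apply HR, outside; [exact Hr |]. rewrite (abs_path Hal). generalize PI_bound; lra. }
    unfold c. rewrite (resolvent_op_plus x Rz Hx).
    vcoefs X; (replace (RtoC (-1)) with (- RtoC 1)%C by (rewrite <- RtoC_opp; reflexivity)); field; repeat split; assumption.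
  - intros alpha Hal. destruct (pole_weight Hal) as [P1 P2]. unfold c.
    assert (Hp : 0 <= 2 * Rpower t (- g / 2)) by (generalize (Rpower_ge_0 t (- g / 2)); lra).
    split; intros rho Hr; rewrite Cmod_mult.
    + rewrite <- (Rmult_1_r (2 * _)). apply Rmult_le_compat; [apply Cmod_ge_0 | apply Cmod_ge_0 | | auto].
      refine (Rle_trans _ _ _ (@exp_sub_1_small t rho alpha Ht ltac:(lra) Hal) _).
      rewrite <- (Rmult_1_r (2 * Rpower t (- g / 2))) at 2. apply Rmult_le_compat_l; [exact Hp |].
      rewrite <- (Rpower_O rho) by lra. apply Rpower_anti_exp; lra.
    + replace (- g / 2 - 1) with (- g / 2 + -1) by ring. rewrite Rpower_plus, <- Rmult_assoc.
      apply Rmult_le_compat; [apply Cmod_ge_0 | apply Cmod_ge_0 | |].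
      * apply exp_sub_1_small; [exact Ht | lra | exact Hal].
      * specialize (P2 rho Hr). lra.
Qed.

End Semigroup.

(** * The evolution problem *)

Lemma is_derive_zero_of_small {V : NormedModule R_AbsRing} (f : R -> V) (s : R) :
  f s = zero -> (forall eps, 0 < eps -> locally s (fun y => norm (f y) <= eps * Rabs (y - s))) ->
  is_derive f s zero.
Proof.
  intros H0 H. split; [apply is_linear_scal_l |].
  intros x0 Hx0.
  assert (E : s = x0) by exact (@is_filter_lim_locally_unique R_AbsRing R_NormedModule s x0 Hx0).
  subst x0. clear Hx0. intros eps. generalize (H eps (cond_pos eps)). apply filter_imp.
  intros y Hy. refine (Rle_trans _ _ _ (Req_le _ _ _) Hy). apply f_equal.
  rewrite H0. rewrite (@scal_zero_r _ V), (@minus_zero_r V), (@minus_zero_r V). reflexivity.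
Qed.

Lemma locally_norm_lt {V : NormedModule R_AbsRing} (l : V) (eps : R) :
  0 < eps -> locally l (fun y => norm (minus y l) < eps).
Proof.
  intros He. apply (@locally_le_locally_norm R_AbsRing V). exists (mkposreal _ He).
  intros y Hy. exact Hy.
Qed.

Lemma is_derive_locally_lipschitz (r : R -> R) (s dr : R) :
  is_derive r s dr -> locally s (fun y => Rabs (r y - r s) <= (Rabs dr + 1) * Rabs (y - s)).
Proof.
  intros [_ H]. specialize (H s (fun P HP => HP) (mkposreal 1 Rlt_0_1)). revert H.
  apply filter_imp. intros y Hy. change (Rabs (r y - r s - (y - s) * dr) <= 1 * Rabs (y - s)) in Hy.
  replace (r y - r s) with ((r y - r s - (y - s) * dr) + (y - s) * dr) by ring.
  refine (Rle_trans _ _ _ (Rabs_triang _ _) _). rewrite Rabs_mult. lra.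
Qed.

Lemma is_derive_const_eq {V : CompleteNormedModule R_AbsRing} (f : R -> V) (a b : R) :
  a <= b -> (forall x, a <= x <= b -> is_derive f x zero) -> f a = f b.
Proof.
  intros Hab H.
  assert (I : is_RInt (fun _ : R => @zero V) a b (minus (f b) (f a))).
  { apply (@is_RInt_derive V f (fun _ => zero)).
    - intros x Hx. rewrite Rmin_left, Rmax_right in Hx by exact Hab. auto.
    - intros x _. apply continuous_const. }
  pose proof (@is_RInt_const V a b zero) as J.
  assert (E : minus (f b) (f a) = zero).
  { refine (eq_trans (eq_sym (is_RInt_unique _ _ _ _ I)) (eq_trans (is_RInt_unique _ _ _ _ J) _)).
    exact (scal_zero_r (b - a)). }
  apply (@eq_of_norm_le R_AbsRing V). intros eps He.
  refine (Rle_trans _ _ _ (Req_le _ _ _) (Rlt_le _ _ He)).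
  rewrite <- (@opp_minus V), E, (@norm_opp R_AbsRing V). exact (@norm_zero R_AbsRing V).
Qed.

(** For negative times [u] and [v] may differ: the derivative at [t > 0] sees only a neighbourhood
    inside the positive axis. *)
Lemma solves_equation_ext {X : CompleteNormedModule C_AbsRing} (phi : R -> R) (A : operator X)
    (u v : R -> X) :
  (forall t, 0 < t -> u t = v t) -> solves_equation phi A u -> solves_equation phi A v.
Proof.
  intros E [Hdom [du [Hdu [Hc Heq]]]].
  split; [intros t Ht; rewrite <- E by exact Ht; auto |].
  exists du. split; [| split; [exact Hc |]].
  - intros t Ht. apply (@is_derive_ext_loc R_AbsRing (real_space X) u v t (du t)); [| auto].
    exists (mkposreal t Ht). intros y Hy. change (Rabs (y - t) < t) in Hy.
    apply Rabs_lt_between in Hy. apply E. lra.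
  - intros t Ht. rewrite <- E by exact Ht. auto.
Qed.

Lemma classical_solution_ext {X : CompleteNormedModule C_AbsRing} (phi : R -> R) (A : operator X)
    (u0 : X) (u v : R -> X) :
  (forall t, 0 <= t -> u t = v t) -> classical_solution phi A u0 u -> classical_solution phi A u0 v.
Proof.
  intros E [Hc [Hs H0]]. split; [| split].
  - intros t Ht. rewrite <- E by exact Ht.
    apply (filterlim_within_ext _ u v); [exact E | apply Hc, Ht].
  - apply solves_equation_ext with u; [| exact Hs]. intros t Ht. apply E. lra.
  - rewrite <- E by apply Rle_refl. exact H0.
Qed.

Section Evolution.
Context {X : CompleteNormedModule C_AbsRing}.
Variable A : operator X.
Variables g mu theta Cmu : R.
Hypothesis Hg : -1 < g < 0.
Hypothesis Hmu : 0 < mu < theta.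
Hypothesis Htheta : theta < PI / 2.
Hypothesis HC : 0 < Cmu.
Hypothesis HR : forall z, ~ sector mu z -> resolvent_set A z.
Hypothesis HB : forall z, ~ sector mu z -> forall x,
  norm (resolvent A z x) <= Cmu * Rpower (Cmod z) g * norm x.

Notation TT := (raw_semigroup A theta).
Notation GG := (raw_generator A theta).
Notation S := (semigroup theta A).

Definition kappa : C := (/ (RtoC (2 * PI) * Ci))%C.
Notation K := (path_const g Cmu).

Lemma two_pi_i_neq_0 : (RtoC (2 * PI) * Ci)%C <> 0%C.
Proof.
  pose proof PI_RGT_0. apply Cmod_gt_0. rewrite Cmod_mult, Cmod_nonneg_R by lra.
  unfold Ci. rewrite Cmod_pair. replace (0 ^ 2 + 1 ^ 2) with 1 by ring. rewrite sqrt_1. lra.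
Qed.

Lemma Cmod_kappa : Cmod kappa <= 1.
Proof.
  pose proof PI2_1. unfold kappa. rewrite Cmod_inv by apply two_pi_i_neq_0.
  rewrite Cmod_mult, Cmod_nonneg_R by lra.
  unfold Ci. rewrite Cmod_pair. replace (0 ^ 2 + 1 ^ 2) with 1 by ring. rewrite sqrt_1.
  rewrite <- Rinv_1. apply Rinv_le_contravar; lra.
Qed.

Lemma norm_kappa (y : X) B : norm y <= B -> norm (scal kappa y) <= B.
Proof. intros H. rewrite <- (Rmult_1_l B). apply (@norm_scal_bound X); [apply Cmod_kappa | exact H]. Qed.

Lemma semigroup_0 x : S 0 x = x.
Proof. unfold semigroup. destruct (Req_EM_T 0 0) as [_ | N]; [reflexivity | contradiction]. Qed.

Lemma semigroup_pos t x : 0 < t -> S t x = scal kappa (TT t x).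
Proof.
  intros Ht. unfold semigroup. destruct (Req_EM_T t 0) as [E | _]; [lra | reflexivity].
Qed.

Lemma semigroup_linear t : 0 <= t -> is_linear (S t).
Proof.
  intros [Ht | <-].
  - assert (L : is_linear (fun x => scal kappa (TT t x))).
    { apply (@is_linear_comp C_AbsRing X X X (TT t) (fun y => scal kappa y)).
      - exact (raw_semigroup_linear Hg Hmu Htheta HC HR HB Ht).
      - apply is_linear_scal_C. }
    destruct L as [L1 L2 [M [HM L3]]]. split.
    + intros x y. rewrite !semigroup_pos by exact Ht. apply L1.
    + intros k x. rewrite !semigroup_pos by exact Ht. apply L2.
    + exists M. split; [exact HM |]. intros x. rewrite semigroup_pos by exact Ht. apply L3.
  - split.
    + intros x y. rewrite !semigroup_0. reflexivity.
    + intros k x. rewrite !semigroup_0. reflexivity.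
    + exists 1. split; [lra |]. intros x. rewrite semigroup_0. lra.
Qed.

Lemma semigroup_dom t x : 0 < t -> dom A (S t x) /\ A (S t x) = scal kappa (GG t x).
Proof.
  intros Ht. destruct (raw_semigroup_dom Hg Hmu Htheta HC HR HB x Ht) as [D E].
  rewrite semigroup_pos by exact Ht. split; [apply dom_scal, D |].
  rewrite op_scal by exact D. rewrite E. reflexivity.
Qed.

Lemma cos_pos : 0 < cos theta.
Proof. apply cos_gt_0; lra. Qed.

Lemma semigroup_derive t x :
  0 < t -> is_derive (V := real_space X) (fun s => S s x) t (opp (scal kappa (GG t x))).
Proof.
  (* Half of the decay rate at time [t], the largest shift that the expansion allows. *)
  intros Ht. pose proof cos_pos. pose (a := t * cos theta / 2).
  assert (Ha : 0 < a) by (unfold a; nra).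
  apply (@is_derive_of_quadratic (real_space X) _ t a (K * exp_const a * norm x)); [exact Ha |].
  intros y Hy. pose (h := y - t). fold h in Hy. replace y with (t + h) by (unfold h; ring).
  replace (t + h - t) with h by ring.
  assert (Hh : Rabs h <= a) by lra.
  assert (H2 : 2 * a <= t * cos theta) by (unfold a; lra).
  destruct (@shift_pos g mu theta Hg Hmu Htheta t h a Ha H2 Hh) as [_ Hth].
  rewrite !semigroup_pos by assumption.
  match goal with |- @norm _ _ ?v <= ?m => change (@norm C_AbsRing X v <= m) end.
  vreplace X (scal kappa (plus (minus (TT (t + h) x) (TT t x)) (scal (RtoC h) (GG t x)))).
  apply norm_kappa.
  refine (Rle_trans _ _ _ (raw_semigroup_taylor Hg Hmu Htheta HC HR HB h x Ha H2 Hh) _). right; ring.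
Qed.

Lemma generator_continuous t x :
  0 < t -> continuous (fun s => scal kappa (GG s x) : real_space X) t.
Proof.
  intros Ht. pose proof cos_pos. pose (a := t * cos theta / 2).
  assert (Ha : 0 < a) by (unfold a; nra).
  apply (@continuous_of_lipschitz_at (real_space X) _ t a (K * exp_const a * norm x)); [exact Ha |].
  intros y Hy. pose (h := y - t). fold h in Hy. replace y with (t + h) by (unfold h; ring).
  replace (t + h - t) with h by ring.
  assert (Hh : Rabs h <= a) by lra.
  assert (H2 : 2 * a <= t * cos theta) by (unfold a; lra).
  match goal with |- @norm _ _ ?v <= ?m => change (@norm C_AbsRing X v <= m) end.
  vreplace X (scal kappa (minus (GG (t + h) x) (GG t x))).
  apply norm_kappa.
  refine (Rle_trans _ _ _ (raw_generator_lipschitz Hg Hmu Htheta HC HR HB h x Ha H2 Hh) _). right; ring.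
Qed.

(** The case [t = 0] is separate because [Rpower] is an exponential and does not vanish at base
    [0]. *)
Lemma semigroup_near_0 t x :
  0 <= t -> dom A x ->
  norm (minus (S t x) x) <= 2 * K * (if Req_EM_T t 0 then 0 else Rpower t (- g / 2)) * norm (plus (A x) x).
Proof.
  intros Ht Hx. destruct (Req_EM_T t 0) as [-> | N].
  - rewrite semigroup_0. rewrite Rmult_0_r, Rmult_0_l. right.
    rewrite (@minus_eq_zero X). exact (@norm_zero _ X).
  - assert (Ht' : 0 < t) by lra. rewrite semigroup_pos by exact Ht'.
    vreplace X (scal kappa (minus (TT t x) (scal (RtoC (2 * PI) * Ci)%C x))).
    { unfold kappa. field. pose proof two_pi_i_neq_0 as N2. split; intros E; apply N2; rewrite E; ring. }
    apply norm_kappa.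
    refine (Rle_trans _ _ _ (raw_semigroup_near_0 Hg Hmu Htheta HC HR HB x Ht' Hx) _). right; ring.
Qed.

Lemma semigroup_shift_norm t h a x :
  0 < a -> 2 * a <= t * cos theta -> Rabs h <= a ->
  norm (minus (S (t + h) x) (S t x)) <= K * exp_const a * Rabs h * norm x.
Proof.
  intros Ha H2 Hh.
  destruct (@shift_pos g mu theta Hg Hmu Htheta t h a Ha H2 Hh) as [Ht Hth].
  rewrite !semigroup_pos by assumption.
  vreplace X (scal kappa (minus (TT (t + h) x) (TT t x))).
  apply norm_kappa.
  refine (Rle_trans _ _ _ (raw_semigroup_lipschitz Hg Hmu Htheta HC HR HB h x Ha H2 Hh) _). right; ring.
Qed.

(** Product rule: vary [r] with [u s] fixed, then [u] with [r s] fixed. The error is the mixed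
    difference [w], which is of smaller order because the semigroup is Lipschitz in operator norm
    near the positive time [r s] and [u] is continuous. *)
Lemma semigroup_product_derive (r : R -> R) (u : R -> X) (s dr : R) (du : X) :
  0 < r s -> is_derive r s dr -> is_derive (V := real_space X) u s du ->
  is_derive (V := real_space X) (fun y => S (r y) (u y)) s
    (plus (scal (RtoC dr) (opp (scal kappa (GG (r s) (u s))))) (S (r s) du)).
Proof.
  intros Hr Dr Du.
  pose proof (semigroup_linear (Rlt_le _ _ Hr)) as L.
  assert (LR : @is_linear R_AbsRing (real_space X) (real_space X) (S (r s))).
  { split.
    - apply (linear_plus _ L).
    - intros k x. exact (linear_scal _ L (RtoC k) x).
    - exact (linear_norm _ L). }
  pose (w := fun y => minus (minus (S (r y) (u y)) (S (r y) (u s)))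
                            (minus (S (r s) (u y)) (S (r s) (u s))) : real_space X).
  assert (D1 : is_derive (V := real_space X) (fun y => S (r y) (u s)) s
    (scal dr (opp (scal kappa (GG (r s) (u s))) : real_space X))).
  { exact (@is_derive_comp R_AbsRing (real_space X) (fun t => S t (u s)) r s _ dr (semigroup_derive (u s) Hr) Dr). }
  assert (D2 : is_derive (V := real_space X) (fun y => S (r s) (u y)) s (S (r s) du)).
  { pose proof (@filterdiff_comp R_AbsRing R_NormedModule (real_space X) (real_space X) _ _
      u (S (r s)) _ _ Du (@filterdiff_linear R_AbsRing (real_space X) (real_space X) _ _ LR)) as F.
    refine (filterdiff_ext_lin _ _ _ F _). intros y. exact (linear_scal _ LR y du). }
  assert (D3 : is_derive (V := real_space X) w s zero).
  { apply is_derive_zero_of_small.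
    - unfold w. change (minus (minus (S (r s) (u s)) (S (r s) (u s)))
                            (minus (S (r s) (u s)) (S (r s) (u s))) = @zero X). vring X.
    - intros eps He. pose proof cos_pos. pose (a := r s * cos theta / 2).
      assert (Ha : 0 < a) by (unfold a; nra).
      assert (H2 : 2 * a <= r s * cos theta) by (unfold a; lra).
      pose proof (path_const_pos Hg HC) as HK. pose proof (exp_const_pos a) as HE.
      (* Local Lipschitz constant of [y |-> S (r y)]: that of the semigroup times that of [r]. *)
      pose (M := K * exp_const a * (Rabs dr + 1)).
      assert (HM : 0 < M).
      { apply Rmult_lt_0_compat; [apply Rmult_lt_0_compat; assumption | generalize (Rabs_pos dr); lra]. }
      assert (C1 : locally s (fun y => Rabs (r y - r s) < a)).
      { pose proof (@ex_derive_continuous R_AbsRing R_NormedModule r s (ex_intro _ _ Dr)) as Cr.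
        exact (Cr _ (locally_norm_lt (r s) Ha)). }
      assert (C2 : locally s (fun y => norm (minus (u y) (u s)) < eps / M)).
      { pose proof (@ex_derive_continuous R_AbsRing (real_space X) u s (ex_intro _ _ Du)) as Cu.
        exact (Cu _ (@locally_norm_lt (real_space X) (u s) (eps / M) (Rdiv_lt_0_compat _ _ He HM))). }
      pose proof (filter_and _ _ (filter_and _ _ C1 C2) (is_derive_locally_lipschitz Dr)) as HF.
      revert HF. apply filter_imp. intros y [[H3 H4] H5].
      pose (h := r y - r s). fold h in H3, H5.
      match goal with |- @norm _ _ ?v <= ?m => change (@norm C_AbsRing X v <= m) end.
      unfold w. replace (r y) with (r s + h) by (unfold h; ring).
      destruct (@shift_pos g mu theta Hg Hmu Htheta (r s) h a Ha H2 (Rlt_le _ _ H3)) as [_ Hth].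
      pose proof (semigroup_linear (Rlt_le _ _ Hth)) as L'.
      assert (LM : forall t, is_linear (S t) -> S t (minus (u y) (u s)) = minus (S t (u y)) (S t (u s))).
      { intros t Lt. transitivity (plus (S t (u y)) (S t (scal (- (1))%C (u s)))).
        - rewrite <- (linear_plus _ Lt). apply f_equal. vring X.
        - transitivity (plus (S t (u y)) (scal (- (1))%C (S t (u s)))); [| vring X].
          apply f_equal. apply (linear_scal _ Lt). }
      rewrite <- (LM _ L'), <- (LM _ L).
      refine (Rle_trans _ _ _ (semigroup_shift_norm h (minus (u y) (u s)) Ha H2 (Rlt_le _ _ H3)) _).
      apply Rle_trans with (K * exp_const a * ((Rabs dr + 1) * Rabs (y - s)) * (eps / M)).
      + apply Rmult_le_compat; [| apply norm_ge_0 | | left; exact H4].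
        * apply Rmult_le_pos; [left; apply Rmult_lt_0_compat; assumption | apply Rabs_pos].
        * apply Rmult_le_compat_l; [left; apply Rmult_lt_0_compat; assumption | exact H5].
      + right. unfold M. field. generalize (Rabs_pos dr). repeat split; lra. }
  pose proof (@is_derive_plus R_AbsRing (real_space X) _ _ _ _ _
    (@is_derive_plus R_AbsRing (real_space X) _ _ _ _ _ D1 D2)
    (@is_derive_plus R_AbsRing (real_space X) _ _ _ _ _ D3
       (@is_derive_const R_AbsRing (real_space X) (opp (S (r s) (u s))) s))) as D.
  refine (@is_derive_ext R_AbsRing (real_space X) _ _ s _ _ _).
  2:{ refine (eq_ind _ (fun l => is_derive (V := real_space X) _ s l) D _ _).
      change (plus (plus (scal (RtoC dr) (opp (scal kappa (GG (r s) (u s))))) (S (r s) du)) (plus zero zero)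
        = plus (scal (RtoC dr) (opp (scal kappa (GG (r s) (u s))))) (S (r s) du) :> X). vring X. }
  intros y. unfold w.
  change (plus (plus (S (r y) (u s)) (S (r s) (u y)))
    (plus (minus (minus (S (r y) (u y)) (S (r y) (u s))) (minus (S (r s) (u y)) (S (r s) (u s)))) (opp (S (r s) (u s))))
    = S (r y) (u y) :> X). vring X.
Qed.

(** * The time change by the integral of [phi] *)

Section Clock.
Variable phi : R -> R.
Hypothesis Hcont : continuous_on_halfline phi.
Hypothesis Hpos : forall t, 0 < t -> 0 < phi t.

(* Nothing is known about [phi] to the left of [0]. *)
Definition phi_ext (s : R) : R := phi (Rmax 0 s).
Definition clock (t : R) : R := RInt phi_ext 0 t.

(** The retraction [Rmax 0] maps into the half-line and does not increase distances. *)
Lemma phi_ext_continuous s : continuous phi_ext s.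
Proof.
  unfold continuous, phi_ext.
  apply filterlim_comp with (within (Rle 0) (locally (Rmax 0 s))).
  - intros P [d Hd]. exists d. intros y Hy. apply Hd; [| apply Rmax_l].
    change (Rabs (Rmax 0 y - Rmax 0 s) < d). change (Rabs (y - s) < d) in Hy.
    revert Hy. unfold Rmax, Rabs.
    destruct (Rle_dec 0 y), (Rle_dec 0 s); repeat destruct Rcase_abs; lra.
  - apply Hcont, Rmax_l.
Qed.

Lemma phi_ext_pos s : 0 <= s -> phi_ext s = phi s.
Proof. intros H. unfold phi_ext. rewrite Rmax_right by exact H. reflexivity. Qed.

Lemma clock_eq t : 0 <= t -> RInt phi 0 t = clock t.
Proof.
  intros Ht. apply RInt_ext. intros x Hx. rewrite Rmin_left in Hx by exact Ht.
  symmetry. apply phi_ext_pos. lra.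
Qed.

Lemma clock_derive t : is_derive clock t (phi_ext t).
Proof.
  apply (@is_derive_RInt R_CompleteNormedModule phi_ext clock 0 t).
  - apply filter_forall. intros y. apply (@RInt_correct R_CompleteNormedModule).
    apply (@ex_RInt_continuous R_CompleteNormedModule). intros z _. apply phi_ext_continuous.
  - apply phi_ext_continuous.
Qed.

Lemma clock_0 : clock 0 = 0.
Proof. exact (RInt_point 0 phi_ext). Qed.

Lemma clock_increasing a b : 0 <= a < b -> clock a < clock b.
Proof.
  intros H.
  assert (I : is_RInt (V := R_NormedModule) phi_ext a b (clock b - clock a)).
  { apply (@is_RInt_derive R_CompleteNormedModule clock phi_ext).
    - intros x _. apply clock_derive.
    - intros x _. apply phi_ext_continuous. }
  assert (P : 0 < RInt phi_ext a b).
  { apply RInt_gt_0; [apply H | |].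
    - intros x Hx. rewrite phi_ext_pos by lra. apply Hpos. lra.
    - intros x _. apply phi_ext_continuous. }
  rewrite (is_RInt_unique (V := R_CompleteNormedModule) _ _ _ _ I) in P. lra.
Qed.

Lemma clock_ge_0 t : 0 <= t -> 0 <= clock t.
Proof.
  intros [Ht | <-]; [| rewrite clock_0; lra].
  rewrite <- clock_0. left. apply clock_increasing. lra.
Qed.

Lemma clock_continuous t : continuous clock t.
Proof.
  apply (@ex_derive_continuous R_AbsRing R_NormedModule). eexists; apply clock_derive.
Qed.

Lemma solves_semigroup x : solves_equation phi A (fun t => S (clock t) x).
Proof.
  assert (CP : forall t, 0 < t -> 0 < clock t).
  { intros t Ht. rewrite <- clock_0. apply clock_increasing. lra. }
  split; [intros t Ht; apply semigroup_dom, CP, Ht |].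
  exists (fun t => scal (RtoC (phi t)) (opp (scal kappa (GG (clock t) x)))). split; [| split].
  - intros t Ht. rewrite <- phi_ext_pos by lra.
    exact (@is_derive_comp R_AbsRing (real_space X) (fun s => S s x) clock t _ (phi_ext t)
      (semigroup_derive x (CP t Ht)) (clock_derive t)).
  - intros t Ht.
    apply (@continuous_ext_loc R_UniformSpace (real_space X) _
      (fun t => scal (phi_ext t) (opp (scal kappa (GG (clock t) x)) : real_space X))).
    { exists (mkposreal t Ht). intros y Hy. change (Rabs (y - t) < t) in Hy.
      apply Rabs_lt_between in Hy. rewrite phi_ext_pos by lra. reflexivity. }
    apply (@continuous_scal R_UniformSpace R_AbsRing (real_space X)); [apply phi_ext_continuous |].
    apply (@continuous_opp R_UniformSpace R_AbsRing (real_space X)).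
    apply (@continuous_comp R_UniformSpace R_UniformSpace (real_space X) clock
      (fun s => scal kappa (GG s x) : real_space X)); [apply clock_continuous |].
    apply generator_continuous, CP, Ht.
  - intros t Ht. rewrite (proj2 (semigroup_dom x (CP t Ht))). vring X.
Qed.

Lemma Rpower_small (p M eps : R) :
  0 < p -> 0 <= M -> 0 < eps -> exists d, 0 < d /\ forall t, 0 < t < d -> M * Rpower t p <= eps.
Proof.
  intros Hp HM He. pose (c := eps / (M + 1)).
  assert (Hc : 0 < c) by (apply Rdiv_lt_0_compat; lra).
  exists (Rpower c (/ p)). split; [apply exp_pos |]. intros t Ht.
  apply Rle_trans with (M * c).
  - apply Rmult_le_compat_l; [exact HM |]. rewrite <- (@Rpower_base_lt p c) by lra.
    apply Rpower_incr_base; lra.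
  - unfold c. apply Rmult_le_reg_r with (M + 1); [lra |]. field_simplify; [nra | lra].
Qed.

Lemma semigroup_continuous_0 x :
  dom A x -> filterlim (fun t => S (clock t) x) (within (Rle 0) (locally 0)) (locally x).
Proof.
  intros Hx. intros P HP.
  pose proof (@norm_compat1 C_AbsRing X) as NC. destruct HP as [eps HP].
  pose (M := 2 * K * norm (plus (A x) x)).
  assert (HM : 0 <= M).
  { pose proof (path_const_pos Hg HC). apply Rmult_le_pos; [lra | apply norm_ge_0]. }
  destruct (@Rpower_small (- g / 2) M (eps / 2)) as [d [Hd Hsmall]]; [lra | exact HM | generalize (cond_pos eps); lra |].
  unfold filtermap, within.
  pose proof (clock_continuous 0 (locally_norm_lt (clock 0) Hd)) as Hc.
  revert Hc. unfold filtermap. apply filter_imp. intros t Ht H0. apply HP, NC.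
  change (Rabs (clock t - clock 0) < d) in Ht. rewrite clock_0, Rminus_0_r in Ht.
  rewrite Rabs_pos_eq in Ht by (apply clock_ge_0, H0).
  refine (Rle_lt_trans _ _ _ (semigroup_near_0 x (clock_ge_0 H0) Hx) _).
  apply Rle_lt_trans with (eps / 2); [| generalize (cond_pos eps); lra].
  destruct (Req_EM_T (clock t) 0) as [E | N].
  - rewrite Rmult_0_r, Rmult_0_l. generalize (cond_pos eps); lra.
  - replace (2 * K * Rpower (clock t) (- g / 2) * norm (plus (A x) x))
      with (M * Rpower (clock t) (- g / 2)) by (unfold M; ring).
    apply Hsmall. generalize (clock_ge_0 H0). lra.
Qed.

Lemma classical_semigroup x : dom A x -> classical_solution phi A x (fun t => S (clock t) x).
Proof.
  intros Hx. pose proof (solves_semigroup x) as HS. split; [| split].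
  - intros t [Ht | <-].
    + destruct HS as [_ [du [Hdu _]]].
      pose proof (@ex_derive_continuous R_AbsRing (real_space X) _ t (ex_intro _ _ (Hdu t Ht))) as Hc.
      intros P HP. generalize (Hc P HP). unfold filtermap, within. apply filter_imp. auto.
    + rewrite clock_0, semigroup_0. apply semigroup_continuous_0, Hx.
  - exact HS.
  - rewrite clock_0. apply semigroup_0.
Qed.

(* [s |-> T(clock t - clock s) u(s)] is constant on ]0, t[; it tends to [u t]
   at the right end because [A u] stays bounded there, which compensates for
   the singularity of the semigroup at [0]. *)
Lemma classical_solution_unique u0 u t :
  classical_solution phi A u0 u -> 0 < t -> u t = S (clock t) u0.
Proof.
  intros [Hu [[Hdom [du [Hdu [Hcdu Heq]]]] H0]] Ht.
  pose (v := fun s => S (clock t - clock s) (u s)).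
  assert (Hv : forall s, 0 < s < t -> is_derive (V := real_space X) v s zero).
  { intros s Hs.
    assert (Hr : 0 < clock t - clock s).
    { pose proof (@clock_increasing s t ltac:(lra)). lra. }
    assert (Dr : is_derive (fun s => clock t - clock s) s (- phi s)).
    { rewrite <- phi_ext_pos by lra.
      replace (- phi_ext s) with (minus 0 (phi_ext s)) by (unfold minus, plus, opp; simpl; ring).
      apply (@is_derive_minus R_AbsRing R_NormedModule (fun _ => clock t) clock).
      - apply (@is_derive_const R_AbsRing R_NormedModule).
      - apply clock_derive. }
    pose proof (@semigroup_product_derive (fun s => clock t - clock s) u s (- phi s) (du s) Hr Dr (Hdu s ltac:(lra))) as D.
    refine (eq_ind _ (fun l => is_derive (V := real_space X) v s l) D _ _). cbv beta.
    (* With [T] the semigroup at time [clock t - clock s], the product rule gives [phi s] times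
       [A (T (u s))] and [- phi s] times [T (A (u s))]; they cancel because [T] commutes with [A] on
       [D(A)]. *)
    rewrite (Heq s ltac:(lra)). pose proof (semigroup_linear (Rlt_le _ _ Hr)) as L.
    pose proof (Hdom s ltac:(lra)) as Ds.
    assert (E : S (clock t - clock s) (opp (scal (RtoC (phi s)) (A (u s))))
      = opp (scal (RtoC (phi s)) (scal kappa (GG (clock t - clock s) (u s))))).
    { rewrite (raw_generator_op Hg Hmu Htheta HC HR HB (u s) Hr Ds).
      rewrite <- semigroup_pos by exact Hr.
      transitivity (S (clock t - clock s) (scal (- RtoC (phi s))%C (A (u s)))).
      - apply f_equal. vring X.
      - etransitivity; [apply (linear_scal _ L) |]. vring X. }
    rewrite E. change (@zero (real_space X)) with (@zero X). vcoefs X. rewrite RtoC_opp. ring. }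
  assert (Hconst : forall a b, 0 < a -> a <= b -> b < t -> v a = v b).
  { intros a b Ha Hab Hb. apply (@is_derive_const_eq (real_space X) v a b Hab).
    intros s Hs. apply Hv. lra. }
  (* Near [s = 0] the time [clock t - clock s] stays away from [0], so boundedness and norm
     continuity of the semigroup, together with continuity of [u] at [0], suffice. *)
  assert (Near0 : forall eps, 0 < eps -> exists d, 0 < d /\
    forall s, 0 < s < d -> s < t -> norm (minus (v s) (S (clock t) u0)) <= eps).
  { intros eps He. pose proof cos_pos as Hcos.
    assert (Hct : 0 < clock t) by (rewrite <- clock_0; apply clock_increasing; lra).
    pose (a := clock t * cos theta / 2). assert (Ha : 0 < a) by (unfold a; nra).
    assert (H2 : 2 * a <= clock t * cos theta) by (unfold a; lra).
    pose proof (path_const_pos Hg HC) as HK. pose proof (exp_const_pos a) as HE.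
    pose (M := K * exp_const a * (a + norm u0 + 1)). pose proof (norm_ge_0 u0) as Hn.
    assert (HM : 0 < M) by (apply Rmult_lt_0_compat; [apply Rmult_lt_0_compat; assumption | lra]).
    assert (C1 : locally 0 (fun s => Rabs (clock s - clock 0) < Rmin a (eps / M / 2))).
    { assert (Hm : 0 < Rmin a (eps / M / 2)).
      { apply Rmin_glb_lt; [exact Ha |]. pose proof (Rdiv_lt_0_compat _ _ He HM). lra. }
      exact (clock_continuous 0 (locally_norm_lt (clock 0) Hm)). }
    destruct (linear_norm _ (semigroup_linear (Rlt_le _ _ Hct))) as [N [HN BN]].
    (* The [1] keeps [u s] bounded; [eps / (2 * N)] absorbs the bound [N] of the operator at time
       [clock t]. *)
    pose (e2 := Rmin 1 (eps / (2 * N))).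
    assert (He2 : 0 < e2) by (apply Rmin_glb_lt; [lra | apply Rdiv_lt_0_compat; lra]).
    assert (C2 : locally 0 (fun s => 0 <= s -> norm (minus (u s) u0) < e2)).
    { pose proof (Hu 0 (Rle_refl 0)) as H. rewrite H0 in H.
      exact (H _ (@locally_norm_lt (real_space X) u0 e2 He2)). }
    destruct (filter_and _ _ C1 C2) as [d Hd]. exists d. split; [apply cond_pos |].
    intros s Hs Hst. destruct (Hd s) as [B1 B2].
    { change (Rabs (s - 0) < d). rewrite Rminus_0_r, Rabs_pos_eq by lra. apply Hs. }
    specialize (B2 ltac:(lra)). rewrite clock_0, Rminus_0_r in B1.
    rewrite Rabs_pos_eq in B1 by (apply clock_ge_0; lra).
    pose proof (Rlt_le_trans _ _ _ B1 (Rmin_l _ _)) as B3.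
    pose proof (Rlt_le_trans _ _ _ B1 (Rmin_r _ _)) as B4.
    pose proof (@clock_ge_0 s ltac:(lra)) as Hcs.
    unfold v. replace (clock t - clock s) with (clock t + - clock s) by ring.
    vreplace X (plus (minus (S (clock t + - clock s) (u s)) (S (clock t) (u s)))
                     (minus (S (clock t) (u s)) (S (clock t) u0))).
    replace eps with (eps / 2 + eps / 2) by field.
    apply (@norm_plus_bound C_AbsRing X).
    - assert (Hh : Rabs (- clock s) <= a) by (rewrite Rabs_Ropp, Rabs_pos_eq by exact Hcs; lra).
      refine (Rle_trans _ _ _ (semigroup_shift_norm (- clock s) (u s) Ha H2 Hh) _).
      rewrite Rabs_Ropp, Rabs_pos_eq by exact Hcs.
      assert (Bu : norm (u s) <= a + norm u0 + 1).
      { pose proof (norm_le_plus_minus (u s) u0) as T.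
        assert (E1 : norm (minus u0 (u s)) <= 1).
        { refine (Rle_trans _ _ _ (Req_le _ _ (eq_trans (f_equal norm (eq_sym (opp_minus (u s) u0))) (@norm_opp _ X _))) _).
          left. apply Rlt_le_trans with (1 := B2), Rmin_l. }
        apply Rle_trans with (norm u0 + 1); [| lra].
        refine (Rle_trans _ _ _ T _). apply Rplus_le_compat_l. exact E1. }
      apply Rle_trans with (K * exp_const a * (eps / M / 2) * (a + norm u0 + 1)).
      + apply Rmult_le_compat; [| apply norm_ge_0 | | exact Bu].
        * apply Rmult_le_pos; [left; apply Rmult_lt_0_compat; assumption | exact Hcs].
        * apply Rmult_le_compat_l; [left; apply Rmult_lt_0_compat; assumption | lra].
      + right. unfold M. field. repeat split; lra.
    - pose proof (semigroup_linear (Rlt_le _ _ Hct)) as L.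
      assert (E : minus (S (clock t) (u s)) (S (clock t) u0) = S (clock t) (minus (u s) u0)).
      { transitivity (plus (S (clock t) (u s)) (scal (- (1))%C (S (clock t) u0))); [vring X |].
        rewrite <- (linear_scal _ L), <- (linear_plus _ L). apply f_equal. vring X. }
      rewrite E. apply Rle_trans with (1 := BN _).
      apply Rle_trans with (N * (eps / (2 * N))).
      + apply Rmult_le_compat_l; [lra |]. left. apply Rlt_le_trans with (1 := B2), Rmin_r.
      + right. field. lra. }
  assert (NearT : forall eps, 0 < eps -> exists d, 0 < d /\
    forall s, 0 < s < t -> t - d < s -> norm (minus (v s) (u t)) <= eps).
  { intros eps He.
    (* [B] bounds [A (u s) + u s] for [s] near [t]: the equation gives [A (u s) = - du s / phi s],
       where [phi s > phi t / 2], while [u s] and [du s] are within [1] of their values at [t]. *)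
    pose proof (Hpos Ht) as Hphi. pose (B := norm (u t) + 1 + 2 * (norm (du t) + 1) / phi t).
    assert (HB0 : 0 <= B).
    { pose proof (norm_ge_0 (u t)). pose proof (norm_ge_0 (du t)).
      assert (0 <= 2 * (norm (du t) + 1) / phi t) by (apply Rmult_le_pos; [lra | left; apply Rinv_0_lt_compat, Hphi]).
      unfold B. lra. }
    pose proof (path_const_pos Hg HC) as HK.
    destruct (@Rpower_small (- g / 2) (2 * K * B) (eps / 2)) as [eta [Heta Hsmall]]; [lra | apply Rmult_le_pos; lra | lra |].
    pose proof (clock_continuous t (locally_norm_lt (clock t) Heta)) as C1.
    pose (e2 := Rmin 1 (eps / 2)).
    assert (He2 : 0 < e2) by (apply Rmin_glb_lt; lra).
    pose proof (@ex_derive_continuous R_AbsRing (real_space X) u t (ex_intro _ _ (Hdu t Ht))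
      _ (@locally_norm_lt (real_space X) (u t) e2 He2)) as C2.
    pose proof (Hcdu t Ht _ (@locally_norm_lt (real_space X) (du t) 1 Rlt_0_1)) as C3.
    assert (Hphi2 : 0 < phi t / 2) by lra.
    pose proof (phi_ext_continuous (s := t) (locally_norm_lt (phi_ext t) Hphi2)) as C4.
    unfold filtermap in C1, C2, C3, C4.
    destruct (filter_and _ _ (filter_and _ _ C1 C2) (filter_and _ _ C3 C4)) as [d Hd].
    exists d. split; [apply cond_pos |]. intros s Hs Hsd.
    destruct (Hd s) as [[B1 B2] [B3 B4]].
    { change (Rabs (s - t) < d). apply Rabs_def1; lra. }
    change (Rabs (clock s - clock t) < eta) in B1.
    change (Rabs (phi_ext s - phi_ext t) < phi t / 2) in B4.
    rewrite !phi_ext_pos in B4 by lra.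
    change (@norm C_AbsRing X (minus (u s) (u t)) < e2) in B2.
    change (@norm C_AbsRing X (minus (du s) (du t)) < 1) in B3.
    apply Rabs_lt_between in B1. apply Rabs_lt_between in B4.
    pose proof (@clock_increasing s t ltac:(lra)) as Hr.
    unfold v. vreplace X (plus (minus (S (clock t - clock s) (u s)) (u s)) (minus (u s) (u t))).
    replace eps with (eps / 2 + eps / 2) by field.
    apply (@norm_plus_bound C_AbsRing X); [| left; apply Rlt_le_trans with (1 := B2), Rmin_r].
    assert (NM : forall (a b : X) e, norm (minus a b) < e -> norm a <= norm b + e).
    { intros p q e He'. vreplace X (plus q (minus p q)).
      apply (@norm_plus_bound C_AbsRing X); [apply Rle_refl | left; exact He']. }
    pose proof (Hdom s ltac:(lra)) as Ds.
    assert (Hps : phi t / 2 < phi s) by lra.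
    assert (BA : norm (plus (A (u s)) (u s)) <= B).
    { unfold B. rewrite Rplus_comm. apply (@norm_plus_bound C_AbsRing X).
      - assert (NZ : RtoC (phi s) <> 0%C) by (intros E; apply RtoC_inj in E; lra).
        vreplace X (scal (- / RtoC (phi s))%C (opp (scal (RtoC (phi s)) (A (u s))))).
        { field. exact NZ. }
        rewrite <- (Heq s ltac:(lra)).
        replace (2 * (norm (du t) + 1) / phi t) with (/ (phi t / 2) * (norm (du t) + 1)) by (field; lra).
        apply (@norm_scal_bound X); [| apply NM, B3].
        rewrite Cmod_opp, Cmod_inv, Cmod_nonneg_R by (try exact NZ; lra).
        apply Rinv_le_contravar; lra.
      - apply NM. apply Rlt_le_trans with (1 := B2), Rmin_l. }
    assert (Hr0 : 0 <= clock t - clock s) by lra.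
    refine (Rle_trans _ _ _ (semigroup_near_0 (u s) Hr0 Ds) _).
    destruct (Req_EM_T (clock t - clock s) 0) as [E | _]; [lra |].
    specialize (Hsmall (clock t - clock s) ltac:(lra)).
    refine (Rle_trans _ _ _ _ Hsmall).
    replace (2 * K * B * Rpower (clock t - clock s) (- g / 2))
      with (2 * K * Rpower (clock t - clock s) (- g / 2) * B) by ring.
    apply Rmult_le_compat_l; [| exact BA].
    apply Rmult_le_pos; [lra | apply Rpower_ge_0]. }
  apply (@eq_of_norm_le C_AbsRing X). intros eps He.
  destruct (@Near0 (eps / 2) ltac:(lra)) as [d0 [Hd0 N0]].
  destruct (@NearT (eps / 2) ltac:(lra)) as [d1 [Hd1 N1]].
  (* [s0 <= t / 2 <= s1] orders the two points inside [(0, t)], where [v] is constant, and each lies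
     in the range of its own estimate. *)
  pose (s0 := Rmin (d0 / 2) (t / 2)). pose (s1 := Rmax (t - d1 / 2) (t / 2)).
  assert (P0 : 0 < s0 <= d0 / 2 /\ s0 <= t / 2).
  { unfold s0. repeat split; [apply Rmin_glb_lt; lra | apply Rmin_l | apply Rmin_r]. }
  assert (P1 : t - d1 / 2 <= s1 < t /\ t / 2 <= s1).
  { unfold s1. repeat split; [apply Rmax_l | apply Rmax_lub_lt; lra | apply Rmax_r]. }
  specialize (N0 s0 ltac:(lra) ltac:(lra)). specialize (N1 s1 ltac:(lra) ltac:(lra)).
  rewrite (Hconst s0 s1) in N0 by lra.
  vreplace X (plus (opp (minus (v s1) (u t))) (minus (v s1) (S (clock t) u0))).
  replace eps with (eps / 2 + eps / 2) by field.
  apply (@norm_plus_bound C_AbsRing X); [| exact N0].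
  exact (Rle_trans _ _ _ (Req_le _ _ (@norm_opp _ X _)) N1).
Qed.

End Clock.
End Evolution.

(** * From the almost sectorial family to a single operator *)

Unset Implicit Arguments.

Theorem theorem5p2 :
  forall (X : CompleteNormedModule C_AbsRing) (gamma omega : R)
    (A : R -> operator X) (phi : R -> R),
  -1 < gamma < 0 ->
  0 < omega < PI / 2 ->
  almost_sectorial gamma omega A ->
  continuous_on_halfline phi ->
  (forall t, 0 <= t -> 0 <= phi t) ->
  (forall t, 0 < t -> 0 < phi t) ->
  forall theta, omega < theta < PI / 2 ->
  forall tau, 0 <= tau ->
  solution_operator phi (A tau)
    (fun t u0 => semigroup theta (A tau) (RInt phi 0 t) u0).
Proof.
  intros X gamma omega A phi Hgamma Homega [_ [Hspec Hbound]] Hphi Hnonneg Hpos theta Htheta tau Htau.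
  (* The resolvent bound needs an angle strictly above [omega], and the contour must lie strictly
     outside the sector of that angle. *)
  pose (mu := (omega + theta) / 2).
  destruct (Hbound mu) as [Cmu [HC HB]]; [unfold mu; generalize PI_RGT_0; lra |].
  specialize (HB tau Htau).
  assert (Hmu : 0 < mu < theta) by (unfold mu; lra).
  (* The spectrum lies in the smaller sector of angle [omega]. It is defined as a negation, so
     membership in the resolvent set comes by double negation. *)
  assert (HR : forall z, ~ sector mu z -> resolvent_set (A tau) z).
  { intros z Hz. apply NNPP. intros N. apply Hz.
    destruct (Hspec tau Htau z N) as [E | (al & Hal & Hb)]; [left; exact E |].
    right. exists al. split; [exact Hal |]. unfold mu; lra. }
  assert (Htheta2 : theta < PI / 2) by lra.
  assert (Hclock : forall t, 0 <= t -> RInt phi 0 t = clock phi t) by (intros; apply clock_eq; assumption).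
  split; [| split; [| split]].
  - intros t Ht. rewrite (Hclock t Ht).
    apply (semigroup_linear Hgamma Hmu Htheta2 HC HR HB), clock_ge_0; assumption.
  - intros u0 u Hu t [Ht | <-].
    + rewrite (Hclock t (Rlt_le _ _ Ht)).
      exact (classical_solution_unique Hgamma Hmu Htheta2 HC HR HB Hphi Hpos Hu Ht).
    + rewrite RInt_point. rewrite semigroup_0. apply Hu.
  - intros u0. split.
    + rewrite RInt_point. apply semigroup_0.
    + apply solves_equation_ext with (2 := solves_semigroup Hgamma Hmu Htheta2 HC HR HB Hphi Hpos u0).
      intros t Ht. rewrite (Hclock t (Rlt_le _ _ Ht)). reflexivity.
  - intros u0 Hu0.
    apply classical_solution_ext with (2 := classical_semigroup Hgamma Hmu Htheta2 HC HR HB Hphi Hpos u0 Hu0).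
    intros t Ht. rewrite (Hclock t Ht). reflexivity.
Qed.
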